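(* Let $G$ be a connected compact Lie group, let $K$ be a massive closed subgroup of $G$, let $W$ be an irreducible unitary representation of $K$ on a finite-dimensional complex Hilbert space $H$, and let $\xi=(\mathcal{E}_W,\pi,T)$, $T=G/K$, be the corresponding homogeneous vector bundle. Let $\mathbf X(t)$ be a random field in $\xi$, with coordinates $X_j(t)$ in the chart of $T$ with dense domain $D_T$ described in the context. The following statements are equivalent. 1. $\mathbf{X}(t)$ is a mean square continuous wide sense (left $G$-)invariant random field in $\xi$. 2. $\mathbf{X}(t)$ has, in this chart, the form \[ X_j(t)=\sum_{V\in\hat{G}_K(W)}\sum_{m=1}^{\dim V}\sum_{n=1}^{\dim W}Z_{mn}^{(V)}\,({}_W\mathbf{Y}_{Vm})_j(t),\qquad 1\le j\le\dim W, \] where $Z_{mn}^{(V)}$, $V\in\hat{G}_K(W)$, $1\leq m\leq\dim V$, $1\leq n\leq\dim W$, are random variables satisfying the following conditions: (a) if $V\neq V_0$, then $\mathsf{E}[Z_{mn}^{(V)}]=0$; (b) $\mathsf{E}[Z_{mn}^{(V)}\overline{Z_{m'n'}^{(V')}}]=\delta_{VV'}\delta_{mm'}R^{(V)}_{nn'}$, with \[ \sum_{V\in\hat{G}_K(W)}\dim V\,\operatorname{tr}[R^{(V)}]<\infty . \]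
   Context: Inner products are linear in the first argument. $(\Omega,\mathfrak F,\mathsf P)$ is a probability space with expectation $\mathsf E$; random variables are complex-valued. $V_0$ is the trivial irreducible representation of $G$. $R^{(V)}=(R^{(V)}_{nn'})_{1\le n,n'\le\dim W}$ is a matrix for each $V$, $\operatorname{tr}$ is the trace and $\delta$ the Kronecker symbol. $\hat G$ and $\hat K$ denote the sets of equivalence classes of irreducible unitary representations of $G$ and $K$. $K$ is massive in $G$ if for all $V\in\hat G$ and all $U\in\hat K$ the multiplicity of $U$ in the restriction of $V$ to $K$ is $0$ or $1$. $\hat G_K(W)$ is the set of $V\in\hat G$ whose restriction to $K$ contains $W$. Homogeneous bundle: $\mathcal E_W$ is the quotient of $G\times H$ by the action $k(g,\mathbf x)=(gk,W(k^{-1})\mathbf x)$ of $K$; $[g,\mathbf x]$ is the class of $(g,\mathbf x)$, and $\pi[g,\mathbf x]=gK$. Each fibre carries the inner product induced from $H$. $G$ acts on $T$ by $g(g_0K)=gg_0K$ and on $\mathcal E_W$ by the associated action $g[g_0,\mathbf x]=[gg_0,\mathbf x]$. A random field in $\xi$ is a collection of random vectors $\mathbf X(t)$, $t\in T$, with $\mathbf X(t)\in\pi^{-1}(t)$. Its associated scalar field on $\mathcal E_W$ is $X(t,\mathbf x)=(\mathbf x,\mathbf X(t))_{\pi^{-1}(t)}$, $\mathbf x\in\pi^{-1}(t)$. $\mathbf X$ is mean square continuous if $(t,\mathbf x)\mapsto X(t,\mathbf x)$ is a continuous map $\mathcal E_W\to L^2_{\mathbb C}(\Omega,\mathfrak F,\mathsf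 P)$. $\mathbf X$ is wide sense left $G$-invariant if for all $g\in G$, $s,t\in T$, $\mathbf x\in\pi^{-1}(s)$, $\mathbf y\in\pi^{-1}(t)$ one has $\mathsf E[X(gs,g\mathbf x)]=\mathsf E[X(s,\mathbf x)]$ and $\mathsf E[X(gs,g\mathbf x)\overline{X(gt,g\mathbf y)}]=\mathsf E[X(s,\mathbf x)\overline{X(t,\mathbf y)}]$. Chart: $D_G\subset G$ is open and dense, and $\mathbf J=(\theta_1,\dots,\theta_{\dim G})\colon D_G\to\mathbb R^{\dim G}$ is a chart of $G$ such that, if $k\in K$ and both $g$ and $gk$ lie in $D_G$, then $\theta_j(gk)=\theta_j(g)$ for $1\le j\le\dim T$. Put $D_T=\{gK: g\in D_G\}$; then $(\theta_1,\dots,\theta_{\dim T})$ is a chart of $T$ whose domain $D_T$ is dense in $T$. Values $\theta^{(0)}_{\dim T+1},\dots,\theta^{(0)}_{\dim G}$ of the remaining coordinates are fixed, and for $t\in D_T$ the element of $D_G$ with coordinates $(\theta_1(t),\dots,\theta_{\dim T}(t),\theta^{(0)}_{\dim T+1},\dots,\theta^{(0)}_{\dim G})$ is denoted $g_t$; it satisfies $g_tK=t$. Fix an orthonormal basis $\mathbf e_1,\dots,\mathbf e_{\dim W}$ of $H$. For $t\in D_T$ write $\mathbf X(t)=[g_t,\mathbf x(t)]$; the coordinates of $\mathbf X(t)$ are $X_j(t)=(\mathbf x(t),\mathbf e_j)$. Basis functions: for $V\in\hat G_K(W)$ acting on $H_V$, let $i_V\colon H\to H_V$ be the ($K$-equivariant,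 isometric) embedding, and fix an orthonormal basis $\mathbf e^{(V)}_1,\dots,\mathbf e^{(V)}_{\dim V}$ of $H_V$ with $i_V\mathbf e_j=\mathbf e^{(V)}_{p+j}$, $1\le j\le\dim W$, for some $p\ge0$. Let $V_{m,n}(g)=(V(g)\mathbf e^{(V)}_n,\mathbf e^{(V)}_m)$ be the matrix elements of $V$. For $t\in D_T$, \[ ({}_W\mathbf Y_{Vm})_j(t)=\sqrt{\frac{\dim V}{\dim W}}\;\overline{V_{m,p+j}(g_t)},\qquad 1\le j\le\dim W . \]
   Formalization: Statement 2 additionally requires that at points of T outside the dense chart domain D_T the field is the mean square limit of its values over D_T; without this 2⇒1 fails (change X at one point outside D_T), and statement 1 implies it. *)

(* Defs.v *)
From HB Require Import structures.
From mathcomp Require Import all_boot all_order all_algebra.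
From mathcomp Require Import generic_quotient finmap complex.
From mathcomp Require Import all_classical all_reals all_analysis.
Set Implicit Arguments.
Unset Strict Implicit.
Unset Printing Implicit Defensive.
Import Order.TTheory GRing.Theory Num.Theory numFieldNormedType.Exports.
Local Open Scope classical_set_scope.
Local Open Scope ring_scope.
Local Open Scope complex_scope.
Local Open Scope quotient_scope.

Section smooth.
Context {R : realType}.

Fixpoint Ck (k m : nat) (A : set 'rV[R]_m) (f : 'rV[R]_m -> R) : Prop :=
  (forall x, A x -> {for x, continuous f}) /\
  if k is k'.+1 then
    forall i : 'I_m,
      (forall x, A x -> derivable f x (delta_mx 0 i)) /\
      Ck k' A (fun x => 'D_(delta_mx 0 i) f x)
  else True.

Definition smooth_on (m n : nat) (A : set 'rV[R]_m) (f : 'rV[R]_m -> 'rV[R]_n) :=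
  forall k (j : 'I_n), Ck k A (fun x => f x 0 j).
End smooth.

Record chart (R : realType) (n : nat) (G : topologicalType) := Chart {
  cdom : set G;
  cfun :> G -> 'rV[R]_n;
  cinv : 'rV[R]_n -> G;
  cdom_open : open cdom;
  cimg_open : open (cfun @` cdom);
  cfunK : forall g, cdom g -> cinv (cfun g) = g;
  cfun_cts : {within cdom, continuous cfun};
  cinv_cts : {within cfun @` cdom, continuous cinv} }.

Definition compatible (R : realType) (n : nat) (G : topologicalType)
    (a b : chart R n G) :=
  smooth_on (a @` (cdom a `&` cdom b)) (b \o cinv a).

HB.mixin Record isLieGroup (R : realType) (n : nat) G of Group G & Topological G := {
  lie_hausdorff : hausdorff_space G;
  lie_second_countable : @second_countable G;
  mulg_cts : continuous (fun p : G * G => (p.1 * p.2)%g);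
  invg_cts : continuous (fun g : G => (g^-1)%g);
  atlas : set (chart R n G);
  atlas_cover : forall g, exists2 c, atlas c & cdom c g;
  atlas_compatible : forall a b, atlas a -> atlas b -> compatible a b;
  mulg_smooth : forall a b c, atlas a -> atlas b -> atlas c ->
    smooth_on
      [set w : 'rV[R]_(n + n) | exists g h,
         [/\ cdom a g, cdom b h, cdom c (g * h)%g & w = row_mx (a g) (b h)]]
      (fun w => c (cinv a (lsubmx w) * cinv b (rsubmx w))%g);
  invg_smooth : forall a b, atlas a -> atlas b ->
    smooth_on (a @` [set g | cdom a g /\ cdom b (g^-1)%g])
      (fun u => b ((cinv a u)^-1)%g) }.

#[short(type="lieGroupType")]
HB.structure Definition LieGroup (R : realType) (n : nat) :=
  {G of Group G & Topological G & isLieGroup R n G}.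

Record closedSubgroup (R : realType) (n : nat) (G : lieGroupType R n) :=
  ClosedSubgroup {
    sgset :> set G;
    sg_closed : closed sgset;
    sg1 : sgset 1%g;
    sgM : forall k l, sgset k -> sgset l -> sgset (k * l)%g;
    sgV : forall k, sgset k -> sgset (k^-1)%g }.

Definition onb (R : realType) (H : normedModType R[i]) (dot : H -> H -> R[i])
    (d : nat) (e : 'I_d -> H) :=
  (forall i j, dot (e i) (e j) = (i == j)%:R) /\
  (forall x, x = \sum_i dot x (e i) *: e i).

(* Finite dimension is expressed by the existence of a finite orthonormal
   basis; the topology of the space is that of the norm of the inner product. *)
Record fdHilbert (R : realType) := FdHilbert {
  hspace :> normedModType R[i];
  hdot : hspace -> hspace -> R[i];
  hdot_linear : forall a x y z, hdot (a *: x + y) z = a * hdot x z + hdot y z;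
  hdot_conj : forall x y, hdot y x = (hdot x y)^*;
  hdot_norm : forall x, hdot x x = `|x| ^+ 2;
  hfin : exists d (e : 'I_d -> hspace), onb hdot e }.

Section representations.
Context {R : realType} {n : nat} {G : lieGroupType R n}.

(* A representation of a subset S of G (in practice S = K or S = G) is given by
   a function on the whole of G whose values outside S are irrelevant; with
   this convention, restricting a representation amounts to changing S. *)
Record urep (S : set G) (H : fdHilbert R) := URep {
  rep_fun :> G -> H -> H;
  rep_linear : forall k a x y, S k ->
    rep_fun k (a *: x + y) = a *: rep_fun k x + rep_fun k y;
  rep1 : forall x, rep_fun 1%g x = x;
  repM : forall k l x, S k -> S l ->
    rep_fun (k * l)%g x = rep_fun k (rep_fun l x);
  rep_unitary : forall k x y, S k ->
    hdot (rep_fun k x) (rep_fun k y) = hdot x y;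
  rep_cts : forall x, {within S, continuous (fun k => rep_fun k x)} }.

Definition subspace_of (H : fdHilbert R) (E : set H) :=
  E 0 /\ forall a x y, E x -> E y -> E (a *: x + y).

Definition irreducible (S : set G) (H : fdHilbert R) (U : G -> H -> H) :=
  (exists x : H, x != 0) /\
  forall E : set H, subspace_of E ->
    (forall k x, S k -> E x -> E (U k x)) -> E = [set 0] \/ E = setT.

Definition intertwiner (S : set G) (H H' : fdHilbert R)
    (U : G -> H -> H) (U' : G -> H' -> H') (f : H -> H') :=
  (forall a x y, f (a *: x + y) = a *: f x + f y) /\
  (forall k x, S k -> f (U k x) = U' k (f x)).

Definition isometric (H H' : fdHilbert R) (f : H -> H') :=
  forall x y, hdot (f x) (f y) = hdot x y.

Definition equivalent (S : set G) (H H' : fdHilbert R)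
    (U : G -> H -> H) (U' : G -> H' -> H') :=
  exists f : H -> H', [/\ intertwiner S U U' f, isometric f & bijective f].

Definition contains (S : set G) (H H' : fdHilbert R)
    (U' : G -> H' -> H') (U : G -> H -> H) :=
  exists f : H -> H', intertwiner S U U' f /\ isometric f.

(* The multiplicity of the irreducible representation U in U' is the dimension
   of the space of intertwiners from U to U'. *)
Definition has_multiplicity (S : set G) (H H' : fdHilbert R)
    (U' : G -> H' -> H') (U : G -> H -> H) (m : nat) :=
  exists f : 'I_m -> H -> H',
    (forall l, intertwiner S U U' (f l)) /\
    (forall h, intertwiner S U U' h ->
      exists! c : {ffun 'I_m -> R[i]}, h = fun x => \sum_l c l *: f l x).

Definition massive (K : closedSubgroup G) :=
  forall (HV : fdHilbert R) (V : urep setT HV) (HU : fdHilbert R) (U : urep K HU),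
    irreducible setT V -> irreducible K U ->
    has_multiplicity K V U 0 \/ has_multiplicity K V U 1.

End representations.

Section bundle.
Context {R : realType} {n : nat} {G : lieGroupType R n} (K : closedSubgroup G).

Definition coset_rel (g h : G) : bool := `[< sgset K (g^-1 * h)%g >].

Lemma coset_rel_refl : reflexive coset_rel.
Proof. by move=> g; apply/asboolP; rewrite mulVg; exact: sg1. Qed.

Lemma coset_rel_sym : symmetric coset_rel.
Proof.
move=> g h; apply/asboolP/asboolP => /sgV; by rewrite invgM invgK.
Qed.

Lemma coset_rel_trans : transitive coset_rel.
Proof.
move=> h g k /asboolP gh /asboolP hk; apply/asboolP.
by have := sgM gh hk; rewrite -mulgA mulVKg.
Qed.

Canonical coset_equiv :=
  EquivRel coset_rel coset_rel_refl coset_rel_sym coset_rel_trans.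

Definition homspace := quotient_topology {eq_quot coset_equiv}.
HB.instance Definition _ := Topological.on homspace.
HB.instance Definition _ := Quotient.on homspace.

Context {H : fdHilbert R} (W : urep K H).

Definition bundle_rel (p q : G * H) : bool :=
  `[< exists k, sgset K k /\ q = ((p.1 * k)%g, W (k^-1)%g p.2) >].

Lemma bundle_rel_refl : reflexive bundle_rel.
Proof.
move=> [g x]; apply/asboolP; exists 1%g; split; first exact: sg1.
by rewrite mulg1 invg1 rep1.
Qed.

Lemma bundle_rel_sym : symmetric bundle_rel.
Proof.
suff S p q : bundle_rel p q -> bundle_rel q p by move=> p q; apply/idP/idP => /S.
move: p q => [g x] [h y] /asboolP[k [Kk [-> ->]]]; apply/asboolP.
exists (k^-1)%g; split; first exact: sgV.
by rewrite /= mulgK invgK -repM ?mulgV ?rep1//; exact: sgV.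
Qed.

Lemma bundle_rel_trans : transitive bundle_rel.
Proof.
move=> [h y] [g x] [l z] /asboolP[k [Kk [-> ->]]] /asboolP[k' [Kk' [-> ->]]].
apply/asboolP; exists (k * k')%g; split; first exact: sgM.
by rewrite /= mulgA invgM repM//; exact: sgV.
Qed.

Canonical bundle_equiv :=
  EquivRel bundle_rel bundle_rel_refl bundle_rel_sym bundle_rel_trans.

Definition bundle := quotient_topology {eq_quot bundle_equiv}.
HB.instance Definition _ := Topological.on bundle.
HB.instance Definition _ := Quotient.on bundle.

Definition coset (g : G) : homspace := \pi_homspace g.
Definition bcls (g : G) (x : H) : bundle := \pi_bundle (g, x).
Definition bproj (p : bundle) : homspace := coset (repr p).1.

(* The vector x with p = [g, x]; meaningful when p lies over gK. *)
Definition bcoord (g : G) (p : bundle) : H :=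
  W (g^-1 * (repr p).1)%g (repr p).2.

(* Meaningful when p and q lie in the same fibre. *)
Definition fib_dot (p q : bundle) : R[i] :=
  hdot (bcoord (repr p).1 p) (bcoord (repr p).1 q).

Definition bact (g : G) (p : bundle) : bundle :=
  bcls (g * (repr p).1)%g (repr p).2.

Lemma coset_eq g h : coset g = coset h <-> sgset K (g^-1 * h)%g.
Proof.
rewrite /coset; split => [/(@eqmodP _ coset_equiv)|Kgh]; first by move/asboolP.
by apply/(@eqmodP _ coset_equiv)/asboolP.
Qed.

Lemma bcls_eq g x h y : bcls g x = bcls h y <->
  exists k, sgset K k /\ (h, y) = ((g * k)%g, W (k^-1)%g x).
Proof.
rewrite /bcls; split => [/(@eqmodP _ bundle_equiv)|kP]; first by move/asboolP.
by apply/(@eqmodP _ bundle_equiv)/asboolP.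
Qed.

Lemma bcls_repr p : bcls (repr p).1 (repr p).2 = p.
Proof. by rewrite /bcls -surjective_pairing reprK. Qed.

Lemma bproj_cls g x : bproj (bcls g x) = coset g.
Proof.
have /bcls_eq[k [Kk]] := bcls_repr (bcls g x); rewrite /bproj.
case: (repr _) => h y [gE _] /=; apply/coset_eq; by rewrite gE mulKg.
Qed.

Lemma bcoordK g p : bproj p = coset g -> bcls g (bcoord g p) = p.
Proof.
move=> /coset_eq Kg; rewrite -[RHS]bcls_repr; apply/bcls_eq.
exists (g^-1 * (repr p).1)%g; have := sgV Kg; rewrite invgM invgK => Kg'.
split => //; rewrite mulVKg /bcoord -repM// ?mulVg ?rep1.
  by rewrite -surjective_pairing.
exact: sgV.
Qed.

Lemma bcoord_cls g x : bcoord g (bcls g x) = x.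
Proof.
have /bcls_eq[k [Kk]] := bcls_repr (bcls g x).
rewrite /bcoord; case: (repr _) => h y /= [-> ->].
by rewrite invgM mulgVK.
Qed.

Lemma fib_dot_cls g x y : fib_dot (bcls g x) (bcls g y) = hdot x y.
Proof.
rewrite /fib_dot; set h := (repr (bcls g x)).1.
have Kh : sgset K (h^-1 * g)%g.
  by apply: (iffLR (coset_eq _ _)); rewrite -[LHS]/(bproj _) bproj_cls.
have hE z : bcoord h (bcls g z) = W (h^-1 * g)%g z.
  rewrite -[in RHS](bcoord_cls g z) /bcoord -repM//.
    by rewrite mulgA -(mulgA h^-1%g) mulgV mulg1.
  by apply: (iffLR (coset_eq _ _)); rewrite -[RHS]/(bproj _) bproj_cls.
by rewrite !hE rep_unitary.
Qed.

Lemma bact_cls h g x : bact h (bcls g x) = bcls (h * g)%g x.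
Proof.
have /bcls_eq[k [Kk]] := bcls_repr (bcls g x); rewrite /bact.
case: (repr _) => l y /= [-> ->]; apply/bcls_eq.
by exists k; split => //; rewrite mulgA.
Qed.
End bundle.

Arguments coset {R n G}.


Section probability.
Context {R : realType} d (Omega : measurableType d) (P : probability Omega R).

Definition complex_rv (Z : Omega -> R[i]) :=
  measurable_fun setT (fun w => complex.Re (Z w)) /\
  measurable_fun setT (fun w => complex.Im (Z w)).

(* Meaningful when Z is integrable. *)
Definition cexpect (Z : Omega -> R[i]) : R[i] :=
  fine 'E_P[fun w => complex.Re (Z w)] +i* fine 'E_P[fun w => complex.Im (Z w)].

(* E |Z|^2 *)
Definition sqmean (Z : Omega -> R[i]) : \bar R :=
  'E_P[fun w => complex.Re (Z w) ^+ 2 + complex.Im (Z w) ^+ 2].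

Definition square_integrable (Z : Omega -> R[i]) :=
  complex_rv Z /\ (sqmean Z < +oo)%E.

(* Unconditional convergence in L^2(P): convergence along the directed set of
   finite subsets of the index set. *)
Definition L2_sum (I : choiceType) (Z : I -> Omega -> R[i])
    (S : Omega -> R[i]) :=
  forall eps : R, 0 < eps -> exists F0 : {fset I}, forall F : {fset I},
    (F0 `<=` F)%fset ->
    (sqmean (fun w => (S w - \sum_(i <- F) Z i w)%R) < eps%:E)%E.

End probability.

Section fields.
Context {R : realType} {n : nat} {G : lieGroupType R n} {K : closedSubgroup G}.
Context {H : fdHilbert R} (W : urep K H).
Context d (Omega : measurableType d).

Record random_field := RandomField {
  rf :> homspace K -> Omega -> bundle W;
  rf_fibre : forall t w, bproj (rf t w) = t;
  rf_measurable : forall p : bundle W,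
    complex_rv (fun w => fib_dot p (rf (bproj p) w)) }.

Definition scalar_field (X : random_field) (p : bundle W) (w : Omega) : R[i] :=
  fib_dot p (X (bproj p) w).

Context (P : probability Omega R).

Definition ms_continuous (X : random_field) :=
  (forall p, square_integrable P (scalar_field X p)) /\
  (forall p, sqmean P (fun w => (scalar_field X q w - scalar_field X p w)%R)
     @[q --> p] --> 0%E).

Definition wide_sense_invariant (X : random_field) :=
  (forall g p,
     cexpect P (scalar_field X (bact g p)) = cexpect P (scalar_field X p)) /\
  (forall g p q,
     cexpect P (fun w =>
       scalar_field X (bact g p) w * (scalar_field X (bact g q) w)^*) =
     cexpect P (fun w => scalar_field X p w * (scalar_field X q w)^*)).

(* A condition imposed in coordinates over D says nothing about the random
   vectors X t for t outside D; this one ties them to the values over D.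
   At the points over the complement of D, X is the mean square limit of its
   values over D. *)
Definition ms_extends_from (D : set (homspace K)) (X : random_field) :=
  forall p, ~ D (bproj p) ->
    sqmean P (fun w => (scalar_field X q w - scalar_field X p w)%R)
      @[q --> within [set q | D (bproj q)] (nbhs p)] --> 0%E.

End fields.

(* ac_sec t is the element g_t.  By ac_const the first q coordinates descend to
   G/K; by ac_sec_chart and ac_sec_coset they are injective on the image of the
   domain, hence (being open and continuous there, the projection of G onto G/K
   being open) they form a chart of G/K.  This forces q to be the dimension of
   G/K and r that of K. *)
Record adapted_chart (R : realType) (q r : nat) (G : lieGroupType R (q + r))
    (K : closedSubgroup G) := AdaptedChart {
  ac_chart :> chart R (q + r) G;
  ac_smooth : forall a, atlas a -> compatible a ac_chart /\ compatible ac_chart a;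
  ac_dense : dense (cdom ac_chart);
  ac_const : forall g k, sgset K k ->
    cdom ac_chart g -> cdom ac_chart (g * k)%g ->
    lsubmx (ac_chart (g * k)%g) = lsubmx (ac_chart g);
  ac_theta0 : 'rV[R]_r;
  ac_sec : homspace K -> G;
  ac_sec_dom : forall g, cdom ac_chart g -> cdom ac_chart (ac_sec (coset K g));
  ac_sec_chart : forall g, cdom ac_chart g ->
    ac_chart (ac_sec (coset K g)) = row_mx (lsubmx (ac_chart g)) ac_theta0;
  ac_sec_coset : forall g, cdom ac_chart g -> coset K (ac_sec (coset K g)) = coset K g }.

Definition ac_dom (R : realType) (q r : nat) (G : lieGroupType R (q + r))
    (K : closedSubgroup G) (J : adapted_chart K) : set (homspace K) :=
  coset K @` cdom J.

Section harmonics.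
Context {R : realType} {n : nat} {G : lieGroupType R n} {K : closedSubgroup G}.
Context {H : fdHilbert R} (W : urep K H) (dimW : nat) (e : 'I_dimW -> H).

(* An irreducible representation V of G containing W, with the embedding i_V
   and the orthonormal basis of H_V: a_shift is p and a_idx j is p + j. *)
Record adapted_irrep := AdaptedIrrep {
  a_space : fdHilbert R;
  a_rep :> urep [set: G] a_space;
  a_irr : irreducible setT a_rep;
  a_dim : nat;
  a_basis : 'I_a_dim -> a_space;
  a_onb : onb (@hdot _ a_space) a_basis;
  a_emb : H -> a_space;
  a_emb_intertwiner : intertwiner K W a_rep a_emb;
  a_emb_isometric : isometric a_emb;
  a_shift : nat;
  a_idx : 'I_dimW -> 'I_a_dim;
  a_idxE : forall j, a_idx j = (a_shift + j)%N :> nat;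
  a_emb_basis : forall j, a_emb (e j) = a_basis (a_idx j) }.

Definition matrix_elt (V : adapted_irrep) (l m : 'I_(a_dim V)) (g : G) : R[i] :=
  hdot (V g (a_basis m)) (a_basis l).

Definition is_trivial (V : adapted_irrep) :=
  a_dim V = 1%N /\ forall g x, V g x = x.

(* (V i), i in I, contains exactly one representative of each class of
   irreducible representations of G whose restriction to K contains W. *)
Definition represents_dual (I : Type) (V : I -> adapted_irrep) :=
  (forall i j, equivalent setT (V i) (V j) -> i = j) /\
  (forall (H' : fdHilbert R) (U : urep [set: G] H'),
     irreducible setT U -> contains K U W ->
     exists i, equivalent setT U (V i)).

End harmonics.

Section basis_functions.
Context {R : realType} {q r : nat} {G : lieGroupType R (q + r)}.
Context {K : closedSubgroup G} {H : fdHilbert R} {W : urep K H}.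
Context {dimW : nat} {e : 'I_dimW -> H} (J : adapted_chart K).

Definition basis_fun (V : adapted_irrep W e) (m : 'I_(a_dim V)) (j : 'I_dimW)
    (t : homspace K) : R[i] :=
  (Num.sqrt ((a_dim V)%:R / dimW%:R) : R)%:C *
  (matrix_elt m (a_idx V j) (ac_sec J t))^*.

Definition field_coord d (Omega : measurableType d) (X : random_field W Omega)
    (j : 'I_dimW) (t : homspace K) (w : Omega) : R[i] :=
  hdot (bcoord (ac_sec J t) (X t w)) (e j).

End basis_functions.

Arguments field_coord {R q r G K H W dimW} e J {d Omega} X.

(* Main.v *)
Require Import Defs.
From HB Require Import structures.
From mathcomp Require Import all_boot all_order all_algebra.
From mathcomp Require Import generic_quotient finmap complex.
From mathcomp Require Import all_classical all_reals all_analysis.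
From mathcomp Require Import measurable_realfun.
From mathcomp Require Import ring lra zify.
Import Order.TTheory GRing.Theory Num.Theory numFieldNormedType.Exports.
Import ComplexField.
Local Open Scope classical_set_scope.
Local Open Scope ring_scope.
Local Open Scope complex_scope.

Set Implicit Arguments.
Unset Strict Implicit.
Unset Printing Implicit Defensive.

(** The space of functions on the compact group G carries an invariant mean, obtained as the
    limit of averages of translates.  Its convolution operators have eigenspaces of finite
    dimension, and the latter split into irreducible representations (Peter-Weyl).

    A field X is encoded by f g v = X [g, v], linear in v, with f (g k) v = f g (W k v), and
    with values in L^2.  If X is invariant, the Fourier transform of g |-> E[f g v conj(f 1 v')]
    against an irreducible V is an intertwiner from W to V in the variable v, hence a multiple of
    the embedding of W (K being massive) and zero if V does not contain W.  So the mean of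
    g |-> conj(V_{m,p+1}(g)) f g e_1 is, up to a constant, the conjugate of a single amplitude
    Z_m^V.  The basis functions do not depend on n, so only the sum of the Z_{mn} over n matters
    and Z_{mn} may be taken to vanish for n <> 1.  The functions g |-> E[r g v conj(r 1 v)], for the
    remainders r of the expansion, converge uniformly to a continuous function all of whose
    Fourier coefficients vanish; by Peter-Weyl the limit is 0, and so is that of E|r g v|^2.

    Conversely, orthogonality of the Z_{mn} and summability of dim V tr R^V make the series
    converge in mean square uniformly over G, to an invariant and continuous field; it agrees
    with X over the dense domain of the chart, hence everywhere by extension. *)

(** * Complex numbers and continuity *)

(** The mean is defined on continuous functions only, and these are not complete for its inner
    product. An eigenfunction is therefore built by power iteration: the normalised even powers of a
    symmetric kernel form a Cauchy sequence in norm, and one more convolution makes the convergence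
    uniform, so that the limit is continuous.

    The squared norm of a remainder is the value at 1 of its covariance function and is the same at
    all points of the group. This is why uniform convergence of the covariance functions to 0
    settles mean square convergence everywhere at once.

    Two normalisations meet in the constants. The vector means [y] have squared norm sigma / dim V,
    which makes dim V the coefficient of [y] in the expansion. The basis functions contain sqrt (dim
    V / dim W), so the amplitudes are the conjugates of [y] times sqrt (dim V dim W).

    In the converse, square integrability of the field is not given: over the chart it comes from
    the expansion, elsewhere from the extension condition. *)

Section complex_modulus.
Context {R : realType}.
Implicit Types z w : R[i].

Lemma normcN z : Normc.normc (- z) = Normc.normc z.
Proof. by case: z => a b /=; rewrite !sqrrN. Qed.

Lemma normc_norm z : `|z| = (Normc.normc z)%:C.
Proof. by rewrite normc_def; case: z. Qed.

Lemma normc_ge0 z : 0 <= Normc.normc z.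
Proof. by case: z => a b /=; exact: sqrtr_ge0. Qed.

Lemma ler_normcD z w : Normc.normc (z + w) <= Normc.normc z + Normc.normc w.
Proof. by rewrite -lecR rmorphD /= -!normc_norm ler_normD. Qed.

Lemma normcBC z w : Normc.normc (z - w) = Normc.normc (w - z).
Proof. by rewrite -normcN opprB. Qed.

Lemma normcJ z : Normc.normc (conjc z) = Normc.normc z.
Proof. by case: z => a b /=; rewrite sqrrN. Qed.

Lemma normc_sqE z : Normc.normc z ^+ 2 = complex.Re z ^+ 2 + complex.Im z ^+ 2.
Proof. by case: z => a b /=; rewrite sqr_sqrtr// addr_ge0// sqr_ge0. Qed.

Lemma normc_real (x : R) : Normc.normc x%:C = `|x|.
Proof. by rewrite /= expr0n addr0 sqrtr_sqr. Qed.

Lemma normc_ge_Re z : `|complex.Re z| <= Normc.normc z.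
Proof. by rewrite -ler_sqr ?nnegrE ?normc_ge0// normc_sqE real_normK ?num_real// lerDl sqr_ge0. Qed.

Lemma normc_ge_Im z : `|complex.Im z| <= Normc.normc z.
Proof. by rewrite -ler_sqr ?nnegrE ?normc_ge0// normc_sqE real_normK ?num_real// lerDr sqr_ge0. Qed.

Lemma normc_le_ReIm z : Normc.normc z <= `|complex.Re z| + `|complex.Im z|.
Proof.
rewrite -ler_sqr ?nnegrE ?normc_ge0 ?addr_ge0// normc_sqE.
rewrite -(real_normK (num_real (complex.Re z))) -(real_normK (num_real (complex.Im z))).
have := normr_ge0 (complex.Re z); have := normr_ge0 (complex.Im z); nra.
Qed.

Lemma mulcJ z : z * conjc z = (Normc.normc z ^+ 2)%:C.
Proof. by rewrite normc_sqE add_Re2_Im2 sqr_normc. Qed.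

Lemma ler_normc_sum (T : Type) (s : seq T) (F : T -> R[i]) :
  Normc.normc (\sum_(i <- s) F i) <= \sum_(i <- s) Normc.normc (F i).
Proof.
elim/big_rec2: _ => [|i x y _]; first by rewrite Normc.normc0.
by move=> h; apply: le_trans (ler_normcD _ _) _; rewrite lerD2l.
Qed.

Lemma normc_small z : (forall e : R, 0 < e -> Normc.normc z <= e) -> z = 0.
Proof.
move=> h; apply: Normc.eq0_normc; apply/eqP; rewrite eq_le normc_ge0 andbT.
by apply/ler_addgt0Pl => e e0; rewrite addr0; exact: h.
Qed.

Lemma conjcM z w : conjc (z * w) = conjc z * conjc w.
Proof. exact: rmorphM. Qed.

Lemma conjc_sum (T : Type) (s : seq T) (p : pred T) (F : T -> R[i]) :
  conjc (\sum_(i <- s | p i) F i) = \sum_(i <- s | p i) conjc (F i).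
Proof. exact: rmorph_sum. Qed.

Lemma ReD z w : complex.Re (z + w) = complex.Re z + complex.Re w.
Proof. by case: z; case: w. Qed.

Lemma ReM z w : complex.Re (z * w) =
  complex.Re z * complex.Re w - complex.Im z * complex.Im w.
Proof. by case: z; case: w. Qed.

Lemma ImM z w : complex.Im (z * w) =
  complex.Re z * complex.Im w + complex.Im z * complex.Re w.
Proof. by case: z; case: w. Qed.

Lemma ImD z w : complex.Im (z + w) = complex.Im z + complex.Im w.
Proof. by case: z; case: w. Qed.

Lemma ReN z : complex.Re (- z) = - complex.Re z. Proof. by case: z. Qed.
Lemma ImN z : complex.Im (- z) = - complex.Im z. Proof. by case: z. Qed.

Lemma ReB z w : complex.Re (z - w) = complex.Re z - complex.Re w.
Proof. by rewrite ReD ReN. Qed.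

Lemma ImB z w : complex.Im (z - w) = complex.Im z - complex.Im w.
Proof. by rewrite ImD ImN. Qed.

Lemma ReJ z : complex.Re (conjc z) = complex.Re z. Proof. by case: z. Qed.
Lemma ImJ z : complex.Im (conjc z) = - complex.Im z. Proof. by case: z. Qed.

Lemma Re_sum (T : Type) (s : seq T) (p : pred T) (F : T -> R[i]) :
  complex.Re (\sum_(i <- s | p i) F i) = \sum_(i <- s | p i) complex.Re (F i).
Proof. by elim/big_rec2: _ => // i x y _ <-; rewrite ReD. Qed.

Lemma Im_sum (T : Type) (s : seq T) (p : pred T) (F : T -> R[i]) :
  complex.Im (\sum_(i <- s | p i) F i) = \sum_(i <- s | p i) complex.Im (F i).
Proof. by elim/big_rec2: _ => // i x y _ <-; rewrite ImD. Qed.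

Lemma ge0_complex z : 0 <= z -> z = (complex.Re z)%:C.
Proof. by rewrite lecE /= => /andP[/eqP h _]; case: z h => a b /= ->. Qed.

Lemma Re_ge0 z : 0 <= z -> 0 <= complex.Re z.
Proof. by rewrite lecE /= => /andP[]. Qed.

Lemma invc_nat (k : nat) : (k%:R : R[i])^-1 = (k%:R^-1)%:C.
Proof. by rewrite fmorphV /= rmorph_nat. Qed.

End complex_modulus.

Section complex_continuity.
Context {R : realType} {T : topologicalType}.
Implicit Types f g : T -> R[i].

(** Continuity is taken componentwise so that limit theorems for real functions apply; [ccontP]
    gives back the form with the modulus. *)
Definition ccont f :=
  continuous (fun x => complex.Re (f x)) /\ continuous (fun x => complex.Im (f x)).

Lemma ccontP f : ccont f <->
  forall x (e : R), 0 < e -> \forall y \near x, Normc.normc (f y - f x) < e.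
Proof.
split=> [[cr ci] x e e0|h].
  have e20 : 0 < e / 2 by rewrite divr_gt0.
  have /cvgrPdist_lt/(_ _ e20) hr := cr x.
  have /cvgrPdist_lt/(_ _ e20) hi := ci x.
  near=> y; apply: le_lt_trans (normc_le_ReIm _) _.
  rewrite (splitr e) ltrD//.
    by rewrite ReB distrC; near: y.
  by rewrite ImB distrC; near: y.
split=> x; apply/cvgrPdist_lt => e e0; near=> y;
  rewrite -?ReB -?ImB; [apply: le_lt_trans (normc_ge_Re _) _|
  apply: le_lt_trans (normc_ge_Im _) _]; rewrite normcBC; near: y; exact: h.
Unshelve. all: by end_near. Qed.

Lemma ccont_eq f g : f =1 g -> ccont f -> ccont g.
Proof. by move=> /funext ->. Qed.

Lemma ccont_cst (c : R[i]) : ccont (fun=> c).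
Proof. by split; exact: cst_continuous. Qed.

Lemma ccontD f g : ccont f -> ccont g -> ccont (fun x => f x + g x).
Proof.
move=> [fr fi] [gr gi]; split=> x.
  under eq_fun do rewrite ReD.
  by apply: cvgD; [exact: fr|exact: gr].
under eq_fun do rewrite ImD.
by apply: cvgD; [exact: fi|exact: gi].
Qed.

Lemma ccontM f g : ccont f -> ccont g -> ccont (fun x => f x * g x).
Proof.
move=> [fr fi] [gr gi]; split=> x.
  under eq_fun do rewrite ReM.
  apply: cvgB; apply: cvgM; by [exact: fr|exact: gr|exact: fi|exact: gi].
under eq_fun do rewrite ImM.
apply: cvgD; apply: cvgM; by [exact: fr|exact: gr|exact: fi|exact: gi].
Qed.

Lemma ccontJ f : ccont f -> ccont (fun x => conjc (f x)).
Proof.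
move=> [fr fi]; split=> x.
  by under eq_fun do rewrite ReJ; exact: fr.
by under eq_fun do rewrite ImJ; apply: cvgN; exact: fi.
Qed.

Lemma ccontZ (c : R[i]) f : ccont f -> ccont (fun x => c * f x).
Proof. by move=> cf; apply: ccontM => //; exact: ccont_cst. Qed.

Lemma ccontMr (c : R[i]) f : ccont f -> ccont (fun x => f x * c).
Proof. by move=> cf; apply: ccont_eq (ccontZ c cf) => x; rewrite mulrC. Qed.

Lemma ccontN f : ccont f -> ccont (fun x => - f x).
Proof. by move=> cf; apply: ccont_eq (ccontZ (-1) cf) => x; rewrite mulN1r. Qed.

Lemma ccontB f g : ccont f -> ccont g -> ccont (fun x => f x - g x).
Proof. by move=> cf cg; apply: ccontD => //; exact: ccontN. Qed.

Lemma ccont_sum (I : Type) (s : seq I) (F : I -> T -> R[i]) :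
  (forall i, ccont (F i)) -> ccont (fun x => \sum_(i <- s) F i x).
Proof.
move=> cF; elim: s => [|i s ih].
  by apply: ccont_eq (ccont_cst 0) => x; rewrite big_nil.
by apply: ccont_eq (ccontD (cF i) ih) => x; rewrite big_cons.
Qed.

Lemma ccont_uniform (F : nat -> T -> R[i]) f : (forall k, ccont (F k)) ->
  (forall e : R, 0 < e -> exists k, forall x, Normc.normc (F k x - f x) <= e) ->
  ccont f.
Proof.
move=> cF h; apply/ccontP => x e e0.
have [|k hk] := h (e / 3); first by rewrite divr_gt0.
have /ccontP/(_ x (e/3)) := cF k.
rewrite divr_gt0// => /(_ isT) near_k; near=> y.
have -> : f y - f x = (f y - F k y) + ((F k y - F k x) + (F k x - f x)) by ring.
apply: le_lt_trans (ler_normcD _ _) _.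
have h1 := hk x; have h2 := hk y; rewrite normcBC in h2.
have h3 : Normc.normc (F k y - F k x) < e / 3 by near: y.
have h4 := ler_normcD (F k y - F k x) (F k x - f x); lra.
Unshelve. all: by end_near. Qed.

End complex_continuity.

Lemma ccont_comp {R : realType} {T U : topologicalType} (f : U -> R[i]) (h : T -> U) :
  continuous h -> ccont f -> ccont (fun x => f (h x)).
Proof.
by move=> ch [fr fi]; split=> x;
  [exact: (continuous_comp (ch x) (fr (h x)))|exact: (continuous_comp (ch x) (fi (h x)))].
Qed.

Lemma uniform_cauchy_limit {R : realType} (T : Type) (F : nat -> T -> R[i]) :
  (forall e : R, 0 < e -> exists k, forall l m, (k <= l)%N -> (k <= m)%N ->
    forall x, Normc.normc (F l x - F m x) <= e) ->
  exists f, forall e : R, 0 < e -> exists k, forall l, (k <= l)%N ->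
    forall x, Normc.normc (F l x - f x) <= e.
Proof.
move=> cau.
have cv (u : nat -> R) : (forall e : R, 0 < e -> exists k, forall l m, (k <= l)%N ->
    (k <= m)%N -> `|u l - u m| <= e) -> cvgn u.
  move=> hu; apply/cauchy_cvgP/cauchy_exP => e e0.
  have [|k hk] := hu (e / 2); first by rewrite divr_gt0.
  exists (u k), k => // m /= km; rewrite /ball /=; apply: le_lt_trans (hk _ _ _ km) _ => //.
  by rewrite ltr_pdivrMr// mulr_natr mulr2n ltrDl.
have cvR x : cvgn (fun k => complex.Re (F k x)).
  apply: cv => e /cau[k hk]; exists k => l m kl km; rewrite -ReB.
  exact: le_trans (normc_ge_Re _) (hk _ _ kl km x).
have cvI x : cvgn (fun k => complex.Im (F k x)).
  apply: cv => e /cau[k hk]; exists k => l m kl km; rewrite -ImB.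
  exact: le_trans (normc_ge_Im _) (hk _ _ kl km x).
exists (fun x => limn (fun k => complex.Re (F k x)) +i* limn (fun k => complex.Im (F k x))).
move=> e e0; have [|k hk] := cau (e / 2); first by rewrite divr_gt0.
exists k => l kl x.
have e40 : 0 < e / 4 by rewrite divr_gt0.
have /cvgrPdist_lt/(_ _ e40)[a _ ha] := cvR x.
have /cvgrPdist_lt/(_ _ e40)[b _ hb] := cvI x.
(* This [m] depends on [x], but it only serves as an intermediate index: the threshold [k] does not
   depend on [x]. *)
pose m := maxn k (maxn a b).
have km : (k <= m)%N by rewrite leq_maxl.
have am : (a <= m)%N by rewrite /m maxnCA leq_maxl.
have bm : (b <= m)%N by rewrite /m !leq_max leqnn !orbT.
set f := (X in F l x - X).
have -> : F l x - f = (F l x - F m x) + (F m x - f) by ring.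
have h1 := ler_normcD (F l x - F m x) (F m x - f).
have h2 := normc_le_ReIm (F m x - f).
have h3 := ha m am; have h4 := hb m bm; have h5 := hk _ _ kl km x.
move: h2; rewrite ReB ImB /f /= (distrC (complex.Re _)) (distrC (complex.Im _)) => h2.
rewrite /= in h3 h4; lra.
Qed.

(** * The invariant mean *)

Section averages.
Context {R : realType} {n : nat} {G : lieGroupType R n}.
Implicit Types (s t : seq G) (g h : G).

Lemma mulgl_cts h : continuous (fun g : G => (h * g)%g).
Proof.
move=> g; apply: (@continuous_comp _ _ _ (fun g : G => (h, g)) (fun p : G * G => (p.1 * p.2)%g)).
  by apply: cvg_pair; [exact: cvg_cst|exact: cvg_id].
exact: mulg_cts.
Qed.

Lemma mulgr_cts h : continuous (fun g : G => (g * h)%g).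
Proof.
move=> g; apply: (@continuous_comp _ _ _ (fun g : G => (g, h)) (fun p : G * G => (p.1 * p.2)%g)).
  by apply: cvg_pair; [exact: cvg_id|exact: cvg_cst].
exact: mulg_cts.
Qed.

(** Values in an arbitrary complex vector space cover both scalar functions and functions with
    random variables as values. Right translates are averaged, so averages commute with left
    translation. *)
Definition avg (E : lmodType R[i]) s (f : G -> E) (g : G) : E :=
  (size s)%:R^-1 *: \sum_(a <- s) f (g * a)%g.

Lemma avgE s (f : G -> R[i]) g : avg s f g = (size s)%:R^-1 * \sum_(a <- s) f (g * a)%g.
Proof. by []. Qed.

Lemma avg_avg (E : lmodType R[i]) s t (f : G -> E) g :
  avg s (avg t f) g = avg [seq (a * b)%g | a <- s, b <- t] f g.
Proof.
rewrite /avg size_allpairs natrM invfM -scalerA -scaler_sumr; congr (_ *: (_ *: _)).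
rewrite big_allpairs_dep /=; apply: eq_bigr => a _; apply: eq_bigr => b _.
by rewrite mulgA.
Qed.

Lemma avg_cst (E : lmodType R[i]) s (c : E) g : (0 < size s)%N -> avg s (fun=> c) g = c.
Proof.
move=> s0; rewrite /avg big_const_seq count_predT iter_addr_0 -(scaler_nat _ c) scalerA.
by rewrite mulVf ?scale1r// pnatr_eq0 -lt0n.
Qed.

Lemma avgD (E : lmodType R[i]) s (f1 f2 : G -> E) g :
  avg s (fun x => f1 x + f2 x) g = avg s f1 g + avg s f2 g.
Proof. by rewrite /avg big_split scalerDr. Qed.

Lemma avgZ (E : lmodType R[i]) s (c : R[i]) (f : G -> E) g :
  avg s (fun x => c *: f x) g = c *: avg s f g.
Proof. by rewrite /avg -scaler_sumr !scalerA mulrC. Qed.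

Lemma avgB (E : lmodType R[i]) s (f1 f2 : G -> E) g :
  avg s (fun x => f1 x - f2 x) g = avg s f1 g - avg s f2 g.
Proof. by rewrite /avg sumrB scalerBr. Qed.

Lemma normc_avg_le s (f : G -> R[i]) (c : R) g : (0 < size s)%N ->
  (forall x, Normc.normc (f x) <= c) -> Normc.normc (avg s f g) <= c.
Proof.
move=> s0 h; rewrite /avg /GRing.scale /= Normc.normcM Normc.normcV.
have -> : Normc.normc (size s)%:R = (size s)%:R :> R.
  by rewrite -(rmorph_nat (real_complex R)) normc_real ger0_norm.
rewrite ler_pdivrMl ?ltr0n//; apply: le_trans (ler_normc_sum _ _) _.
apply: le_trans (ler_sum _ (fun i _ => h _)) _.
by rewrite big_const_seq count_predT iter_addr_0 mulr_natl.
Qed.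

Lemma Re_avg s (f : G -> R[i]) g :
  complex.Re (avg s f g) = (size s)%:R^-1 * \sum_(a <- s) complex.Re (f (g * a)%g).
Proof. by rewrite /avg /GRing.scale /= invc_nat ReM /= mul0r subr0 Re_sum. Qed.

Lemma Re_avg_near s (f : G -> R[i]) (c e : R) g : (0 < size s)%N ->
  (forall x, `|complex.Re (f x) - c| <= e) -> `|complex.Re (avg s f g) - c| <= e.
Proof.
move=> s0 h; rewrite -[c in _ - c]/(complex.Re c%:C) -(avg_cst c%:C g s0) -ReB -avgB.
rewrite Re_avg normrM ger0_norm ?invr_ge0// ler_pdivrMl ?ltr0n//.
apply: le_trans (ler_norm_sum _ _ _) _.
have hh a : true -> `|complex.Re (f (g * a)%g - c%:C)| <= e by move=> _; rewrite ReB.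
apply: le_trans (ler_sum _ hh) _.
by rewrite big_const_seq count_predT iter_addr_0 mulr_natl.
Qed.

Lemma avg_ccont s (f : G -> R[i]) : ccont f -> ccont (avg s f).
Proof.
move=> cf; apply: ccontZ; apply: ccont_sum => a; apply: ccont_comp => //.
exact: mulgr_cts.
Qed.

End averages.

Section invariant_mean.
Context {R : realType} {n : nat} {G : lieGroupType R n}.
Hypothesis Gc : compact [set: G].
Implicit Types (s t : seq G) (g h : G) (f : G -> R[i]).

Lemma finite_cover (O : G -> set G) : (forall g, nbhs g (O g)) ->
  exists s : seq G, forall x, exists2 t, t \in s & O t x.
Proof.
move=> hO.
(* Ordering finite sequences by inclusion turns the near-covering form of compactness into the
   extraction of a finite subcover. *)
pose F : set_system (seq G) := fun A => exists s0 : seq G, forall s, {subset s0 <= s} -> A s.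
have FF : Filter F.
  split; first by exists [::].
    move=> A B [s hs] [t ht]; exists (s ++ t) => u hu; split.
      by apply: hs => x xs; apply: hu; rewrite mem_cat xs.
    by apply: ht => x xs; apply: hu; rewrite mem_cat xs orbT.
  by move=> A B AB [s hs]; exists s => t /hs; exact: AB.
move/compact_near_coveringP : Gc => /(_ _ F (fun s x => exists2 t, t \in s & O t x) FF).
case=> [x _|s hs]; last by exists s => x; apply: (hs s).
exists (O x, [set s : seq G | x \in s]) => [|[y s] /= [Oy xs]]; last by exists x.
by split => //; exists [:: x] => s; apply; rewrite mem_head.
Qed.

(** The difference is jointly continuous in [u] and [g] and vanishes at [u = 1]; compactness makes
    the neighbourhood of 1 independent of [g]. *)
Lemma uniform_modulus f (e : R) : ccont f -> 0 < e ->
  \forall u \near (1%g : G), forall g, Normc.normc (f (u * g)%g - f g) < e.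
Proof.
move=> cf e0.
move/compact_near_coveringP : Gc =>
  /(_ _ (nbhs (1%g : G)) (fun u g => Normc.normc (f (u * g)%g - f g) < e)) cover.
apply: (filterS _ (cover _ _)) => [u h g|g _]; first exact: h.
have cmul : ccont (fun p : G * G => f (p.2 * p.1)%g - f p.1).
  apply: ccontB.
    apply: (@ccont_comp _ _ _ f (fun p : G * G => (p.2 * p.1)%g)) => // p.
    apply: (@continuous_comp _ _ _ (fun p : G * G => (p.2, p.1)) (fun p : G * G => (p.1 * p.2)%g)).
      by apply: cvg_pair; [exact: cvg_snd|exact: cvg_fst].
    exact: mulg_cts.
  by apply: (@ccont_comp _ _ _ f (fun p : G * G => p.1)) => // p; exact: cvg_fst.
have /ccontP/(_ (g, 1%g) _ e0) := cmul.
by rewrite /= mul1g subrr; apply: filterS => -[x u] /=; rewrite subr0.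
Qed.

(** As long as an average oscillates by more than [e], it has a low point [h]. Averaging once more
    over translates that bring every [g] close to [h] lowers the upper bound by a fixed amount,
    which can only happen finitely often for a bounded function. *)
Lemma osc_Re f (e : R) : ccont f -> 0 < e ->
  exists s, (0 < size s)%N /\
    forall g h, complex.Re (avg s f g) - complex.Re (avg s f h) <= e.
Proof.
(* One half of [e] is spent on moving from [h] to a nearby point, the other half is the gain. *)
move=> cf e0; pose d := e / 2; have d0 : 0 < d by rewrite divr_gt0.
pose U u := forall g, Normc.normc (f (u * g)%g - f g) < d.
have nU : \forall u \near (1%g : G), U u by exact: uniform_modulus.
have [t ht] : exists t : seq G, forall x, exists2 b, b \in t & U (x * b^-1)%g.
  apply: (@finite_cover (fun b x => U (x * b^-1)%g)) => b.
  by have := @mulgr_cts R n G b^-1%g b; rewrite /continuous_at mulgV => /(_ _ nU).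
have N0 : (0 < size t)%N by have [b] := ht 1%g; case: (t).
have N0R : 0 < (size t)%:R :> R by rewrite ltr0n.
have sumE (F : G -> R) : forall b, b \in t ->
    \sum_(a <- t) F a = F b + \sum_(a <- rem b t) F a.
  by move=> b bt; rewrite (big_rem b).
pose C : R := (\sum_(b <- t) Normc.normc (f b)) + d.
have fC g : Normc.normc (f g) <= C.
  have [b bt Ub] := ht g.
  have -> : f g = f b + (f (g * b^-1 * b)%g - f b) by rewrite -mulgA mulVg mulg1; ring.
  apply: le_trans (ler_normcD _ _) _; rewrite lerD//; last exact/ltW/Ub.
  by rewrite (sumE _ _ bt) lerDl sumr_ge0// => ? _; exact: normc_ge0.
(* Averages inherit the modulus of continuity of [f], so the same [U] and the same net [t] serve at
   every stage and the gain does not shrink. *)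
have {}mod_avg s u g : (0 < size s)%N -> U u ->
    complex.Re (avg s f (u * g)%g) <= complex.Re (avg s f g) + d.
  move=> s0 Uu; rewrite addrC -lerBlDr -ReB.
  have -> : avg s f (u * g)%g - avg s f g = avg s (fun x => f (u * x)%g - f x) g.
    by rewrite avgB /avg; congr (_ *: _ - _); apply: eq_bigr => a _; rewrite mulgA.
  apply: le_trans (ler_norm _) _; apply: le_trans (normc_ge_Re _) _.
  by apply: normc_avg_le => // x; exact/ltW/Uu.
have H k : exists s, (0 < size s)%N /\
    ((forall g h, complex.Re (avg s f g) - complex.Re (avg s f h) <= e) \/
     (forall g, complex.Re (avg s f g) <= C - k%:R * (d / (size t)%:R))).
  elim: k => [|k [s [s0 [osc|ub]]]].
  - exists [:: 1%g]; split=> //; right => g; rewrite mul0r subr0.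
    apply: le_trans (ler_norm _) _; apply: le_trans (normc_ge_Re _) _.
    exact: normc_avg_le.
  - by exists s; split=> //; left.
  have [osc|nosc] := pselect (forall g h, complex.Re (avg s f g) - complex.Re (avg s f h) <= e).
    by exists s; split=> //; left.
  have [h hh] : exists h, complex.Re (avg s f h) < C - k%:R * (d / (size t)%:R) - e.
    apply: contrapT => no; apply: nosc => g h; rewrite leNgt; apply/negP => lt.
    by apply: no; exists h; move: (ub g) lt; lra.
  (* For the [b] in [t] with [g * b^-1] in [U], the translate [g * b^-1 * h] is close to the low
     point [h]; this one term out of [size t] produces the gain [d / size t]. *)
  exists [seq (a * b)%g | a <- [seq (a^-1 * h)%g | a <- t], b <- s].
  split; first by rewrite size_allpairs size_map muln_gt0 N0.
  right=> g; rewrite -avg_avg Re_avg size_map big_map.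
  rewrite ler_pdivrMl//; have [b bt Ub] := ht g.
  rewrite (sumE _ _ bt) mulgA.
  have h1 := mod_avg s _ h s0 Ub.
  have h2 : \sum_(a <- rem b t) complex.Re (avg s f (g * (a^-1 * h))%g) <=
      ((size t)%:R - 1) * (C - k%:R * (d / (size t)%:R)).
    apply: le_trans (ler_sum _ (fun i _ => ub _)) _.
    rewrite big_const_seq count_predT iter_addr_0 size_rem//.
    have -> : (size t)%:R - 1 = (size t).-1%:R :> R by rewrite -subn1 natrB.
    by rewrite [leRHS]mulr_natl.
  have h3 : (size t)%:R * (C - k.+1%:R * (d / (size t)%:R)) =
     (size t)%:R * (C - k%:R * (d / (size t)%:R)) - d.
    by rewrite -natr1; field; rewrite gt_eqF.
  rewrite h3; have h4 : e = d + d by rewrite /d; field.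
  move: h1 h2 hh; rewrite h4.
  set A := \sum_(a <- _) _; set B := C - _; set D := complex.Re _; set D' := complex.Re _.
  move=> h1 h2 hh; nra.
(* Real parts of averages stay above [- C], so after this many gains only the first alternative is
   left. *)
have [k hk] : exists k : nat, C + C < k%:R * (d / (size t)%:R).
  have ee0 : 0 < d / (size t)%:R by rewrite divr_gt0.
  exists (Num.truncn ((C + C) / (d / (size t)%:R))).+1.
  rewrite -ltr_pdivrMr//; exact: truncnS_gt.
have [s [s0 [osc|ub]]] := H k; first by exists s.
have := ub 1%g; have := normc_avg_le 1%g s0 fC.
have := normc_ge_Re (avg s f 1%g); have := ler_norm (- complex.Re (avg s f 1%g)).
rewrite normrN.
by move: hk; set a := k%:R * _; lra.
Qed.

End invariant_mean.

Section invariant_mean_existence.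
Context {R : realType} {n : nat} {G : lieGroupType R n}.
Implicit Types (s t : seq G) (g h : G) (f : G -> R[i]).

(** The supremum of the lower bounds [v - e] certified by an average that stays within [e] of [v].
    This is defined for every [f] and involves no choice of averages. *)
Definition re_mean f : R :=
  sup [set a | exists s v e, [/\ (0 < size s)%N,
    forall g, `|complex.Re (avg s f g) - v| <= e & a = v - e]].

(** Multiplication by -i turns the imaginary part into a real part. *)
Definition mean f : R[i] := re_mean f +i* re_mean (fun g => f g * (0 -i* 1)).

Hypothesis Gc : compact [set: G].

Lemma ccont_inv f : ccont f -> ccont (fun g => f (g^-1)%g).
Proof. by move=> cf; apply: (@ccont_comp _ _ _ f (fun g : G => (g^-1)%g)) => //; exact: invg_cts. Qed.

Lemma ccont_mulgl f h : ccont f -> ccont (fun g => f (h * g)%g).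
Proof. by move=> cf; apply: (@ccont_comp _ _ _ f) => //; exact: mulgl_cts. Qed.

Lemma ccont_mulgr f h : ccont f -> ccont (fun g => f (g * h)%g).
Proof. by move=> cf; apply: (@ccont_comp _ _ _ f (fun g : G => g * h)%g) => //; exact: mulgr_cts. Qed.

Lemma Re_avg_osc s f (e : R) : (0 < size s)%N ->
  (forall g h, complex.Re (f g) - complex.Re (f h) <= e) ->
  forall g h, complex.Re (avg s f g) - complex.Re (avg s f h) <= e.
Proof.
move=> s0 H g h; rewrite !Re_avg -mulrBr ler_pdivrMl ?ltr0n// -sumrB.
apply: le_trans (ler_sum _ (fun i _ => H _ _)) _.
by rewrite big_const_seq count_predT iter_addr_0 mulr_natl.
Qed.

(** Averaging again never increases an oscillation, so averages found for single functions can be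
    composed into a common one. *)
Lemma osc_Re_family (J : eqType) (r : seq J) (F : J -> G -> R[i]) (e : R) :
  (forall j, ccont (F j)) -> 0 < e ->
  exists s, (0 < size s)%N /\ forall j, j \in r ->
    forall g h, complex.Re (avg s (F j) g) - complex.Re (avg s (F j) h) <= e.
Proof.
move=> cF e0; elim: r => [|j r [s [s0 hs]]]; first by exists [:: 1%g].
have [t [t0 ht]] := osc_Re Gc (avg_ccont s (cF j)) e0.
exists [seq (a * b)%g | a <- t, b <- s].
split=> [|i]; first by rewrite size_allpairs muln_gt0 t0.
rewrite in_cons => /orP[/eqP->|ir] g h; rewrite -!avg_avg //.
by apply: Re_avg_osc => //; exact: hs.
Qed.

(* Right averages commute with left averages, which pins down the value approached by either. *)
Lemma avg_left_right f s t (v w e d : R) : (0 < size s)%N -> (0 < size t)%N ->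
  (forall g, `|complex.Re (avg s f g) - v| <= e) ->
  (forall g, `|complex.Re (avg t (fun x => f x^-1%g) g) - w| <= d) ->
  `|v - w| <= e + d.
Proof.
move=> s0 t0 hs ht.
pose L g := avg t (fun x => f x^-1%g) g^-1%g.
have hL g : `|complex.Re (L g) - w| <= d by exact: ht.
have h1 := Re_avg_near 1%g s0 hL.
pose it := [seq a^-1%g | a <- t].
have it0 : (0 < size it)%N by rewrite size_map.
have h2 := Re_avg_near 1%g it0 hs.
have E : avg s L 1%g = avg it (avg s f) 1%g.
  rewrite /avg size_map -!scaler_sumr !scalerA mulrC; congr (_ *: _).
  rewrite exchange_big big_map; apply: eq_bigr => a _; apply: eq_bigr => b' _.
  by rewrite invgM invgK !mul1g.
rewrite E in h1; move: h1 h2; set x := complex.Re _ => h1 h2.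
have -> : v - w = (v - x) + (x - w) by ring.
by apply: le_trans (ler_normD _ _) _; rewrite distrC lerD.
Qed.

(** Both right averages are compared with one fine left average of [f], obtained by averaging the
    function [f x^-1]. *)
Lemma avg_consistent f s s' (v v' e e' : R) : ccont f -> (0 < size s)%N -> (0 < size s')%N ->
  (forall g, `|complex.Re (avg s f g) - v| <= e) ->
  (forall g, `|complex.Re (avg s' f g) - v'| <= e') ->
  `|v - v'| <= e + e'.
Proof.
move=> cf s0 s'0 hs hs'; apply/ler_addgt0Pl => d d0.
have [t [t0 ht]] := osc_Re Gc (ccont_inv cf) (divr_gt0 d0 (ltr0n _ 2)).
pose w := complex.Re (avg t (fun x => f x^-1%g) 1%g).
have hw g : `|complex.Re (avg t (fun x => f x^-1%g) g) - w| <= d / 2.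
  by have := ht g 1%g; have := ht 1%g g; rewrite -/w ler_norml; set x := complex.Re _; lra.
have h1 := avg_left_right s0 t0 hs hw; have h2 := avg_left_right s'0 t0 hs' hw.
have -> : v - v' = (v - w) - (v' - w) by ring.
apply: le_trans (ler_normB _ _) _; lra.
Qed.

Lemma re_mean_near f s (e : R) : ccont f -> (0 < size s)%N ->
  (forall g h, complex.Re (avg s f g) - complex.Re (avg s f h) <= e) ->
  forall g, `|complex.Re (avg s f g) - re_mean f| <= e.
Proof.
move=> cf s0 osc g; set v := complex.Re _.
have hv h : `|complex.Re (avg s f h) - v| <= e.
  by rewrite ler_norml osc andbT lerNl opprB osc.
have ubv : ubound [set a | exists s v e, [/\ (0 < size s)%N,
    forall g, `|complex.Re (avg s f g) - v| <= e & a = v - e]] (v + e).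
  move=> _ [s' [v' [e' [s'0 hs' ->]]]].
  have : `|v - v'| <= e + e'.
    exact: (avg_consistent cf s0 s'0).
  by rewrite ler_norml => /andP[]; lra.
have h1 : v - e <= re_mean f.
  by apply: ub_le_sup; [exists (v + e)|exists s, v, e].
have h2 : re_mean f <= v + e.
  by apply: ge_sup => //; exists (v - e); exists s, v, e.
by rewrite ler_norml; lra.
Qed.

Lemma mean_near f s (e : R) : ccont f -> (0 < size s)%N ->
  (forall g h, Normc.normc (avg s f g - avg s f h) <= e) ->
  forall g, Normc.normc (avg s f g - mean f) <= e + e.
Proof.
move=> cf s0 osc g; apply: le_trans (normc_le_ReIm _) _.
have ImE h : complex.Im (avg s f h) = complex.Re (avg s (fun g => f g * (0 -i* 1)) h).
  by rewrite /avg -mulr_suml scalerAl; set z := _ *: _; rewrite ReM /=; ring.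
rewrite ReB ImB lerD//.
  apply: re_mean_near => // x y; rewrite -ReB.
  by apply: le_trans (ler_norm _) _; apply: le_trans (normc_ge_Re _) (osc _ _).
rewrite ImE; apply: re_mean_near => //; first by exact: (ccontMr _ cf).
move=> x y; rewrite -!ImE -ImB.
by apply: le_trans (ler_norm _) _; apply: le_trans (normc_ge_Im _) (osc _ _).
Qed.

Lemma mean_approx (J : eqType) (r : seq J) (F : J -> G -> R[i]) (e : R) :
  (forall j, ccont (F j)) -> 0 < e ->
  exists s, (0 < size s)%N /\ forall j, j \in r ->
    forall g, Normc.normc (avg s (F j) g - mean (F j)) <= e.
Proof.
(* The real and the imaginary part each contribute [e / 4] to the oscillation, and [mean_near]
   doubles the sum. *)
move=> cF e0; have e40 : 0 < e / 4 by rewrite divr_gt0.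
pose F' (p : J * bool) := if p.2 then F p.1 else fun g => F p.1 g * (0 -i* 1).
have cF' p : ccont (F' p).
  by case: p => j []; rewrite /F' /=; [exact: cF|exact: ccontMr].
have [s [s0 hs]] := osc_Re_family [seq (j, b) | j <- r, b <- [:: true; false]] cF' e40.
have ImE j h : complex.Im (avg s (F j) h) = complex.Re (avg s (F' (j, false)) h).
  by rewrite /avg /F' /= -mulr_suml scalerAl; set z := _ *: _; rewrite ReM /=; ring.
exists s; split=> // j jr g.
have mj b : (j, b) \in [seq (j, b) | j <- r, b <- [:: true; false]].
  by apply/allpairsP; exists (j, b); split=> //; case: (b).
suff osc x y : Normc.normc (avg s (F j) x - avg s (F j) y) <= e / 2.
  by have := mean_near (cF j) s0 osc g; rewrite -splitr.
apply: le_trans (normc_le_ReIm _) _; rewrite ReB ImB !ImE.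
have h1 := hs _ (mj true) x y; have h2 := hs _ (mj true) y x.
have h3 := hs _ (mj false) x y; have h4 := hs _ (mj false) y x.
have -> : e / 2 = e / 4 + e / 4 by field.
by rewrite lerD// ler_norml; apply/andP; split=> //; rewrite lerNl opprB.
Qed.

(** The working principle for the mean: linearity, conjugation and left invariance all follow by
    evaluating averages and identifying the constant that they approach. *)
Lemma mean_uniq f (c : R[i]) : ccont f ->
  (forall e : R, 0 < e -> exists s, (0 < size s)%N /\
     forall g, Normc.normc (avg s f g - c) <= e) -> mean f = c.
Proof.
move=> cf H; apply/eqP; rewrite -subr_eq0; apply/eqP/normc_small => e e0.
have [|s [s0 hs]] := H (e / 5); first by rewrite divr_gt0.
have osc x y : Normc.normc (avg s f x - avg s f y) <= e / 5 + e / 5.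
  have -> : avg s f x - avg s f y = (avg s f x - c) + (c - avg s f y) by ring.
  by apply: le_trans (ler_normcD _ _) _; rewrite [X in _ + X]normcBC lerD.
have h1 := mean_near cf s0 osc 1%g; have h2 := hs 1%g.
have -> : mean f - c = (mean f - avg s f 1%g) + (avg s f 1%g - c) by ring.
apply: le_trans (ler_normcD _ _) _; rewrite [X in X + _]normcBC; lra.
Qed.

Lemma mean_approx1 f (e : R) : ccont f -> 0 < e ->
  exists s, (0 < size s)%N /\ forall g, Normc.normc (avg s f g - mean f) <= e.
Proof.
move=> cf e0; have [s [s0 hs]] := mean_approx [:: tt] (fun=> cf) e0.
by exists s; split=> //; apply: (hs tt); rewrite mem_head.
Qed.

Lemma mean_approx2 f1 f2 (e : R) : ccont f1 -> ccont f2 -> 0 < e ->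
  exists s, [/\ (0 < size s)%N, forall g, Normc.normc (avg s f1 g - mean f1) <= e
    & forall g, Normc.normc (avg s f2 g - mean f2) <= e].
Proof.
move=> c1 c2 e0; have cF b : ccont (if b then f1 else f2) by case: b.
have [s [s0 hs]] := mean_approx [:: true; false] cF e0.
by exists s; split=> // g; [apply: (hs true)|apply: (hs false)].
Qed.

Lemma mean_cst (c : R[i]) : mean (fun=> c) = c.
Proof.
apply: mean_uniq; first exact: ccont_cst.
move=> e e0; exists [:: 1%g]; split=> // g.
by rewrite avg_cst// subrr Normc.normc0 ltW.
Qed.

Lemma mean_linear (c : R[i]) f1 f2 : ccont f1 -> ccont f2 ->
  mean (fun g => c * f1 g + f2 g) = c * mean f1 + mean f2.
Proof.
move=> c1 c2; apply: mean_uniq; first by apply: ccontD => //; exact: ccontZ.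
move=> e e0; have d0 : 0 < Normc.normc c + 1 by have := normc_ge0 c; lra.
have [s [s0 h1 h2]] := mean_approx2 c1 c2 (divr_gt0 e0 (addr_gt0 d0 ltr01)).
exists s; split=> // g; rewrite avgD avgZ.
set a1 := avg s f1 g; set a2 := avg s f2 g.
have -> : c *: a1 + a2 - (c * mean f1 + mean f2) = c * (a1 - mean f1) + (a2 - mean f2).
  by rewrite /GRing.scale /=; ring.
apply: le_trans (ler_normcD _ _) _; rewrite Normc.normcM.
have {}h1 := h1 g; have {}h2 := h2 g.
have c0 := normc_ge0 c; rewrite -/a1 in h1; rewrite -/a2 in h2.
have -> : e = Normc.normc c * (e / (Normc.normc c + 1 + 1)) + 
    (e / (Normc.normc c + 1 + 1)) + (e / (Normc.normc c + 1 + 1)).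
  by field; rewrite gt_eqF//; lra.
have h3 := ler_wpM2l c0 h1.
have h4 : 0 < e / (Normc.normc c + 1 + 1) by apply: divr_gt0 => //; lra.
lra.
Qed.

Lemma meanD f1 f2 : ccont f1 -> ccont f2 ->
  mean (fun g => f1 g + f2 g) = mean f1 + mean f2.
Proof.
move=> c1 c2; rewrite -[mean f1]mul1r -mean_linear//; congr mean.
by apply/funext => g; rewrite mul1r.
Qed.

Lemma meanZ (c : R[i]) f : ccont f -> mean (fun g => c * f g) = c * mean f.
Proof.
move=> cf; have := mean_linear c cf (ccont_cst 0); rewrite mean_cst addr0 => <-.
by congr mean; apply/funext => g; rewrite addr0.
Qed.

Lemma meanZr (c : R[i]) f : ccont f -> mean (fun g => f g * c) = mean f * c.
Proof.
by move=> cf; rewrite mulrC -meanZ//; congr mean; apply/funext => g; rewrite mulrC.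
Qed.

Lemma meanB f1 f2 : ccont f1 -> ccont f2 ->
  mean (fun g => f1 g - f2 g) = mean f1 - mean f2.
Proof.
move=> c1 c2; rewrite meanD//; last exact: ccontN.
by congr (_ + _); rewrite -mulN1r -meanZ//; congr mean; apply/funext => g; rewrite mulN1r.
Qed.

Lemma mean_sum (I : Type) (r : seq I) (F : I -> G -> R[i]) : (forall i, ccont (F i)) ->
  mean (fun g => \sum_(i <- r) F i g) = \sum_(i <- r) mean (F i).
Proof.
move=> cF; elim: r => [|i r ih].
  by rewrite big_nil -[RHS](mean_cst 0); congr mean; apply/funext => g; rewrite big_nil.
rewrite big_cons -ih -meanD//; last exact: ccont_sum.
by congr mean; apply/funext => g; rewrite big_cons.
Qed.

Lemma mean_conj f : ccont f -> mean (fun g => conjc (f g)) = conjc (mean f).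
Proof.
move=> cf; apply: mean_uniq; first exact: ccontJ.
move=> e e0; have [s [s0 hs]] := mean_approx1 cf e0; exists s; split=> // g.
have -> : avg s (fun g => conjc (f g)) g = conjc (avg s f g).
  by rewrite !avgE conjcM conjc_sum conjc_inv conjc_nat.
by rewrite -rmorphB normcJ.
Qed.

Lemma normc_mean_le f (c : R) : ccont f -> (forall g, Normc.normc (f g) <= c) ->
  Normc.normc (mean f) <= c.
Proof.
move=> cf fc; apply/ler_addgt0Pl => e e0.
have [s [s0 hs]] := mean_approx1 cf e0.
have -> : mean f = (mean f - avg s f 1%g) + avg s f 1%g by ring.
apply: le_trans (ler_normcD _ _) _; rewrite normcBC lerD//; exact: normc_avg_le.
Qed.

Lemma mean_ge0 f : ccont f -> (forall g, 0 <= f g) -> 0 <= mean f.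
Proof.
move=> cf f0; have fJ : mean f = conjc (mean f).
  rewrite -mean_conj//; congr mean; apply/funext => g.
  by rewrite (ge0_complex (f0 g)) conjc_real.
have im0 : complex.Im (mean f) = 0.
  by have := congr1 (@complex.Im R) fJ; rewrite ImJ; lra.
rewrite lecE im0 eqxx andTb -[complex.Re 0]/0; apply/ler_addgt0Pl => e e0.
have [s [s0 hs]] := mean_approx1 cf e0.
have h1 := le_trans (normc_ge_Re _) (hs 1%g).
have h2 : 0 <= complex.Re (avg s f 1%g).
  by rewrite Re_avg mulr_ge0 ?invr_ge0// sumr_ge0// => a _; exact: Re_ge0.
by move: h1; rewrite ReB ler_norml; lra.
Qed.

Lemma mean_mulgl f h : ccont f -> mean (fun g => f (h * g)%g) = mean f.
Proof.
move=> cf; apply: mean_uniq; first exact: ccont_mulgl.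
move=> e e0; have [s [s0 hs]] := mean_approx1 cf e0; exists s; split=> // g.
have -> : avg s (fun g => f (h * g)%g) g = avg s f (h * g)%g.
  by rewrite /avg; congr (_ *: _); apply: eq_bigr => a _; rewrite mulgA.
exact: hs.
Qed.

(** Inversion exchanges right and left averages, and [avg_left_right] shows that both approach the
    same value. *)
Lemma mean_inv f : ccont f -> mean (fun g => f g^-1%g) = mean f.
Proof.
move=> cf; have cfi := ccont_inv cf.
have H f1 : ccont f1 -> re_mean (fun g => f1 g^-1%g) = re_mean f1.
  move=> c1; have ci := ccont_inv c1.
  apply/eqP; rewrite -subr_eq0 -normr_le0; apply/ler_addgt0Pl => e e0; rewrite addr0.
  have [s [s0 hs]] := osc_Re Gc c1 (divr_gt0 e0 (ltr0n _ 2)).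
  have [t [t0 ht]] := osc_Re Gc ci (divr_gt0 e0 (ltr0n _ 2)).
  have h1 := re_mean_near c1 s0 hs; have h2 := re_mean_near ci t0 ht.
  by rewrite distrC [e]splitr; exact: avg_left_right s0 t0 h1 h2.
rewrite /mean H//; congr (_ +i* _).
by exact: (H _ (ccontMr _ cf)).
Qed.

(** Left invariance is immediate for averages of right translates; right invariance is transported
    from it by inversion. *)
Lemma mean_mulgr f h : ccont f -> mean (fun g => f (g * h)%g) = mean f.
Proof.
move=> cf; rewrite -mean_inv; last exact: ccont_mulgr.
rewrite -[RHS]mean_inv// -[RHS](mean_mulgl h^-1%g); last exact: ccont_inv.
by congr mean; apply/funext => g; rewrite invgM invgK.
Qed.

(** If [f] is positive at one point, finitely many right translates of [f] have a sum bounded below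
    by a positive constant, while the mean of this sum is a multiple of [mean f]. *)
Lemma mean_eq0 f : ccont f -> (forall g, 0 <= f g) -> mean f = 0 -> forall g, f g = 0.
Proof.
move=> cf f0 m0 g0; apply/eqP; apply: contraPT m0 => fg0.
pose c := complex.Re (f g0); have c0 : 0 < c.
  rewrite lt_neqAle Re_ge0// andbT eq_sym; apply: contraNneq fg0 => h.
  by rewrite (ge0_complex (f0 g0)) -/c h.
have c20 : 0 < c / 2 by rewrite divr_gt0.
pose O (t g : G) := c / 2 <= complex.Re (f (g * (t^-1 * g0))%g).
have [t|ts hts] := @finite_cover _ _ _ Gc O.
  have /ccontP/(_ t _ c20) := ccont_mulgr (t^-1 * g0)%g cf.
  apply: filterS => g /ltW /(le_trans (normc_ge_Re _)).
  rewrite ReB mulVKg -/c /O; have : c = c / 2 + c / 2 by field.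
  by rewrite ler_norml; lra.
have ts0 : (0 < size ts)%N by have [b] := hts 1%g; case: (ts).
have lb g : c / 2 <= \sum_(t <- ts) complex.Re (f (g * (t^-1 * g0))%g).
  have [t tts Ot] := hts g; rewrite (big_rem t)//=.
  by apply: le_trans Ot _; rewrite lerDl sumr_ge0// => ? _; exact: Re_ge0.
pose F g := \sum_(t <- ts) f (g * (t^-1 * g0))%g.
have cF : ccont F by apply: ccont_sum => t; exact: ccont_mulgr.
have mF : mean F = (size ts)%:R * mean f.
  rewrite mean_sum; last by move=> t; exact: ccont_mulgr.
  under eq_bigr do rewrite mean_mulgr//.
  by rewrite big_const_seq count_predT iter_addr_0 mulr_natl.
move=> m0; have : 0 <= mean (fun g => F g - (c / 2)%:C).
  apply: mean_ge0; first by apply: ccontB => //; exact: ccont_cst.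
  move=> g; rewrite lecE ReB ImB /= subr_ge0 /F Re_sum lb subr0 Im_sum andbT.
  by rewrite big1 ?eqxx// => t _; rewrite (ge0_complex (f0 _)).
rewrite meanB//; last exact: ccont_cst.
by rewrite mean_cst mF m0 mulr0 lecE /= => /andP[_]; lra.
Qed.

End invariant_mean_existence.

Global Opaque mean.

(** * Semi-inner products *)

(* The pairing need only behave well on S, e.g. the square integrable functions among all
   functions; it is not assumed definite, so functions equal almost everywhere need not be
   identified. *)
Record semidot (R : realType) (E : lmodType R[i]) (S : set E) (dot : E -> E -> R[i]) : Prop :=
  Semidot {
    sd0 : S 0;
    sdP : forall a x y, S x -> S y -> S (a *: x + y);
    sd_linear : forall a x y z, S x -> S y -> S z ->
      dot (a *: x + y) z = a * dot x z + dot y z;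
    sd_conj : forall x y, S x -> S y -> dot y x = conjc (dot x y);
    sd_ge0 : forall x, S x -> 0 <= dot x x }.

Section semi_inner_product.
Context {R : realType} {E : lmodType R[i]} (dot : E -> E -> R[i]).

Definition sqn (x : E) : R := complex.Re (dot x x).
Definition hnorm (x : E) : R := Num.sqrt (sqn x).
Definition orthonormal (k : nat) (e : 'I_k -> E) := forall i j, dot (e i) (e j) = (i == j)%:R.

Context {S : set E} (H : semidot S dot).
Implicit Types (x y z : E) (a : R[i]).

Lemma sdZ a x : S x -> S (a *: x).
Proof. by move=> Sx; rewrite -[_ *: _]addr0; apply: sdP H _ _ _ Sx (sd0 H). Qed.

Lemma sdD x y : S x -> S y -> S (x + y).
Proof. by move=> Sx Sy; rewrite -[x]scale1r; exact: sdP H _ _ _ Sx Sy. Qed.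

Lemma sdN x : S x -> S (- x).
Proof. by rewrite -scaleN1r; exact: sdZ. Qed.

Lemma sdB x y : S x -> S y -> S (x - y).
Proof. by move=> Sx Sy; apply: sdD => //; exact: sdN. Qed.

Lemma sd_sum (I : Type) (r : seq I) (F : I -> E) : (forall i, S (F i)) -> S (\sum_(i <- r) F i).
Proof. by move=> SF; elim/big_rec: _ => [|i x _ Sx]; [exact: (sd0 H)|exact: sdD]. Qed.

Lemma dot0l z : S z -> dot 0 z = 0.
Proof.
move=> Sz; have := sd_linear H 1 (sd0 H) (sd0 H) Sz.
by rewrite scale1r addr0 mul1r => /eqP; rewrite -subr_eq0 opprD addNKr oppr_eq0 => /eqP.
Qed.

Lemma dotZl a x z : S x -> S z -> dot (a *: x) z = a * dot x z.
Proof.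
move=> Sx Sz; rewrite -[a *: x]addr0 (sd_linear H)//; last exact: (sd0 H).
by rewrite dot0l// addr0.
Qed.

Lemma dotDl x y z : S x -> S y -> S z -> dot (x + y) z = dot x z + dot y z.
Proof. by move=> Sx Sy Sz; rewrite -[x]scale1r (sd_linear H)// scale1r mul1r. Qed.

Lemma dotNl x z : S x -> S z -> dot (- x) z = - dot x z.
Proof. by move=> Sx Sz; rewrite -scaleN1r dotZl// mulN1r. Qed.

Lemma dotBl x y z : S x -> S y -> S z -> dot (x - y) z = dot x z - dot y z.
Proof. by move=> Sx Sy Sz; rewrite dotDl ?dotNl//; exact: sdN. Qed.

Lemma dot_suml (I : Type) (r : seq I) (F : I -> E) z : (forall i, S (F i)) -> S z ->
  dot (\sum_(i <- r) F i) z = \sum_(i <- r) dot (F i) z.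
Proof.
move=> SF Sz; elim: r => [|i r ih]; first by rewrite !big_nil dot0l.
by rewrite !big_cons dotDl ?ih//; exact: sd_sum.
Qed.

Lemma dot0r z : S z -> dot z 0 = 0.
Proof. by move=> Sz; rewrite (sd_conj H) ?dot0l ?conjc0//; exact: (sd0 H). Qed.

Lemma dotZr a x z : S x -> S z -> dot z (a *: x) = conjc a * dot z x.
Proof.
by move=> Sx Sz; rewrite (sd_conj H) ?dotZl ?conjcM -?(sd_conj H)//; exact: sdZ.
Qed.

Lemma dotDr x y z : S x -> S y -> S z -> dot z (x + y) = dot z x + dot z y.
Proof.
move=> Sx Sy Sz; have Sxy := sdD Sx Sy.
by rewrite (sd_conj H)// dotDl// rmorphD /= -!(sd_conj H).
Qed.

Lemma dotNr x z : S x -> S z -> dot z (- x) = - dot z x.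
Proof.
move=> Sx Sz; have SN := sdN Sx.
by rewrite (sd_conj H)// dotNl// rmorphN /= -(sd_conj H).
Qed.

Lemma dotBr x y z : S x -> S y -> S z -> dot z (x - y) = dot z x - dot z y.
Proof. by move=> Sx Sy Sz; rewrite dotDr ?dotNr//; exact: sdN. Qed.

Lemma dot_sumr (I : Type) (r : seq I) (F : I -> E) z : (forall i, S (F i)) -> S z ->
  dot z (\sum_(i <- r) F i) = \sum_(i <- r) dot z (F i).
Proof.
move=> SF Sz; elim: r => [|i r ih]; first by rewrite !big_nil dot0r.
by rewrite !big_cons dotDr ?ih//; exact: sd_sum.
Qed.

Lemma sqn_ge0 x : S x -> 0 <= sqn x.
Proof. by move=> Sx; apply: Re_ge0; exact: (sd_ge0 H). Qed.

Lemma dot_sqn x : S x -> dot x x = (sqn x)%:C.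
Proof. by move=> Sx; apply: ge0_complex; exact: (sd_ge0 H). Qed.

Lemma sqnZ a x : S x -> sqn (a *: x) = Normc.normc a ^+ 2 * sqn x.
Proof.
move=> Sx; rewrite /sqn dotZl//; last exact: sdZ.
by rewrite dotZr// mulrA mulcJ dot_sqn// ReM /= mulr0 subr0.
Qed.

Lemma sqnN x : S x -> sqn (- x) = sqn x.
Proof. by move=> Sx; rewrite /sqn dotNl ?dotNr ?opprK//; exact: sdN. Qed.

Lemma sqnD x y : S x -> S y -> sqn (x + y) = sqn x + 2 * complex.Re (dot x y) + sqn y.
Proof.
move=> Sx Sy; have Sxy := sdD Sx Sy.
by rewrite /sqn dotDl// !dotDr// !ReD (sd_conj H Sx Sy) ReJ; ring.
Qed.

Lemma sqnB x y : S x -> S y -> sqn (x - y) = sqn x - 2 * complex.Re (dot x y) + sqn y.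
Proof.
move=> Sx Sy; have SN := sdN Sy.
by rewrite sqnD// dotNr// ReN sqnN// mulrN.
Qed.

(** The squared norm of [x - r (x, y) y] is nonnegative for every real [r]. The pairing may
    degenerate, so the case of a vector [y] of norm 0 is separate. *)
Lemma cauchy_schwarz_sq x y : S x -> S y ->
  Normc.normc (dot x y) ^+ 2 <= sqn x * sqn y.
Proof.
move=> Sx Sy; set D := _ ^+ 2; have D0 : 0 <= D by exact: sqr_ge0.
have key (r : R) : 0 <= sqn x - 2 * r * D + r ^+ 2 * D * sqn y.
  have Sz : S ((r%:C * dot x y) *: y) by exact: sdZ.
  have -> : sqn x - 2 * r * D + r ^+ 2 * D * sqn y = sqn (x - (r%:C * dot x y) *: y).
    rewrite sqnB// sqnZ// Normc.normcM exprMn normc_real real_normK ?num_real// -/D.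
    rewrite dotZr// conjcM conjc_real -(mulrA r%:C) (mulrC (conjc _)) mulcJ -/D.
    by rewrite ReM /= mulr0 subr0 mulrA.
  by apply: sqn_ge0; exact: sdB.
have [y0|yn0] := eqVneq (sqn y) 0.
  rewrite y0 mulr0; have [->//|Dn0] := eqVneq D 0.
  (* Without the quadratic term the expression is affine in [r], and this [r] would make it equal to
     [- sqn x - 2]. *)
  have := key ((sqn x + 1) / D); rewrite y0 mulr0 addr0 -mulrA mulfVK//.
  have := sqn_ge0 Sx; lra.
have y0 : 0 < sqn y by rewrite lt_neqAle eq_sym yn0 sqn_ge0.
have := key (sqn y)^-1.
have -> : sqn x - 2 * (sqn y)^-1 * D + (sqn y)^-1 ^+ 2 * D * sqn y = sqn x - D / sqn y by field.
by rewrite subr_ge0 ler_pdivrMr.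
Qed.

Lemma hnorm_ge0 x : 0 <= hnorm x. Proof. exact: sqrtr_ge0. Qed.

Lemma sqr_hnorm x : S x -> hnorm x ^+ 2 = sqn x.
Proof. by move=> Sx; rewrite sqr_sqrtr// sqn_ge0. Qed.

Lemma cauchy_schwarz x y : S x -> S y -> Normc.normc (dot x y) <= hnorm x * hnorm y.
Proof.
move=> Sx Sy; rewrite -ler_sqr ?nnegrE ?mulr_ge0 ?hnorm_ge0 ?normc_ge0//.
by rewrite exprMn !sqr_hnorm// cauchy_schwarz_sq.
Qed.

Lemma ler_hnormD x y : S x -> S y -> hnorm (x + y) <= hnorm x + hnorm y.
Proof.
move=> Sx Sy; rewrite -ler_sqr ?nnegrE ?addr_ge0 ?hnorm_ge0//.
rewrite sqrrD !sqr_hnorm ?sqnD//; last exact: sdD.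
have := le_trans (ler_norm _) (le_trans (normc_ge_Re _) (cauchy_schwarz Sx Sy)).
by set p := hnorm x * hnorm y; lra.
Qed.

Lemma hnormN x : S x -> hnorm (- x) = hnorm x.
Proof. by move=> Sx; rewrite /hnorm sqnN. Qed.

Lemma hnormBC x y : S x -> S y -> hnorm (x - y) = hnorm (y - x).
Proof. by move=> Sx Sy; rewrite -opprB hnormN//; exact: sdB. Qed.

Lemma hnormZ a x : S x -> hnorm (a *: x) = Normc.normc a * hnorm x.
Proof.
by move=> Sx; rewrite /hnorm sqnZ// sqrtrM ?sqr_ge0// sqrtr_sqr ger0_norm// normc_ge0.
Qed.

Lemma hnorm_le x (c : R) : 0 <= c -> (hnorm x <= c) = (sqn x <= c ^+ 2).
Proof.
move=> c0; rewrite /hnorm -{1}(ger0_norm c0) -sqrtr_sqr ler_sqrt// sqr_ge0.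
by [].
Qed.

Lemma ler_hnorm_sum (I : Type) (r : seq I) (F : I -> E) : (forall i, S (F i)) ->
  hnorm (\sum_(i <- r) F i) <= \sum_(i <- r) hnorm (F i).
Proof.
move=> SF; elim: r => [|i r ih].
  by rewrite !big_nil /hnorm /sqn dot0l ?sqrtr0//; exact: (sd0 H).
rewrite !big_cons; apply: le_trans (ler_hnormD _ _) _ => //; first exact: sd_sum.
by rewrite lerD2l.
Qed.

Lemma sqn_orthogonal_sum (k : nat) (e : 'I_k -> E) (c : 'I_k -> R[i]) :
  (forall i, S (e i)) -> orthonormal e ->
  sqn (\sum_i c i *: e i) = \sum_i Normc.normc (c i) ^+ 2.
Proof.
move=> Se oe; have Sce i : S (c i *: e i) by exact: sdZ.
rewrite /sqn dot_suml//; last exact: sd_sum.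
rewrite Re_sum; apply: eq_bigr => i _; rewrite dot_sumr// (bigD1 i)//=.
rewrite dotZl// dotZr// oe eqxx mulr1 mulcJ big1 ?addr0// => j ji.
by rewrite dotZl// dotZr// oe eq_sym (negbTE ji) !mulr0.
Qed.

Lemma dot_projection (k : nat) (e : 'I_k -> E) x j :
  (forall i, S (e i)) -> orthonormal e -> S x ->
  dot (x - \sum_i dot x (e i) *: e i) (e j) = 0.
Proof.
move=> Se oe Sx; have Sce i : S (dot x (e i) *: e i) by exact: sdZ.
rewrite dotBl//; last exact: sd_sum.
rewrite dot_suml// (bigD1 j)//= dotZl// oe eqxx mulr1 big1 ?addr0 ?subrr// => i ij.
by rewrite dotZl// oe (negbTE ij) mulr0.
Qed.

Lemma sqn_projection (k : nat) (e : 'I_k -> E) x :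
  (forall i, S (e i)) -> orthonormal e -> S x ->
  sqn (x - \sum_i dot x (e i) *: e i) = sqn x - \sum_i Normc.normc (dot x (e i)) ^+ 2.
Proof.
move=> Se oe Sx; have Sce i : S (dot x (e i) *: e i) by exact: sdZ.
have Ssum : S (\sum_i dot x (e i) *: e i) by exact: sd_sum.
rewrite sqnB// sqn_orthogonal_sum// dot_sumr// Re_sum.
have -> : \sum_i complex.Re (dot x (dot x (e i) *: e i)) = \sum_i Normc.normc (dot x (e i)) ^+ 2.
  by apply: eq_bigr => i _; rewrite dotZr// mulrC mulcJ.
by ring.
Qed.

Lemma bessel (k : nat) (e : 'I_k -> E) x :
  (forall i, S (e i)) -> orthonormal e -> S x ->
  \sum_i Normc.normc (dot x (e i)) ^+ 2 <= sqn x.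
Proof.
move=> Se oe Sx; rewrite -subr_ge0 -sqn_projection//; apply: sqn_ge0; apply: sdB => //.
by apply: sd_sum => i; exact: sdZ.
Qed.

Lemma orthonormal_extend (k : nat) (e : 'I_k -> E) x :
  (forall i, S (e i)) -> orthonormal e -> S x -> (forall i, dot x (e i) = 0) -> sqn x != 0 ->
  exists e' : 'I_k.+1 -> E, [/\ forall i, S (e' i), orthonormal e' &
    forall i : 'I_k, e' (lift ord0 i) = e i].
Proof.
move=> Se oe Sx xe xn0; have x0 : 0 < sqn x by rewrite lt_neqAle eq_sym xn0 sqn_ge0.
pose c : R[i] := ((hnorm x)^-1)%:C.
pose e' (i : 'I_k.+1) := if unlift ord0 i is Some j then e j else c *: x.
have Se' i : S (e' i) by rewrite /e'; case: (unlift _ _) => [j|]; [exact: Se|exact: sdZ].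
have hx : hnorm x != 0 by rewrite sqrtr_eq0 -ltNge.
exists e'; split=> // [i j|i]; last by rewrite /e' liftK.
rewrite /e'; case: unliftP => [i' ->|->]; case: unliftP => [j' ->|->].
- by rewrite oe (inj_eq lift_inj).
- by rewrite dotZr// (sd_conj H)// xe conjc0 mulr0 eq_sym; case: eqP => // /eqP; rewrite (negbTE (neq_lift _ _)).
- by rewrite dotZl// xe mulr0; case: eqP => // /eqP; rewrite (negbTE (neq_lift _ _)).
rewrite eqxx dotZl ?dotZr//; last exact: sdZ.
rewrite dot_sqn// mulrA /c conjc_real -!rmorphM /= -(sqr_hnorm Sx).
by rewrite (_ : _ * _ = 1)//; field.
Qed.

(** Finite dimension enters as a bound on the size of orthonormal families. A family of maximal size
    leaves no residual, since a residual could be normalised and added. *)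
Lemma orthonormal_basis_exists (N : nat) :
  (forall x, S x -> sqn x = 0 -> x = 0) ->
  (forall k (e : 'I_k -> E), (forall i, S (e i)) -> orthonormal e -> (k <= N)%N) ->
  exists k (e : 'I_k -> E), [/\ forall i, S (e i), orthonormal e &
    forall x, S x -> x = \sum_i dot x (e i) *: e i].
Proof.
move=> def bnd.
pose P k := `[< exists e : 'I_k -> E, (forall i, S (e i)) /\ orthonormal e >].
have exP : exists k, P k by exists 0%N; apply/asboolP; exists (fun=> 0); split=> -[].
have ubP k : P k -> (k <= N)%N by move=> /asboolP[e [Se oe]]; exact: bnd Se oe.
case: (ex_maxnP exP ubP) => k /asboolP[e [Se oe]] kmax.
exists k, e; split=> // x Sx; apply/eqP; rewrite -subr_eq0; apply/eqP.
have Sce i : S (dot x (e i) *: e i) by exact: sdZ.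
have Sy : S (x - \sum_i dot x (e i) *: e i) by apply: sdB => //; exact: sd_sum.
apply: def => //; apply/eqP; apply: contraT => yn0.
have [|e' [Se' oe' _]] := orthonormal_extend Se oe Sy _ yn0.
  by move=> j; exact: dot_projection.
by have := kmax k.+1; rewrite ltnn => -> //; apply/asboolP; exists e'.
Qed.

(** The double sum of the squared moduli of [dot (f j) (e i)] equals [m] by Parseval for [e] and is
    at most [k] by Bessel for [f]. *)
Lemma orthonormal_size (k m : nat) (e : 'I_k -> E) (f : 'I_m -> E) :
  (forall i, S (e i)) -> orthonormal e -> (forall x, S x -> x = \sum_i dot x (e i) *: e i) ->
  (forall j, S (f j)) -> orthonormal f -> (m <= k)%N.
Proof.
move=> Se oe he Sf of_; rewrite -(ler_nat R).
have one (l : nat) (h : 'I_l -> E) : orthonormal h -> forall j, sqn (h j) = 1.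
  by move=> oh j; rewrite /sqn oh eqxx.
have -> : m%:R = \sum_(j < m) \sum_(i < k) Normc.normc (dot (f j) (e i)) ^+ 2.
  rewrite -[in LHS](card_ord m) -sumr_const; apply: eq_bigr => j _.
  by rewrite -(one _ _ of_ j) {1}(he _ (Sf j)) sqn_orthogonal_sum.
have -> : k%:R = \sum_(i < k) (1 : R) by rewrite sumr_const card_ord.
rewrite exchange_big; apply: ler_sum => i _; rewrite -(one _ _ oe i).
under eq_bigr => j _ do rewrite (sd_conj H) ?normcJ//.
exact: bessel.
Qed.

Lemma semidot_sub (S' : set E) : S' `<=` S -> S' 0 ->
  (forall a x y, S' x -> S' y -> S' (a *: x + y)) -> semidot S' dot.
Proof.
move=> sub S0 SP; split=> //.
- by move=> a x y z /sub Sx /sub Sy /sub Sz; exact: (sd_linear H).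
- by move=> x y /sub Sx /sub Sy; exact: (sd_conj H).
- by move=> x /sub Sx; exact: (sd_ge0 H).
Qed.

End semi_inner_product.

Section hilbert_valued_functions.
Context {R : realType} {E : lmodType R[i]} {dot : E -> E -> R[i]} {S : set E}.
Hypothesis H : semidot S dot.

(** The space [E] carries no topology; continuity refers to the seminorm of [dot]. *)
Definition hcont (T : topologicalType) (f : T -> E) :=
  forall t (e : R), 0 < e -> \forall u \near t, hnorm dot (f u - f t) < e.

Lemma hcont_comp (T U : topologicalType) (f : U -> E) (h : T -> U) :
  continuous h -> hcont f -> hcont (fun t => f (h t)).
Proof. by move=> ch cf t e e0; exact: (ch t _ (cf (h t) e e0)). Qed.

Lemma hcont_cst (T : topologicalType) (x : E) : S x -> hcont (fun _ : T => x).
Proof.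
move=> Sx t e e0; apply: nearW => _; rewrite subrr /hnorm /sqn (dot0l H) ?sqrtr0//.
exact: (sd0 H).
Qed.

Lemma hcontD (T : topologicalType) (f g : T -> E) : (forall t, S (f t)) -> (forall t, S (g t)) ->
  hcont f -> hcont g -> hcont (fun t => f t + g t).
Proof.
move=> Sf Sg cf cg t e e0; have e20 : 0 < e / 2 by rewrite divr_gt0.
near=> u.
have -> : f u + g u - (f t + g t) = (f u - f t) + (g u - g t) by rewrite opprD addrACA.
apply: le_lt_trans (ler_hnormD H _ _) _; [exact: (sdB H)|exact: (sdB H)|].
by rewrite [e]splitr ltrD//; near: u; [exact: cf|exact: cg].
Unshelve. all: by end_near. Qed.

Lemma hcontZ (T : topologicalType) (c : T -> R[i]) (f : T -> E) : (forall t, S (f t)) ->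
  ccont c -> hcont f -> hcont (fun t => c t *: f t).
Proof.
move=> Sf /ccontP cc cf t e e0.
pose A := Normc.normc (c t); pose B := hnorm dot (f t).
have A0 : 0 <= A by exact: normc_ge0.
have B0 : 0 <= B by exact: hnorm_ge0.
(* The error is below [(d + A) * d + d * B], and [d <= 1] keeps this below [d * (A + B + 2)]. *)
pose d := Num.min 1 (e / (A + B + 2)).
have d0 : 0 < d by rewrite lt_min ltr01 divr_gt0//; lra.
have d1 : d <= 1 by rewrite ge_min lexx.
have de : d * (A + B + 2) <= e.
  by rewrite -ler_pdivlMr ?ge_min ?lexx ?orbT//; lra.
near=> u.
have -> : c u *: f u - c t *: f t = c u *: (f u - f t) + (c u - c t) *: f t.
  by rewrite scalerBr scalerBl addrA subrK.
have S1 : S (f u - f t) by exact: (sdB H).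
apply: le_lt_trans (ler_hnormD H _ _) _; [exact: (sdZ H)|exact: (sdZ H)|].
rewrite !(hnormZ H)//.
have h1 : Normc.normc (c u - c t) < d by near: u; exact: cc.
have h2 : hnorm dot (f u - f t) < d by near: u; exact: cf.
have h3 : Normc.normc (c u) <= d + A.
  have -> : c u = (c u - c t) + c t by rewrite subrK.
  by apply: le_trans (ler_normcD _ _) _; rewrite lerD2r ltW.
have h4 := hnorm_ge0 dot (f u - f t).
have h5 := normc_ge0 (c u - c t).
have h6 : Normc.normc (c u) * hnorm dot (f u - f t) <= (d + A) * d.
  by apply: ler_pM => //; [exact: normc_ge0|exact: ltW].
have h7 : Normc.normc (c u - c t) * B <= d * B by rewrite ler_wpM2r// ltW.
rewrite -/B; nra.
Unshelve. all: by end_near. Qed.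

Lemma hcont_sum (T : topologicalType) (I : Type) (r : seq I) (f : I -> T -> E) :
  (forall i t, S (f i t)) -> (forall i, hcont (f i)) -> hcont (fun t => \sum_(i <- r) f i t).
Proof.
move=> Sf cf; elim: r => [|i r ih].
  by under eq_fun do rewrite big_nil; apply: hcont_cst; exact: (sd0 H).
under eq_fun do rewrite big_cons.
by apply: hcontD => // t; apply: (sd_sum H).
Qed.

Lemma hcont_dot (T : topologicalType) (f g : T -> E) : (forall t, S (f t)) ->
  (forall t, S (g t)) -> hcont f -> hcont g -> ccont (fun t => dot (f t) (g t)).
Proof.
move=> Sf Sg cf cg; apply/ccontP => t e e0.
pose A := hnorm dot (f t); pose B := hnorm dot (g t).
have A0 : 0 <= A by exact: hnorm_ge0.
have B0 : 0 <= B by exact: hnorm_ge0.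
pose d := Num.min 1 (e / (A + B + 2)).
have d0 : 0 < d by rewrite lt_min ltr01 divr_gt0//; lra.
have d1 : d <= 1 by rewrite ge_min lexx.
have de : d * (A + B + 2) <= e.
  by rewrite -ler_pdivlMr ?ge_min ?lexx ?orbT//; lra.
near=> u.
have S1 : S (f u - f t) by exact: (sdB H).
have S2 : S (g u - g t) by exact: (sdB H).
have -> : dot (f u) (g u) - dot (f t) (g t) =
    dot (f u - f t) (g u) + dot (f t) (g u - g t).
  by rewrite (dotBl H)// (dotBr H)//; ring.
apply: le_lt_trans (ler_normcD _ _) _.
have h1 : hnorm dot (f u - f t) < d by near: u; exact: cf.
have h2 : hnorm dot (g u - g t) < d by near: u; exact: cg.
have h3 : hnorm dot (g u) <= d + B.
  have -> : g u = (g u - g t) + g t by rewrite subrK.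
  by apply: le_trans (ler_hnormD H _ _) _ => //; rewrite lerD2r ltW.
have h4 := cauchy_schwarz H S1 (Sg u).
have h5 := cauchy_schwarz H (Sf t) S2.
have h6 : hnorm dot (f u - f t) * hnorm dot (g u) <= d * (d + B).
  by apply: ler_pM => //; [exact: hnorm_ge0|exact: hnorm_ge0|exact: ltW].
have h7 : A * hnorm dot (g u - g t) <= A * d by rewrite ler_wpM2l// ltW.
rewrite -/A in h5; nra.
Unshelve. all: by end_near. Qed.

Definition hcomplete := forall u : nat -> E, (forall k, S (u k)) ->
  (forall e : R, 0 < e -> exists k, forall l m, (k <= l)%N -> (k <= m)%N ->
     hnorm dot (u l - u m) <= e) ->
  exists x, S x /\ forall e : R, 0 < e -> exists k, forall l, (k <= l)%N ->
     hnorm dot (u l - x) <= e.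

End hilbert_valued_functions.
Arguments hcont {R E} dot {T} f.
Arguments hcomplete {R E} dot S.

(** * Means depending on a parameter, Fubini's theorem and vector-valued means *)

Section mean_with_parameter.
Context {R : realType} {n : nat} {G : lieGroupType R n}.
Hypothesis Gc : compact [set: G].

Lemma ccont_slice (T : topologicalType) (F : T -> G -> R[i]) t :
  ccont (fun p : T * G => F p.1 p.2) -> ccont (F t).
Proof.
move=> cF; apply: (@ccont_comp _ _ _ _ (fun g : G => (t, g)) _ cF) => g.
by apply: cvg_pair; [exact: cvg_cst|exact: cvg_id].
Qed.

Lemma ccont_swap (T U : topologicalType) (F : T -> U -> R[i]) :
  ccont (fun p : T * U => F p.1 p.2) -> ccont (fun p : U * T => F p.2 p.1).
Proof.
move=> cF; apply: (@ccont_comp _ _ _ _ (fun p : U * T => (p.2, p.1)) _ cF) => p.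
by apply: cvg_pair; [exact: cvg_snd|exact: cvg_fst].
Qed.

Lemma near_slice (T : topologicalType) (F : T -> G -> R[i]) t (e : R) :
  ccont (fun p : T * G => F p.1 p.2) -> 0 < e ->
  \forall u \near t, forall g, Normc.normc (F u g - F t g) < e.
Proof.
move=> cF e0.
move/compact_near_coveringP : Gc =>
  /(_ _ (nbhs t) (fun u g => Normc.normc (F u g - F t g) < e)) cover.
apply: (filterS _ (cover _ _)) => [u h g|g _]; first exact: h.
have cS : ccont (fun p : G * T => F p.2 p.1 - F t p.1).
  apply: ccontB; first exact: ccont_swap.
  by apply: (@ccont_comp _ _ _ (F t) (fun p : G * T => p.1));
    [move=> p; exact: cvg_fst|exact: ccont_slice].
have /ccontP/(_ (g, t) _ e0) := cS.
by rewrite /= subrr; apply: filterS => -[x u] /=; rewrite subr0.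
Qed.

Lemma ccont_mean (T : topologicalType) (F : T -> G -> R[i]) :
  ccont (fun p : T * G => F p.1 p.2) -> ccont (fun t => mean (F t)).
Proof.
move=> cF; apply/ccontP => t e e0.
have := near_slice t cF (divr_gt0 e0 (ltr0n _ 2)); apply: filterS => u hu.
have cu := ccont_slice u cF; have ct := ccont_slice t cF.
rewrite -(meanB Gc)//; apply: le_lt_trans (normc_mean_le Gc (c := e / 2) _ _) _.
- exact: ccontB.
- by move=> g; exact: ltW.
- by rewrite ltr_pdivrMr// mulr_natr mulr2n ltrDl.
Qed.

(** By compactness every [F t] is uniformly close to one of finitely many, so a single sequence of
    translates serves all parameters; [f] is carried along as one more member of the finite
    family. *)
Lemma mean_approx_unif (F : G -> G -> R[i]) (f : G -> R[i]) (e : R) :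
  ccont (fun p : G * G => F p.1 p.2) -> ccont f -> 0 < e ->
  exists s, [/\ (0 < size s)%N,
    forall t g, Normc.normc (avg s (F t) g - mean (F t)) <= e &
    forall g, Normc.normc (avg s f g - mean f) <= e].
Proof.
move=> cF cf e0; have e30 : 0 < e / 3 by rewrite divr_gt0.
have [ts hts] := finite_cover Gc (fun t => near_slice t cF e30).
pose F' (o : option G) := if o is Some t then F t else f.
have cF' o : ccont (F' o) by case: o => [t|//]; exact: ccont_slice.
have [s [s0 hs]] := mean_approx Gc (None :: map Some ts) cF' e30.
exists s; split=> // [t g|g]; last first.
  by apply: le_trans (hs None (mem_head _ _) g) _; rewrite ler_pdivrMr//; lra.
have [t0 t0s ht0] := hts t.
have {}hs := hs (Some t0); rewrite in_cons map_f ?orbT// in hs.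
have {}hs := hs isT g; rewrite /= in hs.
have h1 : Normc.normc (avg s (F t) g - avg s (F t0) g) <= e / 3.
  by rewrite -avgB; apply: normc_avg_le => // x; exact: ltW.
have h2 : Normc.normc (mean (F t0) - mean (F t)) <= e / 3.
  rewrite -(meanB Gc); [|exact: ccont_slice|exact: ccont_slice].
  apply: normc_mean_le => // [|x]; first by apply: ccontB; exact: ccont_slice.
  by rewrite normcBC ltW.
have -> : avg s (F t) g - mean (F t) = (avg s (F t) g - avg s (F t0) g) +
   ((avg s (F t0) g - mean (F t0)) + (mean (F t0) - mean (F t))) by ring.
apply: le_trans (ler_normcD _ _) _.
have h3 := ler_normcD (avg s (F t0) g - mean (F t0)) (mean (F t0) - mean (F t)).
lra.
Qed.

(** The inner mean is replaced, uniformly in the parameter, by a finite average, and a finite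
    average commutes with the outer mean. *)
Lemma mean_fubini (F : G -> G -> R[i]) : ccont (fun p : G * G => F p.1 p.2) ->
  mean (fun t => mean (F t)) = mean (fun g => mean (F ^~ g)).
Proof.
move=> cF; have cF' := ccont_swap cF.
have c1 : ccont (fun t => mean (F t)) by exact: ccont_mean.
have c2 : ccont (fun g => mean (F ^~ g)) by exact: (@ccont_mean _ (fun g t => F t g)).
apply/eqP; rewrite -subr_eq0; apply/eqP/normc_small => e e0.
have [s [s0 hs hs']] := mean_approx_unif cF c2 (divr_gt0 e0 (ltr0n _ 2)).
have cs t : ccont (F ^~ t) by exact: (@ccont_slice _ (fun g t => F t g)).
have ca : ccont (fun t => avg s (F t) 1%g) by apply: ccontZ; exact: ccont_sum.
have h1 : mean (fun t => avg s (F t) 1%g) = avg s (fun g => mean (F ^~ g)) 1%g.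
  rewrite !avgE -(mean_sum Gc)//; rewrite -(meanZ Gc)//; exact: ccont_sum.
set A := mean _; set B := mean _.
have -> : A - B = (A - mean (fun t => avg s (F t) 1%g)) + (avg s (fun g => mean (F ^~ g)) 1%g - B).
  by rewrite h1; ring.
apply: le_trans (ler_normcD _ _) _; rewrite [e]splitr lerD//.
rewrite -(meanB Gc)//; apply: normc_mean_le => //; first exact: ccontB.
by move=> t; rewrite normcBC.
Qed.

Definition mdot (f g : G -> R[i]) : R[i] := mean (fun x => f x * conjc (g x)).

Lemma ccont_dot (f g : G -> R[i]) : ccont f -> ccont g -> ccont (fun x => f x * conjc (g x)).
Proof. by move=> cf cg; apply: ccontM => //; exact: ccontJ. Qed.

Lemma mdot_semidot : semidot [set f : G -> R[i] | ccont f] mdot.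
Proof.
split=> /=.
- exact: ccont_cst.
- by move=> a x y cx cy; apply: ccontD => //; exact: ccontZ.
- move=> a x y z cx cy cz; rewrite /mdot -(mean_linear Gc); [|exact: ccont_dot|exact: ccont_dot].
  by congr mean; apply/funext => g; rewrite mulrDl mulrA.
- move=> x y cx cy; rewrite /mdot. rewrite -(mean_conj Gc); last exact: ccont_dot.
  by congr mean; apply/funext => g; rewrite conjcM conjcK mulrC.
- move=> x cx; apply: (mean_ge0 Gc); first exact: ccont_dot.
  by move=> g; rewrite mulcJ ler0c sqr_ge0.
Qed.

Lemma mdot_eq0 (f : G -> R[i]) : ccont f -> sqn mdot f = 0 -> f = 0.
Proof.
move=> cf f0; apply/funext => g.
have := @mean_eq0 _ _ _ Gc (fun x => f x * conjc (f x)) (ccont_dot cf cf).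
have m0 : mdot f f = 0 by rewrite (dot_sqn mdot_semidot)// f0.
move=> /(_ _ m0 g) h; have {h} : f g * conjc (f g) = 0.
  by apply: h => x; rewrite mulcJ ler0c sqr_ge0.
by rewrite mulcJ => -[] /eqP; rewrite sqrf_eq0 => /eqP /Normc.eq0_normc.
Qed.

Section hilbert_valued_mean.
Context {E : lmodType R[i]} {dot : E -> E -> R[i]} {S : set E}.
Hypothesis H : semidot S dot.

(** A relation rather than a function: the limit is determined only up to a vector of seminorm 0. *)
Definition is_mean (f : G -> E) (y : E) := forall e : R, 0 < e ->
  exists s, (0 < size s)%N /\ forall g, hnorm dot (avg s f g - y) <= e.

Lemma sd_avg s (f : G -> E) g : (forall x, S (f x)) -> S (avg s f g).
Proof. by move=> Sf; apply: (sdZ H); exact: (sd_sum H). Qed.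

Lemma dot_avgl s (f : G -> E) x g : (forall x, S (f x)) -> S x ->
  dot (avg s f g) x = avg s (fun h => dot (f h) x) g.
Proof.
by move=> Sf Sx; rewrite /avg (dotZl H)//; [rewrite (dot_suml H)|exact: (sd_sum H)].
Qed.

Lemma dot_avgr s (f : G -> E) x g : (forall x, S (f x)) -> S x ->
  dot x (avg s f g) = avg s (fun h => dot x (f h)) g.
Proof.
move=> Sf Sx; rewrite /avg (dotZr H)//; last exact: (sd_sum H).
by rewrite (dot_sumr H)// conjc_inv conjc_nat.
Qed.

(** The form in which vector means are used later: pairing with a fixed vector reduces them to
    scalar means. *)
Lemma is_mean_dot (f : G -> E) y x : (forall g, S (f g)) -> hcont dot f -> S y -> S x ->
  is_mean f y -> dot y x = mean (fun g => dot (f g) x).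
Proof.
move=> Sf cf Sy Sx fy; apply/esym/(mean_uniq Gc).
  by apply: (hcont_dot H) => //; exact: (hcont_cst H).
move=> e e0; have x0 := hnorm_ge0 dot x.
have [|s [s0 hs]] := fy (e / (hnorm dot x + 1)); first by rewrite divr_gt0//; lra.
exists s; split=> // g; rewrite -dot_avgl// -(dotBl H)//; last exact: sd_avg.
have Sd : S (avg s f g - y) by apply: (sdB H) => //; exact: sd_avg.
apply: le_trans (cauchy_schwarz H Sd Sx) _.
apply: le_trans (ler_wpM2r x0 (hs g)) _.
by rewrite -mulrA ler_piMr ?(ltW e0)// mulrC ler_pdivrMr ?mul1r; lra.
Qed.

(** Inner products of two fine averages of [f] approach the double mean of [dot (f t) (f g)].
    Squared distances of averages therefore tend to 0, and completeness supplies the limit. *)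
Lemma is_mean_exists (f : G -> E) : hcomplete dot S -> (forall g, S (f g)) -> hcont dot f ->
  exists y, S y /\ is_mean f y.
Proof.
move=> cE Sf cf.
pose F t g := dot (f t) (f g).
have cF : ccont (fun p : G * G => F p.1 p.2).
  apply: (hcont_dot H) => //.
    by apply: (hcont_comp (f := f) (h := fun p : G * G => p.1)) => // p; exact: cvg_fst.
  by apply: (hcont_comp (f := f) (h := fun p : G * G => p.2)) => // p; exact: cvg_snd.
pose m t := mean (F t); have cm : ccont m by exact: ccont_mean.
pose C := mean m.
have pos k : 0 < k.+1%:R^-1 :> R by rewrite invr_gt0 ltr0n.
have ex k : exists s, [/\ (0 < size s)%N,
    forall t g, Normc.normc (avg s (F t) g - m t) <= k.+1%:R^-1 &
    forall g, Normc.normc (avg s m g - C) <= k.+1%:R^-1].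
  exact: mean_approx_unif.
have [s hs] := choice ex.
have near_C k l g h : Normc.normc (dot (avg (s k) f g) (avg (s l) f h) - C) <=
    k.+1%:R^-1 + l.+1%:R^-1.
  have [sk0 _ hk] := hs k; have [sl0 hl _] := hs l.
  rewrite dot_avgl//; last exact: sd_avg.
  have -> : avg (s k) (fun x => dot (f x) (avg (s l) f h)) g =
            avg (s k) (fun x => avg (s l) (F x) h) g.
    by congr avg; apply/funext => x; rewrite dot_avgr.
  set A := avg _ _ _.
  have -> : A - C = (avg (s k) m g - C) + (A - avg (s k) m g) by ring.
  apply: le_trans (ler_normcD _ _) _; rewrite lerD// /A -avgB.
  exact: normc_avg_le.
(* In the expansion of the square the constants [C] cancel. The two squares contribute twice the
   error of [k] and twice that of [l], the cross term twice the sum of both. *)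
have dist k l g h : sqn dot (avg (s k) f g - avg (s l) f h) <= 4 * (k.+1%:R^-1 + l.+1%:R^-1).
  have Sk := sd_avg (s k) g Sf; have Sl := sd_avg (s l) h Sf.
  rewrite (sqnB H)// /sqn.
  have h1 := near_C k k g g; have h2 := near_C l l h h; have h3 := near_C k l g h.
  have := le_trans (normc_ge_Re _) h1; have := le_trans (normc_ge_Re _) h2.
  have := le_trans (normc_ge_Re _) h3; rewrite !ReB !ler_norml.
  by move: (k.+1%:R^-1) (l.+1%:R^-1) => a b; lra.
have hdist k l g h (e : R) : 0 < e -> 4 * (k.+1%:R^-1 + l.+1%:R^-1) <= e ^+ 2 ->
    hnorm dot (avg (s k) f g - avg (s l) f h) <= e.
  by move=> e0 le; rewrite (hnorm_le _ _ (ltW e0)); exact: le_trans (dist _ _ _ _) le.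
have small (e : R) : 0 < e -> exists k, forall l, (k <= l)%N -> 8 * l.+1%:R^-1 <= e ^+ 2.
  move=> e0; have e20 : 0 < e ^+ 2 by rewrite exprn_gt0.
  exists (Num.truncn (8 / e ^+ 2)) => l kl.
  rewrite ler_pdivrMr ?ltr0n// -ler_pdivrMl// mulrC.
  by apply: ltW; apply: lt_le_trans (truncnS_gt _) _; rewrite ler_nat ltnS.
have [|e e0|y [Sy hy]] := cE (fun k => avg (s k) f 1%g).
- by move=> k; exact: sd_avg.
- have [k hk] := small _ e0; exists k => l j kl kj; apply: hdist => //.
  have := hk _ kl; have := hk _ kj.
  by move: (l.+1%:R^-1) (j.+1%:R^-1) => a b; lra.
exists y; split=> // e e0; have e20 : 0 < e / 2 by rewrite divr_gt0.
have [k1 hk1] := small _ e20; have [k2 hk2] := hy _ e20.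
pose k := maxn k1 k2; have [s0 _ _] := hs k.
exists (s k); split=> // g.
have -> : avg (s k) f g - y = (avg (s k) f g - avg (s k) f 1%g) + (avg (s k) f 1%g - y).
  by rewrite addrA subrK.
apply: le_trans (ler_hnormD H _ _) _.
- by apply: (sdB H); exact: sd_avg.
- by apply: (sdB H) => //; exact: sd_avg.
rewrite [e]splitr lerD//; last by apply: hk2; rewrite leq_maxr.
apply: hdist => //; have := hk1 k (leq_maxl _ _).
by move: (k.+1%:R^-1) => a; lra.
Qed.

End hilbert_valued_mean.
End mean_with_parameter.

(** * Convolution and the Peter-Weyl theorem *)

Section growth_rate.
Context {R : realType}.

Lemma bernoulli_ineq (h : R) (m : nat) : 0 <= h -> 1 + m%:R * h <= (1 + h) ^+ m.
Proof.
move=> h0; elim: m => [|m ih]; first by rewrite mul0r addr0 expr0.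
rewrite exprS -natr1; apply: le_trans (ler_wpM2l _ ih); last by rewrite addr_ge0.
have : 0 <= m%:R * h * h by rewrite !mulr_ge0.
by rewrite mulrDl mulrDr !mulrDl; lra.
Qed.

Lemma le_of_pow_le (x y c : R) : 0 < x -> 0 < y -> 0 < c ->
  (forall m, c * x ^+ m <= y ^+ m) -> x <= y.
Proof.
move=> x0 y0 c0 hm; rewrite leNgt; apply/negP => yx.
pose h := x / y - 1; have h0 : 0 < h by rewrite subr_gt0 ltr_pdivlMr ?mul1r.
pose m := (Num.truncn (c^-1 / h)).+1.
have h1 : c^-1 < m%:R * h by rewrite -ltr_pdivrMr//; exact: truncnS_gt.
have h2 := bernoulli_ineq m (ltW h0).
have h3 := hm m.
have h4 : c * (1 + h) ^+ m <= 1.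
  rewrite /h addrC subrK expr_div_n mulrA ler_pdivrMr ?exprn_gt0// mul1r.
  exact: h3.
have h5 : c * (m%:R * h) <= 1 by apply: le_trans h4; rewrite ler_wpM2l ?ltW//; lra.
have h6 : c * c^-1 < c * (m%:R * h) by rewrite ltr_pM2l.
by move: h6; rewrite mulfV ?gt_eqF//; lra.
Qed.

(* b k plays the role of the squared norm of the (k+1)-st power of an operator. *)
Lemma growth_rate (b : nat -> R) :
  (forall k, 0 < b k) -> (forall k, b k.+1 ^+ 2 <= b k * b k.+2) ->
  (forall k l, b (k + l).+1 <= b k * b l) ->
  exists rho, [/\ 0 < rho, forall k, b k.+1 <= rho * b k & forall k, rho ^+ k.+1 <= b k].
Proof.
move=> b0 blc bsm; pose r k := b k.+1 / b k.
have r0 k : 0 < r k by rewrite divr_gt0.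
have rS k : r k <= r k.+1.
  rewrite /r ler_pdivrMr// mulrAC ler_pdivlMr//.
  by have := blc k; rewrite expr2 [X in _ <= X]mulrC.
have rmono k l : (k <= l)%N -> r k <= r l.
  move=> /subnK <-; elim: (l - k)%N => // j ih; exact: le_trans (rS _).
have rb k : r k <= b 0%N by rewrite /r ler_pdivrMr// mulrC; have := bsm k 0%N; rewrite addn0.
have hs : has_sup (range r) by split; [exists (r 0%N), 0%N|exists (b 0%N) => _ [k _ <-]].
(* Log-convexity makes the ratios increase, and submultiplicativity bounds them by [b 0]. *)
pose rho := sup (range r).
have rrho k : r k <= rho by apply: ub_le_sup; [case: hs|exists k].
have rho0 : 0 < rho by exact: lt_le_trans (r0 0%N) (rrho 0%N).
exists rho; split=> // k; first by rewrite -ler_pdivrMr; [exact: rrho|exact: b0].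
have low j l : b j * r j ^+ l <= b (j + l)%N.
  elim: l => [|l ih]; first by rewrite expr0 mulr1 addn0.
  rewrite exprSr mulrA addnS.
  have -> : b (j + l).+1 = b (j + l)%N * r (j + l)%N by rewrite /r mulrC divfK ?gt_eqF.
  by apply: ler_pM => //; [rewrite mulr_ge0 ?exprn_ge0// ltW|exact: ltW|exact: rmono (leq_addr _ _)].
have upp m : b (k.+1 * m + k)%N <= b k ^+ m.+1.
  elim: m => [|m ih]; first by rewrite muln0 expr1.
  have -> : (k.+1 * m.+1 + k = (k + (k.+1 * m + k)).+1)%N by rewrite mulnS; lia.
  by apply: le_trans (bsm _ _) _; rewrite exprS ler_pM2l.
(* Along the indices congruent to [k] modulo [k + 1] the sequence grows at least like powers of
   [r j] and at most like powers of [b k]; letting the exponent grow removes the constants. *)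
have key j : r j ^+ k.+1 <= b k.
  have bk := exprn_gt0 j.+1 (b0 k).
  apply: (@le_of_pow_le _ _ (b j * r j ^+ (k * j + k) / b k ^+ j.+1)) => //.
  - exact: exprn_gt0.
  - by rewrite divr_gt0// mulr_gt0// exprn_gt0.
  move=> m; rewrite mulrAC ler_pdivrMr// -exprM -exprD -mulrA -exprD.
  have := le_trans (low j (k * j + k + k.+1 * m)%N) _; apply.
  have -> : (j + (k * j + k + k.+1 * m) = k.+1 * (m + j) + k)%N by rewrite mulSn; lia.
  by apply: le_trans (upp _) _; rewrite addnS.
(* Roots are taken because the bound has to pass to the supremum [rho] of the ratios [r j]. *)
have rootE : (b k `^ (k.+1%:R^-1)) ^+ k.+1 = b k.
  by rewrite -powR_mulrn ?powR_ge0// -powRrM mulVf// powRr1// ltW.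
have rho_le : rho <= b k `^ (k.+1%:R^-1).
  apply: ge_sup; first by case: hs.
  by move=> _ [j _ <-]; rewrite -(@ler_pXn2r _ k.+1) ?rootE// ?nnegrE ?powR_ge0 ?ltW.
by rewrite -[leRHS]rootE ler_pXn2r// nnegrE ?powR_ge0 ?ltW.
Qed.
End growth_rate.

Section convolution.
Context {R : realType} {n : nat} {G : lieGroupType R n}.
Hypothesis Gc : compact [set: G].
Implicit Types f g k : G -> R[i].
Let SD := mdot_semidot Gc.
Local Notation hn := (hnorm (@mdot R n G)).

Definition conv f g (x : G) : R[i] := mean (fun h => f (x * h^-1)%g * g h).

Lemma div_cts : continuous (fun p : G * G => (p.1 * p.2^-1)%g).
Proof.
move=> p; apply: (@continuous_comp _ _ _ (fun p : G * G => (p.1, p.2^-1)%g)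
  (fun p : G * G => (p.1 * p.2)%g)); last exact: mulg_cts.
apply: cvg_pair; first exact: cvg_fst.
exact: (continuous_comp (@cvg_snd _ _ _ _ _) (@invg_cts _ _ _ _)).
Qed.

Lemma ccont_fst (T U : topologicalType) (F : T -> R[i]) : ccont F -> ccont (fun p : T * U => F p.1).
Proof. by apply: ccont_comp => p; exact: cvg_fst. Qed.

Lemma ccont_snd (T U : topologicalType) (F : U -> R[i]) : ccont F -> ccont (fun p : T * U => F p.2).
Proof. by apply: ccont_comp => p; exact: cvg_snd. Qed.

Lemma conv_joint f g : ccont f -> ccont g ->
  ccont (fun p : G * G => f (p.1 * p.2^-1)%g * g p.2).
Proof.
move=> cf cg; apply: ccontM; last exact: ccont_snd.
exact: (ccont_comp div_cts cf).
Qed.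

Lemma ccont_conv f g : ccont f -> ccont g -> ccont (conv f g).
Proof.
move=> cf cg; apply: (ccont_mean Gc (F := fun x h => f (x * h^-1)%g * g h)).
exact: conv_joint.
Qed.

Lemma conv_integrand f g x : ccont f -> ccont g -> ccont (fun h => f (x * h^-1)%g * g h).
Proof.
move=> cf cg; exact: (ccont_slice (F := fun x h => f (x * h^-1)%g * g h) x (conv_joint cf cg)).
Qed.

Lemma convA f g k : ccont f -> ccont g -> ccont k -> conv (conv f g) k = conv f (conv g k).
Proof.
move=> cf cg ck; apply/funext => x; rewrite /conv.
have cF : ccont (fun p : G * G => f (x * p.2^-1)%g * (g (p.2 * p.1^-1)%g * k p.1)).
  apply: ccontM; last by apply: (ccont_swap (F := fun a h => g (a * h^-1)%g * k h)); exact: conv_joint.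
  apply: (@ccont_comp _ _ _ (fun h => f (x * h^-1)%g) (fun p : G * G => p.2)).
    by move=> p; exact: cvg_snd.
  by apply: (ccont_inv (f := fun h => f (x * h)%g)); exact: ccont_mulgl.
transitivity (mean (fun h => mean (fun a => f (x * a^-1)%g * (g (a * h^-1)%g * k h)))).
  congr mean; apply/funext => h; rewrite -(meanZr Gc); last exact: conv_integrand.
  have cs : ccont (fun a => f (x * a^-1)%g * (g (a * h^-1)%g * k h)).
    exact: (ccont_slice (F := fun h a => f (x * a^-1)%g * (g (a * h^-1)%g * k h)) h cF).
  rewrite -[RHS](mean_mulgr Gc h)//; congr mean; apply/funext => a.
  by rewrite mulgK invgM !mulgA mulrA.
rewrite (mean_fubini Gc (F := fun h a => f (x * a^-1)%g * (g (a * h^-1)%g * k h)))//.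
congr mean; apply/funext => a; rewrite (meanZ Gc)//; exact: conv_integrand.
Qed.

Lemma conv_mulgr f g a : ccont f -> ccont g ->
  conv f (fun x => g (x * a)%g) = fun x => conv f g (x * a)%g.
Proof.
move=> cf cg; apply/funext => x; rewrite /conv -[RHS](mean_mulgr Gc a); last exact: conv_integrand.
by congr mean; apply/funext => h; rewrite invgM mulgA mulgK.
Qed.

Lemma conv_linear f (c : R[i]) g k : ccont f -> ccont g -> ccont k ->
  conv f (c *: g + k) = c *: conv f g + conv f k.
Proof.
move=> cf cg ck; apply/funext => x.
have -> : (c *: conv f g + conv f k) x = c * conv f g x + conv f k x by [].
rewrite /conv -(mean_linear Gc); [|exact: conv_integrand|exact: conv_integrand].
congr mean; apply/funext => h.
have -> : (c *: g + k) h = c * g h + k h by [].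
by ring.
Qed.

Lemma conv_dot f g x : conv f g x = mdot g (fun h => conjc (f (x * h^-1)%g)).
Proof. by congr mean; apply/funext => h; rewrite conjcK mulrC. Qed.

Lemma sqn_translate f x : ccont f -> sqn mdot (fun h => conjc (f (x * h^-1)%g)) = sqn mdot f.
Proof.
move=> cf; rewrite /sqn /mdot; congr complex.Re.
rewrite -[RHS](mean_mulgl Gc x); last exact: ccont_dot.
rewrite -[RHS](mean_inv Gc); last by apply: (ccont_dot (f := fun h => f (x * h)%g) (g := fun h => f (x * h)%g)); exact: ccont_mulgl.
by congr mean; apply/funext => h; rewrite conjcK mulrC.
Qed.

Lemma ccont_translate f x : ccont f -> ccont (fun h => conjc (f (x * h^-1)%g)).
Proof. by move=> cf; apply: ccontJ; apply: (ccont_inv (f := fun h => f (x * h)%g)); exact: ccont_mulgl. Qed.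

Lemma normc_conv_le f g x : ccont f -> ccont g ->
  Normc.normc (conv f g x) <= hn f * hn g.
Proof.
move=> cf cg; rewrite conv_dot; apply: le_trans (cauchy_schwarz SD _ _) _ => //.
  exact: ccont_translate.
by rewrite mulrC [X in X * _]/hnorm sqn_translate.
Qed.

Lemma hnorm_sup f (c : R) : ccont f -> 0 <= c -> (forall x, Normc.normc (f x) <= c) ->
  hn f <= c.
Proof.
move=> cf c0 hc; rewrite hnorm_le//; apply: le_trans (ler_norm _) _.
apply: le_trans (normc_ge_Re _) _; apply: (normc_mean_le Gc); first exact: ccont_dot.
by move=> x; rewrite Normc.normcM normcJ -expr2 ler_sqr ?nnegrE ?normc_ge0.
Qed.

Lemma hnorm_conv_le f g : ccont f -> ccont g -> hn (conv f g) <= hn f * hn g.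
Proof.
move=> cf cg; apply: hnorm_sup; first exact: ccont_conv.
  by rewrite mulr_ge0 ?hnorm_ge0.
by move=> x; exact: normc_conv_le.
Qed.

Lemma conv_selfadjoint f g k : ccont f -> ccont g -> ccont k ->
  (forall x, f x^-1%g = conjc (f x)) -> mdot (conv f g) k = mdot g (conv f k).
Proof.
move=> cf cg ck fJ; rewrite /mdot /conv.
have cF : ccont (fun p : G * G => f (p.1 * p.2^-1)%g * g p.2 * conjc (k p.1)).
  by apply: ccontM; [exact: conv_joint|apply: (ccont_fst _ (F := fun x => conjc (k x))); exact: ccontJ].
transitivity (mean (fun x => mean (fun h => f (x * h^-1)%g * g h * conjc (k x)))).
  by congr mean; apply/funext => x; rewrite (meanZr Gc)//; exact: conv_integrand.
rewrite (mean_fubini Gc cF); congr mean; apply/funext => h.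
rewrite -(mean_conj Gc); last exact: conv_integrand.
rewrite -(meanZ Gc); last by apply: ccontJ; exact: conv_integrand.
congr mean; apply/funext => x; rewrite conjcM -fJ invgM invgK.
by ring.
Qed.

(* Writing the elements of the eigenspace as inner products against translates of f,
   Bessel's inequality bounds the sum of their squares by a constant, pointwise. *)
Lemma eigenspace_bounded f (rho : R) : ccont f -> 0 < rho ->
  exists N, forall m (e : 'I_m -> G -> R[i]),
    (forall i, ccont (e i) /\ conv f (e i) = rho%:C *: e i) -> orthonormal mdot e -> (m <= N)%N.
Proof.
move=> cf r0; pose B := sqn mdot f / rho ^+ 2.
exists (Num.truncn B) => m e he oe.
have ce i : ccont (e i) by case: (he i).
have pw x : \sum_i Normc.normc (e i x) ^+ 2 <= B.
  rewrite /B ler_pdivlMr ?exprn_gt0// -(sqn_translate x cf) mulr_suml.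
  apply: le_trans (bessel SD (e := e) ce oe (ccont_translate x cf)).
  apply: ler_sum => i _; rewrite (sd_conj SD (ce i) (ccont_translate x cf)) normcJ.
  have [_ /(congr1 (fun F => F x))] := he i; rewrite conv_dot => ->.
  have -> : (rho%:C *: e i) x = rho%:C * e i x by [].
  by rewrite Normc.normcM exprMn normc_real real_normK ?num_real// mulrC.
(* Each function has norm 1, so the mean of the pointwise bound counts the family. *)
have ms : mean (fun x => \sum_i e i x * conjc (e i x)) = m%:R.
  rewrite (mean_sum Gc _ (F := fun i x => e i x * conjc (e i x))); last by move=> j; exact: ccont_dot.
  rewrite (eq_bigr (fun=> 1)) ?sumr_const ?card_ord// => j _.
  by rewrite -[mean _]/(mdot (e j) (e j)) oe eqxx.
have B0 : 0 <= B by apply: le_trans (pw 1%g); apply: sumr_ge0 => i _; exact: sqr_ge0.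
have h : Normc.normc (m%:R : R[i]) <= B.
  rewrite -ms; apply: (normc_mean_le Gc).
    by apply: ccont_sum => i; exact: ccont_dot.
  move=> x; apply: le_trans (ler_normc_sum _ _) _; apply: le_trans (pw x).
  by apply: ler_sum => i _; rewrite Normc.normcM normcJ expr2.
rewrite -(rmorph_nat (real_complex R)) normc_real ger0_norm// in h.
by rewrite truncn_ge_nat.
Qed.

End convolution.

(** * An eigenfunction of the square of a symmetric convolution operator *)

Section eigenfunction.
Context {R : realType} {n : nat} {G : lieGroupType R n}.
Hypothesis Gc : compact [set: G].
Let SD := mdot_semidot Gc.
Local Notation hn := (hnorm (@mdot R n G)).
Variable kappa : G -> R[i].
Hypothesis ck : ccont kappa.
Hypothesis kappaJ : forall x, kappa x^-1%g = conjc (kappa x).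
Hypothesis kappa_neq0 : kappa <> 0.

(** [K k] is the convolution power with exponent [k + 1]; this shift explains the index [(k + l).+1]
    of a product. *)
Let K k := iter k (conv kappa) kappa.

Let cK k : ccont (K k).
Proof. by elim: k => //= k ih; exact: ccont_conv. Qed.

Let convK k l : conv (K k) (K l) = K (k + l).+1.
Proof.
elim: k => [|k ih]; first exact: erefl.
by rewrite addSn [K k.+1]iterS (convA Gc ck (cK k) (cK l)) ih [RHS]iterS.
Qed.

(** Self-adjointness moves factors from one side to the other, so inner products of powers depend
    only on the sum of the indices. When the sum is even they are squared norms, which turns
    Cauchy-Schwarz into log-convexity of [b]. *)
Let dotK k l : mdot (K k) (K l) = mdot (K (k + l)) kappa.
Proof.
elim: l k => [|l ih] k; first by rewrite addn0.
rewrite -addSnnS -ih [K k.+1]iterS [K l.+1]iterS.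
exact/esym/(conv_selfadjoint Gc ck (cK k) (cK l)).
Qed.

Let b k := sqn mdot (K k).

Let dot_half k l m : (k + l)%N = m.*2 -> mdot (K k) (K l) = (b m)%:C.
Proof. by move=> kl; rewrite dotK kl -addnn -dotK (dot_sqn SD)//; exact: cK. Qed.

Let b_log_convex k : b k.+1 ^+ 2 <= b k * b k.+2.
Proof.
have := cauchy_schwarz_sq SD (cK k) (cK k.+2).
rewrite (@dot_half _ _ k.+1); last by rewrite -addnn; lia.
by rewrite normc_real ger0_norm// /b (sqn_ge0 SD)//; exact: cK.
Qed.

(** Log-convexity propagates positivity from two consecutive indices. The convolution square of
    [kappa] is nonzero because its value at 1 is the squared norm of [kappa]. *)
Let b_gt0 k : 0 < b k.
Proof.
have pos (f : G -> R[i]) : ccont f -> f <> 0 -> 0 < sqn mdot f.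
  move=> cf f0; rewrite lt_def (sqn_ge0 SD cf) andbT.
  by apply/eqP => /(mdot_eq0 Gc cf).
suff : 0 < b k /\ 0 < b k.+1 by case.
elim: k => [|k [bk bk1]]; last first.
  split; first exact: bk1.
  have := b_log_convex k; rewrite -(pmulr_rgt0 _ bk); apply: lt_le_trans.
  exact: exprn_gt0.
have b0 : 0 < b 0 by exact: pos.
split=> //; apply: pos; first exact: cK.
move=> /(congr1 (fun f => f 1%g)) /=; rewrite /conv.
have -> : mean (fun h => kappa (1 * h^-1)%g * kappa h) = (b 0)%:C.
  rewrite -(@dot_half 0 0 0)//; congr mean; apply/funext => h.
  by rewrite mul1g kappaJ mulrC.
by move=> [] /eqP; rewrite gt_eqF.
Qed.

Let b_submult k l : b (k + l).+1 <= b k * b l.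
Proof.
rewrite /b -convK -!(sqr_hnorm SD); [|exact: cK|exact: cK|exact: ccont_conv].
rewrite -exprMn ler_sqr ?nnegrE ?mulr_ge0 ?hnorm_ge0//.
exact: hnorm_conv_le.
Qed.

(** Power iteration. With [rho] the growth rate of the squared norms [b], the normalised powers of
    [conv kappa kappa] converge to an eigenfunction. The square is used because the spectrum of
    [kappa] may contain two opposite values of largest modulus, between which the powers of [kappa]
    itself would oscillate. *)
Lemma eigenfunction_exists : exists (rho : R) (p : G -> R[i]),
  [/\ 0 < rho, ccont p, p <> 0 & conv (conv kappa kappa) p = rho%:C *: p].
Proof.
have [rho [rho0 brho rhob]] := growth_rate b_gt0 b_log_convex b_submult.
have rho_ge0 := ltW rho0.
(* The two bounds from [growth_rate] say that [c] decreases and stays above 1. *)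
pose c j := b j / rho ^+ j.+1.
have cS j : c j.+1 <= c j.
  by rewrite /c exprS invfM mulrA ler_pM2r ?invr_gt0 ?exprn_gt0// ler_pdivrMr// mulrC.
have cmono i j : (i <= j)%N -> c j <= c i.
  by move=> /subnK <-; elim: (j - i)%N => // k ih; exact: le_trans (cS _) ih.
have c1 j : 1 <= c j by rewrite ler_pdivlMr ?exprn_gt0// mul1r.
(* [P k] is the power of [conv kappa kappa] with exponent [k + 1], divided by the same power of
   [rho]. *)
pose P k : G -> R[i] := (rho ^+ k.+1)^-1%:C *: K k.*2.+1.
have cP k : ccont (P k) by apply: ccontZ; exact: cK.
have dotP k l : mdot (P k) (P l) = (c (k + l).+1)%:C.
  rewrite /P (dotZl SD); [|exact: cK|exact: cP].
  rewrite (dotZr SD); [|exact: cK|exact: cK].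
  rewrite (@dot_half _ _ (k + l).+1); last by rewrite doubleS doubleD; lia.
  rewrite conjc_real -!rmorphM /= /c; congr (_%:C).
  have -> : (k + l).+2 = (k.+1 + l.+1)%N by lia.
  by rewrite exprD invfM [RHS]mulrC -mulrA.
pose inf_c := inf (range c).
have hi : has_inf (range c) by split; [exists (c 0%N), 0%N|exists 1 => _ [k _ <-]].
have infc j : inf_c <= c j by apply: ge_inf; [case: hi|exists j].
(* The squared distance is [c (2l+1) - 2 c (l+m+1) + c (2m+1)], and all three values are close to
   the infimum of [c]. *)
have P_cauchy (e : R) : 0 < e -> exists k, forall l m, (k <= l)%N -> (k <= m)%N ->
    hn (P l - P m) <= e.
  move=> e0; have e20 : 0 < e ^+ 2 / 2 by rewrite divr_gt0// exprn_gt0.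
  have [_ [k _ <-] hk] := inf_adherent e20 hi.
  exists k => l m kl km; rewrite (hnorm_le _ _ (ltW e0)) (sqnB SD); [|exact: cP|exact: cP].
  rewrite /sqn !dotP [complex.Re _]/= [complex.Re (_%:C)]/= [complex.Re (c _)%:C]/=.
  have h1 := cmono k (l + l).+1; have h2 := cmono k (m + m).+1.
  have := infc (l + m).+1; rewrite -/inf_c in hk.
  by have := h1 ltac:(lia); have := h2 ltac:(lia); lra.
have convP k : conv (K 1) (P k) = rho%:C *: P k.+1.
  have -> : conv (K 1) (P k) = (rho ^+ k.+1)^-1%:C *: conv (K 1) (K k.*2.+1).
    have := conv_linear Gc (rho ^+ k.+1)^-1%:C (cK 1) (cK k.*2.+1) (ccont_cst 0).
    have -> : conv (K 1) (fun=> 0) = 0.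
      apply/funext => x; rewrite /conv -[RHS](mean_cst Gc 0); congr mean.
      by apply/funext => h; rewrite mulr0.
    by rewrite !addr0.
  have rE : rho * (rho ^+ k.+2)^-1 = (rho ^+ k.+1)^-1.
    by rewrite [rho ^+ k.+2]exprS invfM mulrA mulfV ?gt_eqF// mul1r.
  by rewrite convK /P scalerA -rmorphM rE add1n doubleS.
have K1 : K 1 = conv kappa kappa by [].
(* Convolution is bounded from the norm of the mean to the supremum norm, so one more factor turns a
   Cauchy sequence in norm into a uniform one. *)
have sup_bound k l x : Normc.normc (P k.+1 x - P l.+1 x) <= rho^-1 * (hn (K 1) * hn (P k - P l)).
  have -> : P k.+1 x - P l.+1 x = rho^-1%:C * conv (K 1) (P k - P l) x.
    have -> : conv (K 1) (P k - P l) x = rho%:C * (P k.+1 x - P l.+1 x).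
      rewrite -[P k - P l]addrC -scaleN1r (conv_linear Gc)// !convP scaleN1r addrC.
      by rewrite -scalerBr.
    by rewrite mulrA -rmorphM mulVf ?gt_eqF// mul1r.
  rewrite Normc.normcM normc_real ger0_norm ?invr_ge0//.
  rewrite ler_wpM2l ?invr_ge0//; apply: (normc_conv_le Gc) => //.
  by apply: ccontB.
have [|p hp] := @uniform_cauchy_limit R G (fun k => P k.+1).
  move=> e e0; pose M := rho^-1 * hn (K 1).
  have M0 : 0 <= M by rewrite mulr_ge0 ?invr_ge0 ?hnorm_ge0.
  have [|k hk] := P_cauchy (e / (M + 1)); first by rewrite divr_gt0// ltr_wpDl.
  exists k => l m kl km x; apply: le_trans (sup_bound _ _ _) _; rewrite mulrA -/M.
  apply: le_trans (ler_wpM2l M0 (hk _ _ kl km)) _.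
  by rewrite mulrCA ler_piMr ?(ltW e0)// ler_pdivrMr ?mul1r ?lerDl// ltr_wpDl.
have cp : ccont p.
  apply: (ccont_uniform (F := fun k => P k.+1)) => // e e0.
  by have [k hk] := hp e e0; exists k => x; exact: hk.
exists rho, p; split=> //.
  (* The limit is nonzero because [c >= 1] keeps the norms of the [P k] above 1. *)
  move=> p0; have [|k hk] := hp (1 / 2); first by rewrite divr_gt0.
  have h : hn (P k.+1) <= 1 / 2.
    apply: (hnorm_sup Gc) => // x; have := hk k (leqnn _) x.
    by rewrite p0 -[(0 : G -> R[i]) x]/0 subr0.
  move: h; rewrite hnorm_le// /sqn dotP /= => h.
  by have := c1 (k.+1 + k.+1).+1; move: h; rewrite expr2; lra.
rewrite -K1; apply/funext => x; apply/eqP; rewrite -subr_eq0; apply/eqP/normc_small => e e0.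
have B0 := hnorm_ge0 mdot (K 1).
pose M := hn (K 1) + rho; have M0 : 0 < M by rewrite /M; lra.
have [|k hk] := hp (e / M); first by rewrite divr_gt0.
have -> : conv (K 1) p x - (rho%:C *: p) x =
   conv (K 1) (p - P k.+1) x + rho%:C * (P k.+2 x - p x).
  have -> : conv (K 1) (p - P k.+1) x = conv (K 1) p x - rho%:C * P k.+2 x.
    rewrite -[p - _]addrC -scaleN1r (conv_linear Gc)// convP scaleN1r.
    by rewrite addrC.
  by rewrite -[(_ *: p) x]/(rho%:C * p x); ring.
apply: le_trans (ler_normcD _ _) _; rewrite Normc.normcM normc_real ger0_norm//.
have h1 : Normc.normc (conv (K 1) (p - P k.+1) x) <= hn (K 1) * (e / M).
  apply: le_trans (normc_conv_le Gc _ _ _) _ => //; first exact: ccontB.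
  rewrite ler_wpM2l//; apply: (hnorm_sup Gc); first exact: ccontB.
    by rewrite divr_ge0// ltW.
  by move=> y; have := hk k (leqnn _) y; rewrite normcBC.
have h2 : rho * Normc.normc (P k.+2 x - p x) <= rho * (e / M).
  by rewrite ler_wpM2l//; apply: hk.
have -> : e = hn (K 1) * (e / M) + rho * (e / M).
  by rewrite -mulrDl -/M mulrC divfK// gt_eqF.
exact: lerD.
Qed.

End eigenfunction.

Section finite_dimensional_hilbert_spaces.
Context {R : realType}.

Lemma fd_semidot (H : fdHilbert R) : semidot setT (@hdot R H).
Proof.
split=> //.
- by move=> a x y z _ _ _; exact: hdot_linear.
- by move=> x y _ _; exact: hdot_conj.
- by move=> x _; rewrite hdot_norm exprn_ge0.
Qed.

Lemma norm_hnorm (H : fdHilbert R) (x : H) : `|x| = (hnorm (@hdot R H) x)%:C.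
Proof.
apply/eqP; rewrite -(@eqrXn2 _ 2)//; last by rewrite ler0c hnorm_ge0.
by rewrite -hdot_norm (dot_sqn (fd_semidot H))// -rmorphXn /= (sqr_hnorm (fd_semidot H)).
Qed.

Lemma hdot_eq0 (H : fdHilbert R) (x : H) : sqn (@hdot R H) x = 0 -> x = 0.
Proof. by move=> h; apply/eqP; rewrite -normr_eq0 norm_hnorm /hnorm h sqrtr0. Qed.

Lemma hcont_continuous (H : fdHilbert R) (T : topologicalType) (f : T -> H) :
  hcont (@hdot R H) f <-> continuous f.
Proof.
split=> cf t.
  apply/cvgrPdist_lt => e e0.
  have eE := ge0_complex (ltW e0).
  have e'0 : 0 < complex.Re e by rewrite -ltcR -eE.
  have := cf t _ e'0; apply: filterS => u; rewrite eE norm_hnorm ltcR.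
  by rewrite (hnormBC (fd_semidot H)).
move=> e e0; have /cvgrPdist_lt/(_ e%:C) := cf t.
rewrite ltcR => /(_ e0); apply: filterS => u; rewrite norm_hnorm ltcR.
by rewrite (hnormBC (fd_semidot H)).
Qed.

(** A separate name for row vectors keeps the Hermitian norm apart from the norm that matrices
    already carry. *)
Definition hvec (k : nat) := 'rV[R[i]]_k.

HB.instance Definition _ k := GRing.Lmodule.copy (hvec k) 'rV[R[i]]_k.

Definition vdot k (x y : hvec k) : R[i] := \sum_i x 0 i * conjc (y 0 i).

Lemma vdot_semidot k : semidot setT (@vdot k).
Proof.
split=> //.
- move=> a x y z _ _ _; rewrite /vdot mulr_sumr -big_split; apply: eq_bigr => i _ /=.
  by rewrite !mxE mulrDl mulrA.
- move=> x y _ _; rewrite /vdot conjc_sum; apply: eq_bigr => i _.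
  by rewrite conjcM conjcK mulrC.
- by move=> x _; rewrite sumr_ge0// => i _; rewrite mulcJ ler0c sqr_ge0.
Qed.

Lemma sqn_vdot k (x : hvec k) : sqn (@vdot k) x = \sum_i Normc.normc (x 0 i) ^+ 2.
Proof. by rewrite /sqn /vdot Re_sum; apply: eq_bigr => i _; rewrite mulcJ. Qed.

Lemma vdot_eq0 k (x : hvec k) : hnorm (@vdot k) x = 0 -> x = 0.
Proof.
move=> /eqP; rewrite sqrtr_eq0 sqn_vdot => le0; apply/rowP => i; rewrite mxE.
apply: Normc.eq0_normc; apply/eqP; rewrite -sqrf_eq0; apply/eqP/le_anti.
rewrite sqr_ge0 andbT; apply: le_trans le0; rewrite (bigD1 i)//= lerDl sumr_ge0//.
by move=> j _; exact: sqr_ge0.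
Qed.

End finite_dimensional_hilbert_spaces.

Section hermitian_space.
Context {R : realType} (k : nat).
Implicit Types x y : hvec (R := R) k.

Definition hvec_norm x : R[i] := (hnorm (@vdot R k) x)%:C.

Lemma hvec_normD x y : hvec_norm (x + y) <= hvec_norm x + hvec_norm y.
Proof. by rewrite -rmorphD lecR (ler_hnormD (vdot_semidot k)). Qed.

Lemma hvec_normZ (a : R[i]) x : hvec_norm (a *: x) = `|a| * hvec_norm x.
Proof. by rewrite /hvec_norm (hnormZ (vdot_semidot k))// rmorphM normc_norm. Qed.

Lemma hvec_norm0 x : hvec_norm x = 0 -> x = 0.
Proof. by move=> [] /vdot_eq0. Qed.

HB.instance Definition _ := @Lmodule_isNormed.Build R[i] (hvec (R := R) k) hvec_norm
  hvec_normD hvec_normZ hvec_norm0.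

Lemma hvec_normE x : `|x| = (hnorm (@vdot R k) x)%:C.
Proof. by []. Qed.

Definition vbasis (i : 'I_k) : hvec (R := R) k := delta_mx 0 i.

Lemma vdot_vbasis x i : vdot x (vbasis i) = x 0 i.
Proof.
rewrite /vdot (bigD1 i)//= /vbasis mxE !eqxx conjc_nat mulr1 big1 ?addr0// => j ji.
by rewrite mxE (negbTE ji) andbF conjc0 mulr0.
Qed.

Lemma vbasis_onb : onb (@vdot R k) vbasis.
Proof.
split=> [i j|x]; first by rewrite vdot_vbasis mxE eqxx eq_sym.
by rewrite [LHS]row_sum_delta; apply: eq_bigr => i _; rewrite vdot_vbasis.
Qed.

Definition hvec_fdHilbert : fdHilbert R.
Proof.
refine (@FdHilbert R (hvec (R := R) k) (@vdot R k) _ _ _ _).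
- by move=> a x y z; exact: (sd_linear (vdot_semidot k)).
- by move=> x y; exact: (sd_conj (vdot_semidot k)).
- move=> x; rewrite hvec_normE -rmorphXn /= (sqr_hnorm (vdot_semidot k))//.
  by rewrite (dot_sqn (vdot_semidot k)).
- by exists k, vbasis; exact: vbasis_onb.
Defined.

Lemma hcont_vdot (T : topologicalType) (f : T -> hvec (R := R) k) :
  (forall i, ccont (fun t => f t 0 i)) -> hcont (@vdot R k) f.
Proof.
move=> cf.
have -> : f = fun t => \sum_i f t 0 i *: vbasis i.
  by apply/funext => t; rewrite [LHS]row_sum_delta.
apply: (hcont_sum (vdot_semidot k)) => // i; apply: (hcontZ (vdot_semidot k)) => //.
exact: (hcont_cst (vdot_semidot k)).
Qed.

End hermitian_space.

(** * Representations on finite-dimensional spaces of functions by right translation *)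

Section right_regular_representation.
Context {R : realType} {n : nat} {G : lieGroupType R n}.
Hypothesis Gc : compact [set: G].
Let SD := mdot_semidot Gc.

Definition rtrans (a : G) (f : G -> R[i]) : G -> R[i] := fun x => f (x * a)%g.

Lemma rtrans_sum a (I : Type) (r : seq I) (F : I -> G -> R[i]) :
  rtrans a (\sum_(i <- r) F i) = \sum_(i <- r) rtrans a (F i).
Proof. by elim: r => [|i r ih]; rewrite ?big_nil// !big_cons -ih. Qed.

Lemma mdot_rtrans a (f g : G -> R[i]) : ccont f -> ccont g ->
  mdot (rtrans a f) (rtrans a g) = mdot f g.
Proof. by move=> cf cg; rewrite /mdot -[RHS](mean_mulgr Gc a)//; exact: ccont_dot. Qed.

Variables (k : nat) (e : 'I_k -> G -> R[i]).
Hypothesis ce : forall i, ccont (e i).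
Hypothesis oe : orthonormal mdot e.
Hypothesis einv : forall a i, rtrans a (e i) = \sum_j mdot (rtrans a (e i)) (e j) *: e j.

Definition comb (v : hvec (R := R) k) : G -> R[i] := \sum_i v 0 i *: e i.
Definition rmat (a : G) : 'M[R[i]]_k := \matrix_(i, j) mdot (rtrans a (e i)) (e j).
Definition rrep (a : G) (v : hvec (R := R) k) : hvec (R := R) k := v *m rmat a.

Lemma ccont_comb v : ccont (comb v).
Proof. by apply: (sd_sum SD) => i; apply: (sdZ SD); exact: ce. Qed.

Lemma comb_linear c v w : comb (c *: v + w) = c *: comb v + comb w.
Proof.
rewrite /comb scaler_sumr -big_split; apply: eq_bigr => i _ /=.
by rewrite !mxE scalerDl scalerA.
Qed.

Lemma mdot_comb v w : mdot (comb v) (comb w) = vdot v w.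
Proof.
have Sv (c : R[i]) i : [set f : G -> R[i] | ccont f] (c *: e i) by apply: (sdZ SD); exact: ce.
rewrite {1}/comb (dot_suml SD)//; last exact: ccont_comb.
apply: eq_bigr => i _; rewrite (dotZl SD); [|exact: ce|exact: ccont_comb].
rewrite (dot_sumr SD)//; last exact: ce.
rewrite (bigD1 i)//= (dotZr SD); [|exact: ce|exact: ce].
rewrite oe eqxx mulr1 big1 ?addr0// => j ji.
by rewrite (dotZr SD); [|exact: ce|exact: ce]; rewrite oe eq_sym (negbTE ji) mulr0.
Qed.

Lemma comb_inj v w : comb v = comb w -> v = w.
Proof.
move=> vw; apply/eqP; rewrite -subr_eq0; apply/eqP/vdot_eq0.
have -> : v - w = -1 *: w + v by rewrite scaleN1r addrC.
rewrite /hnorm /sqn -mdot_comb comb_linear vw scaleN1r addNr.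
by rewrite (dot0l SD) ?sqrtr0//; exact: (sd0 SD).
Qed.

Lemma comb_rrep a v : comb (rrep a v) = rtrans a (comb v).
Proof.
rewrite /comb rtrans_sum.
have -> : \sum_i rtrans a (v 0 i *: e i) = \sum_i \sum_j (v 0 i * rmat a i j) *: e j.
  apply: eq_bigr => i _; rewrite -[rtrans a _]/(v 0 i *: rtrans a (e i)) {1}einv scaler_sumr.
  by apply: eq_bigr => j _; rewrite scalerA mxE.
rewrite exchange_big; apply: eq_bigr => j _ /=.
by rewrite mxE scaler_suml.
Qed.

Lemma rmat_ccont i j : ccont (fun a => rmat a i j).
Proof.
apply: (@ccont_eq _ _ (fun a => mean (fun x => e i (x * a)%g * conjc (e j x)))).
  by move=> a; rewrite mxE.
apply: (ccont_mean Gc (F := fun a x => e i (x * a)%g * conjc (e j x))).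
apply: ccontM; last by apply: (ccont_snd _ (F := fun x => conjc (e j x))); exact: ccontJ.
apply: (@ccont_comp _ _ _ (e i) (fun p : G * G => (p.2 * p.1)%g)) => // p.
apply: (@continuous_comp _ _ _ (fun p : G * G => (p.2, p.1)) (fun p : G * G => (p.1 * p.2)%g)).
  by apply: cvg_pair; [exact: cvg_snd|exact: cvg_fst].
exact: mulg_cts.
Qed.

(** [comb] is an injective isometry from coordinates to functions that turns [rrep] into right
    translation; the axioms are read off there, unitarity being the right invariance of the mean. *)
Definition rrep_urep : urep [set: G] (hvec_fdHilbert k).
Proof.
refine (@URep R n G [set: G] (hvec_fdHilbert k) rrep _ _ _ _ _).
- by move=> a c v w _; rewrite /rrep mulmxDl scalemxAl.
- by move=> v; apply: comb_inj; rewrite comb_rrep /rtrans; apply/funext => x; rewrite mulg1.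
- move=> a b v _ _; apply: comb_inj; rewrite !comb_rrep /rtrans; apply/funext => x.
  by rewrite mulgA.
- move=> a v w _; rewrite -[LHS]mdot_comb !comb_rrep mdot_rtrans ?mdot_comb//; exact: ccont_comb.
- move=> v; apply: continuous_subspaceT; apply/(hcont_continuous (H := hvec_fdHilbert k)).
  apply: hcont_vdot => j.
  apply: (@ccont_eq _ _ (fun a => \sum_i v 0 i * rmat a i j)) => [a|]; first by rewrite mxE.
  by apply: ccont_sum => i; apply: ccontZ; exact: rmat_ccont.
Defined.

(* Evaluation at 1 is represented by a vector, so the functions in the span are matrix
   coefficients. *)
Lemma comb_coefficient : exists b : hvec (R := R) k, forall v x, comb v x = vdot (rrep x v) b.
Proof.
exists (\row_i conjc (e i 1%g)) => v x.
have -> : comb v x = comb (rrep x v) 1%g by rewrite comb_rrep /rtrans mul1g.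
rewrite /comb /vdot.
have this (F : 'I_k -> G -> R[i]) : (\sum_i F i) 1%g = \sum_i F i 1%g by rewrite fct_sumE.
rewrite this; apply: eq_bigr => i _.
by rewrite -[LHS]/(rrep x v 0 i * e i 1%g); congr (_ * _); rewrite mxE conjcK.
Qed.

End right_regular_representation.

Section peter_weyl.
Context {R : realType} {n : nat} {G : lieGroupType R n}.
Hypothesis Gc : compact [set: G].
Let SD := mdot_semidot Gc.

(** Among the nonempty orthonormal families with a span stable under translation, one of minimal
    size is taken: an orthonormal basis of a proper nonzero invariant subspace would give a smaller
    one. *)
Lemma irreducible_rtrans_family (S : set (G -> R[i])) (N : nat) (p : G -> R[i]) :
  (forall f, S f -> ccont f) -> S 0 -> (forall a f g, S f -> S g -> S (a *: f + g)) ->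
  (forall a f, S f -> S (rtrans a f)) ->
  (forall m (e : 'I_m -> G -> R[i]), (forall i, S (e i)) -> orthonormal mdot e -> (m <= N)%N) ->
  S p -> p <> 0 ->
  exists k (e : 'I_k -> G -> R[i]) (ce : forall i, ccont (e i)) (oe : orthonormal mdot e)
    (einv : forall a i, rtrans a (e i) = \sum_j mdot (rtrans a (e i)) (e j) *: e j),
    (forall i, S (e i)) /\ irreducible [set: G] (rrep_urep Gc ce oe einv).
Proof.
move=> Sc S0 SP Srt bnd Sp p0.
have SS : semidot S mdot by exact: (semidot_sub SD Sc S0 SP).
have def f : S f -> sqn mdot f = 0 -> f = 0 by move=> Sf; apply: (mdot_eq0 Gc); exact: Sc.
(* The size is written [k.+1] to exclude the empty family. *)
pose Q k := `[< exists e : 'I_k.+1 -> G -> R[i], [/\ forall i, S (e i), orthonormal mdot e &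
  forall a i, rtrans a (e i) = \sum_j mdot (rtrans a (e i)) (e j) *: e j] >].
have exQ : exists k, Q k.
  have [[|k] [e [Se oe he]]] := orthonormal_basis_exists SS def bnd.
    by exfalso; apply: p0; rewrite (he p Sp) big_ord0.
  by exists k; apply/asboolP; exists e; split=> // a i; apply: he; exact: Srt.
case: (ex_minnP exQ) => k /asboolP[e [Se oe einv]] kmin.
have ce i : ccont (e i) by apply: Sc.
exists k.+1, e, ce, oe, einv; split=> //; split.
  exists (vbasis ord0); apply/negP => /eqP h.
  have := vdot_vbasis (vbasis (R := R) (@ord0 k)) ord0.
  by rewrite {1}h (dot0l (vdot_semidot _))// mxE !eqxx => /esym/eqP; rewrite oner_eq0.
move=> F [F0 FP] Finv.
have FS : semidot F (@vdot R k.+1) by exact: (semidot_sub (vdot_semidot _) (fun _ _ => I) F0 FP).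
have defF v : F v -> sqn (@vdot R k.+1) v = 0 -> v = 0.
  by move=> _ h; apply: vdot_eq0; rewrite /hnorm h sqrtr0.
have [vb1 vb2] := vbasis_onb (R := R) k.+1.
have bndF m (f : 'I_m -> hvec (R := R) k.+1) : orthonormal (@vdot R k.+1) f -> (m <= k.+1)%N.
  by move=> of_; apply: (orthonormal_size (vdot_semidot k.+1) (e := @vbasis R k.+1) (f := f)).
have [[|m] [f [Ff of_ hf]]] := orthonormal_basis_exists FS defF (fun m f _ => @bndF m f).
  left; apply/seteqP; split=> v /=; last by move=> ->.
  by move=> /hf ->; rewrite big_ord0.
right; apply/seteqP; split=> // v _.
(* The basis [f] of the invariant subspace, turned into functions by [comb], is again such a family,
   so minimality gives the subspace full dimension. *)
have km : (k <= m)%N.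
  apply: kmin; apply/asboolP; exists (fun i => comb e (f i)); split.
  - move=> i; rewrite /comb; elim/big_rec: _ => // j g _ Sg; exact: SP.
  - by move=> i j; rewrite (mdot_comb Gc).
  move=> a i; rewrite -(comb_rrep einv) {1}(hf (rrep e a (f i)) (Finv _ _ Logic.I (Ff i))).
  have csum (I : Type) (r : seq I) (c : I -> R[i]) (w : I -> hvec (R := R) k.+1) :
      comb e (\sum_(i <- r) c i *: w i) = \sum_(i <- r) c i *: comb e (w i).
    elim: r => [|j r ih]; first by rewrite !big_nil /comb big1// => ? _; rewrite mxE scale0r.
    by rewrite !big_cons comb_linear ih.
  by rewrite csum; apply: eq_bigr => j _; rewrite (mdot_comb Gc).
(* A vector outside [F] would have a residual extending [f] to [m + 2] orthonormal vectors in a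
   space of dimension [k + 1]. *)
apply: contrapT => Fv.
pose w := v - \sum_i vdot v (f i) *: f i.
have Fsum : F (\sum_i vdot v (f i) *: f i).
  by apply: (sd_sum FS) => i; apply: (sdZ FS).
have wn0 : sqn (@vdot R k.+1) w != 0.
  apply/eqP => h; apply: Fv; have : w = 0 by apply: vdot_eq0; rewrite /hnorm h sqrtr0.
  by move=> /eqP; rewrite subr_eq0 => /eqP ->.
have h0 i : vdot w (f i) = 0 by exact: (dot_projection (vdot_semidot k.+1)).
have [f' [_ of' _]] := orthonormal_extend (vdot_semidot k.+1) (e := f) (x := w)
  (fun=> Logic.I) of_ Logic.I h0 wn0.
by have := bndF _ _ of'; rewrite !ltnS ltnNge km.
Qed.

Lemma coefficient_joint (H : fdHilbert R) (U : urep [set: G] H) a b :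
  ccont (fun g => hdot (U g a) b).
Proof.
apply: (hcont_dot (fd_semidot H)) => //; last exact: (hcont_cst (fd_semidot H)).
apply/hcont_continuous; move: (@rep_cts _ _ _ _ _ U a).
by rewrite -continuous_subspace_setT.
Qed.

(* Otherwise the autocorrelation kappa of psi has an eigenspace for its convolution square
   containing an irreducible space of functions; these are matrix coefficients, on which
   convolution by kappa vanishes. *)
Theorem peter_weyl (psi : G -> R[i]) : ccont psi ->
  (forall (H : fdHilbert R) (U : urep [set: G] H), irreducible [set: G] U ->
     forall a b, mean (fun g => psi g * conjc (hdot (U g a) b)) = 0) ->
  psi = 0.
Proof.
move=> cpsi ortho; apply: contrapT => psi0.
(* The autocorrelation is Hermitian under inversion, and its value at 1 is the squared norm of
   [psi]. *)
pose kappa x := mean (fun h => psi (x * h)%g * conjc (psi h)).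
have cF : ccont (fun p : G * G => psi (p.1 * p.2)%g * conjc (psi p.2)).
  apply: ccontM; first exact: (ccont_comp (@mulg_cts _ _ _) cpsi).
  by apply: (ccont_snd _ (F := fun x => conjc (psi x))); exact: ccontJ.
have cslice x : ccont (fun h => psi (x * h)%g * conjc (psi h)).
  exact: (ccont_slice (F := fun x h => psi (x * h)%g * conjc (psi h))).
have ck : ccont kappa by exact: (ccont_mean Gc (F := fun x h => psi (x * h)%g * conjc (psi h))).
have kJ x : kappa x^-1%g = conjc (kappa x).
  rewrite /kappa -(mean_conj Gc)// -[LHS](mean_mulgl Gc x)//; congr mean; apply/funext => h.
  by rewrite mulKg conjcM conjcK mulrC.
have k0 : kappa <> 0.
  move=> /(congr1 (fun f => f 1%g)) k1; apply: psi0; apply: (mdot_eq0 Gc) => //.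
  have E : mdot psi psi = kappa 1%g.
    by rewrite /kappa /mdot; congr mean; apply/funext => h; rewrite mul1g.
  by rewrite /sqn E k1.
have [rho [p [rho0 cp p0 hp]]] := eigenfunction_exists Gc ck kJ k0.
have ckk := ccont_conv Gc ck ck.
have [N hN] := eigenspace_bounded Gc ckk rho0.
pose S := [set f : G -> R[i] | ccont f /\ conv (conv kappa kappa) f = rho%:C *: f].
have conv0 (f : G -> R[i]) : ccont f -> conv f 0 = 0.
  move=> cf; apply/funext => x; rewrite /conv -[RHS](mean_cst Gc 0); congr mean.
  by apply/funext => h; rewrite mulr0.
have [k [e [ce [oe [einv [Se irr]]]]]] : exists k (e : 'I_k -> G -> R[i]) (ce : forall i, ccont (e i))
    (oe : orthonormal mdot e)
    (einv : forall a i, rtrans a (e i) = \sum_j mdot (rtrans a (e i)) (e j) *: e j),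
    (forall i, S (e i)) /\ irreducible [set: G] (rrep_urep Gc ce oe einv).
  apply: (@irreducible_rtrans_family S N p) => //.
  - by move=> f [].
  - by split; [exact: ccont_cst|rewrite conv0// scaler0].
  - move=> a f g [cf hf] [cg hg]; split; first by apply: ccontD => //; exact: ccontZ.
    by rewrite (conv_linear Gc)// hf hg scalerDr !scalerA mulrC.
  - move=> a f [cf hf]; split; first exact: ccont_mulgr.
    by rewrite /rtrans (conv_mulgr Gc)// hf.
case: (irr) => -[v v0] _.
set U := rrep_urep Gc ce oe einv in irr.
(* After exchanging the means, a translation moves [h] into the vector [a]: translates of matrix
   coefficients are matrix coefficients, to which [psi] is orthogonal. *)
have kappa_ortho a b : mean (fun x => kappa x * conjc (hdot (U x a) b)) = 0.
  have cc := coefficient_joint U a b.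
  have cFF : ccont (fun p : G * G => psi (p.1 * p.2)%g * conjc (psi p.2) * conjc (hdot (U p.1 a) b)).
    apply: ccontM => //; apply: (ccont_fst _ (F := fun x => conjc (hdot (U x a) b))).
    exact: ccontJ.
  transitivity (mean (fun x => mean (fun h => psi (x * h)%g * conjc (psi h) * conjc (hdot (U x a) b)))).
    by congr mean; apply/funext => x; rewrite (meanZr Gc).
  rewrite (mean_fubini Gc (F := fun x h => psi (x * h)%g * conjc (psi h) * conjc (hdot (U x a) b)))//.
  rewrite -[RHS](mean_cst Gc 0); congr mean; apply/funext => h.
  pose F x := psi x * conjc (hdot (U x (U h^-1%g a)) b).
  have cF' : ccont F by apply: ccont_dot => //; exact: coefficient_joint.
  transitivity (mean (fun x => F (x * h)%g * conjc (psi h))).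
    congr mean; apply/funext => x; rewrite /F -(repM U)// mulgK.
    by rewrite mulrAC.
  rewrite (meanZr Gc); last exact: ccont_mulgr.
  by rewrite (mean_mulgr Gc)// ortho// mul0r.
(* Written as a matrix coefficient, [comb e w] turns the convolution at [x] into the mean of [kappa]
   against the conjugate of another coefficient. *)
have conv_comb w : conv kappa (comb e w) = 0.
  have [b hb] := comb_coefficient einv.
  apply/funext => x; rewrite /conv -(mean_inv Gc); last exact: conv_integrand (ccont_comb Gc ce w).
  have cI : ccont (fun g => kappa (x * g^-1^-1)%g * comb e w g^-1%g).
    by apply: (ccont_inv (f := fun g => kappa (x * g^-1)%g * comb e w g)); exact: conv_integrand (ccont_comb Gc ce w).
  rewrite -(mean_mulgl Gc x^-1%g)// -[RHS](kappa_ortho b (rrep e x w)); congr mean.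
  apply/funext => g; rewrite invgK mulVKg invgM invgK hb; congr (_ * _).
  rewrite -[RHS]hdot_conj -[LHS]/(hdot (U (g^-1 * x)%g w) b) (repM U)//.
  by rewrite -(rep_unitary U (k := g))// -(repM U)// mulgV rep1.
(* The eigenvalue [rho] is positive, whereas convolution by [kappa] already kills the function. *)
have comb0 w : comb e w = 0.
  have cw := ccont_comb Gc ce w.
  have : conv (conv kappa kappa) (comb e w) = rho%:C *: comb e w.
    have SS : S (comb e w).
      rewrite /comb; elim/big_rec: _ => [|i f _ [cf hf]].
        by split; [exact: ccont_cst|rewrite conv0// scaler0].
      have [ci hi] := Se i; split; first by apply: ccontD => //; exact: ccontZ.
      by rewrite (conv_linear Gc)// hf hi scalerDr !scalerA mulrC.
    by case: SS.
  rewrite (convA Gc)// conv_comb conv0// => /esym/eqP; rewrite scaler_eq0 => /orP[|/eqP//].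
  by rewrite eq_complex /= gt_eqF.
by move/eqP: v0; apply; apply: (comb_inj Gc ce oe); rewrite !comb0.
Qed.

End peter_weyl.

(** * Schur's lemma and orthogonality *)

Section linear_maps.
Context {R : realType}.
Implicit Types H : fdHilbert R.

Definition lin_map H H' (f : H -> H') := forall a x y, f (a *: x + y) = a *: f x + f y.

Lemma lin_map0 H H' (f : H -> H') : lin_map f -> f 0 = 0.
Proof.
move=> fl; have := fl 1 0 0; rewrite !scale1r addr0 => /eqP.
by rewrite -subr_eq0 opprD addNKr oppr_eq0 => /eqP.
Qed.

Lemma lin_mapZ H H' (f : H -> H') a x : lin_map f -> f (a *: x) = a *: f x.
Proof. by move=> fl; rewrite -[a *: x]addr0 fl lin_map0// addr0. Qed.

Lemma lin_mapD H H' (f : H -> H') x y : lin_map f -> f (x + y) = f x + f y.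
Proof. by move=> fl; rewrite -[x in LHS]scale1r fl scale1r. Qed.

Lemma lin_map_sum H H' (f : H -> H') (I : Type) (r : seq I) (F : I -> H) : lin_map f ->
  f (\sum_(i <- r) F i) = \sum_(i <- r) f (F i).
Proof.
move=> fl; elim: r => [|i r ih]; first by rewrite !big_nil lin_map0.
by rewrite !big_cons lin_mapD// ih.
Qed.

Lemma hdot_inj H (x y : H) : (forall z, hdot x z = hdot y z) -> x = y.
Proof.
move=> h; apply/eqP; rewrite -subr_eq0; apply/eqP/hdot_eq0.
by rewrite /sqn (dotBl (fd_semidot H))// h subrr.
Qed.

Lemma hdot_suml H (I : Type) (r : seq I) (F : I -> H) z :
  hdot (\sum_(i <- r) F i) z = \sum_(i <- r) hdot (F i) z.
Proof. exact: (dot_suml (fd_semidot H)). Qed.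

Lemma hdotZl H (a : R[i]) (x z : H) : hdot (a *: x) z = a * hdot x z.
Proof. exact: (dotZl (fd_semidot H)). Qed.

Lemma hdotZr H (a : R[i]) (x z : H) : hdot z (a *: x) = conjc a * hdot z x.
Proof. exact: (dotZr (fd_semidot H)). Qed.

Lemma hdotDl H (x y z : H) : hdot (x + y) z = hdot x z + hdot y z.
Proof. exact: (dotDl (fd_semidot H)). Qed.

Lemma hdotDr H (x y z : H) : hdot z (x + y) = hdot z x + hdot z y.
Proof. exact: (dotDr (fd_semidot H)). Qed.

Lemma hdot0l H (z : H) : hdot 0 z = 0.
Proof. exact: (dot0l (fd_semidot H)). Qed.

Lemma hdot_self_neq0 H (x : H) : x != 0 -> hdot x x != 0.
Proof. by apply: contraNneq => h; rewrite (@hdot_eq0 _ _ x)// /sqn h. Qed.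

Lemma onb_parseval H d (e : 'I_d -> H) (x y : H) : onb (@hdot R H) e ->
  hdot x y = \sum_i hdot x (e i) * conjc (hdot y (e i)).
Proof.
move=> [_ he]; rewrite {1}(he x) hdot_suml; apply: eq_bigr => i _.
by rewrite hdotZl (hdot_conj y).
Qed.

(** Riesz representation in finite dimension. It turns means of products with matrix coefficients
    into linear maps, to which Schur's lemma applies. *)
Lemma sesquilinear_map H H' (B : H -> H' -> R[i]) :
  (forall z a x y, B (a *: x + y) z = a * B x z + B y z) ->
  (forall z a x y, B z (a *: x + y) = conjc a * B z x + B z y) ->
  exists f : H -> H', lin_map f /\ forall x y, hdot (f x) y = B x y.
Proof.
move=> Bl Br; have [d [e [oe he]]] := hfin H'.
exists (fun x => \sum_i B x (e i) *: e i); split.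
  move=> a x y; rewrite scaler_sumr -big_split; apply: eq_bigr => i _ /=.
  by rewrite Bl scalerDl scalerA.
have B0 z : B z 0 = 0.
  have := Br z 1 0 0; rewrite scale1r addr0 conjc1 mul1r => /eqP.
  by rewrite -subr_eq0 opprD addNKr oppr_eq0 => /eqP.
move=> x y; rewrite [y in RHS]he hdot_suml.
have -> (I : Type) (r : seq I) (F : I -> H') c : B x (\sum_(i <- r) c i *: F i) =
    \sum_(i <- r) conjc (c i) * B x (F i).
  by elim: r => [|i r ih]; rewrite ?big_nil ?B0// !big_cons Br ih.
by apply: eq_bigr => i _; rewrite hdotZl mulrC -hdot_conj.
Qed.

Lemma adjoint_exists H H' (f : H -> H') : lin_map f ->
  exists g : H' -> H, lin_map g /\ forall x y, hdot (g y) x = hdot y (f x).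
Proof.
move=> fl; have [z a x y|z a x y|g [gl hg]] :=
    @sesquilinear_map H' H (fun y x => hdot y (f x)).
- exact: hdot_linear.
- by rewrite fl hdotDr hdotZr.
- by exists g; split=> // x y; exact: hg.
Qed.

Lemma eigenvector_exists H (T : H -> H) : lin_map T -> (exists x : H, x != 0) ->
  exists a x, x != 0 /\ T x = a *: x.
Proof.
move=> Tl [x0 x0n]; have [d [e [oe he]]] := hfin H.
have d0 : (0 < d)%N.
  by case: d e oe he => // e _ he; move: x0n; rewrite (he x0) big_ord0 eqxx.
pose A : 'M[R[i]]_d := \matrix_(i, j) hdot (T (e i)) (e j).
(* [Theorem7'] provides an eigenvalue of a complex square matrix of positive size. Eigenvectors are
   rows, which matches the rows of [A] holding the coordinates of the images [T (e i)]. *)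
have [a /eigenvalueP[v vA v0]] := Theorem7' A d0.
exists a, (\sum_i v 0 i *: e i); split.
  apply: contraNneq v0 => h; apply/eqP/rowP => j; rewrite mxE.
  have := congr1 (fun x => hdot x (e j)) h; rewrite hdot_suml hdot0l => <-.
  rewrite (bigD1 j)//= hdotZl oe eqxx mulr1 big1 ?addr0// => i ij.
  by rewrite hdotZl oe (negbTE ij) mulr0.
rewrite lin_map_sum// scaler_sumr.
have -> : \sum_i T (v 0 i *: e i) = \sum_i \sum_j (v 0 i * A i j) *: e j.
  apply: eq_bigr => i _; rewrite lin_mapZ// [T (e i)]he scaler_sumr.
  by apply: eq_bigr => j _; rewrite scalerA mxE.
rewrite exchange_big; apply: eq_bigr => j _; rewrite -scaler_suml scalerA; congr (_ *: _).
by have := congr1 (fun w : 'rV_d => w 0 j) vA; rewrite !mxE.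
Qed.

End linear_maps.

Section schur.
Context {R : realType} {n : nat} {G : lieGroupType R n} (S : set G).
Hypothesis SV : forall k, S k -> S k^-1%g.

Lemma rep_unitaryV (H : fdHilbert R) (U : urep S H) k x y : S k ->
  hdot (U k x) y = hdot x (U k^-1%g y).
Proof.
move=> Sk; have Sk' := SV Sk.
by rewrite -(rep_unitary U (k := k^-1%g))// -(repM U)// mulVg rep1.
Qed.

Lemma schur_scalar (H : fdHilbert R) (U : urep S H) (T : H -> H) :
  irreducible S U -> intertwiner S U U T -> exists c, forall x, T x = c *: x.
Proof.
move=> [ne irr] [Tl TU]; have [c [x [x0 Tx]]] := eigenvector_exists Tl ne.
exists c; have [||E0|ET] := irr [set y | T y = c *: y].
- by split=> /= [|a y z Ty Tz]; rewrite ?(lin_map0 Tl) ?scaler0// Tl Ty Tz scalerDr !scalerA mulrC.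
- by move=> k y Sk /= Ty; rewrite TU// Ty -(lin_mapZ _ _ (fun a x y => rep_linear U a x y Sk)).
- by move: x0; have : [set y | T y = c *: y] x by []; rewrite E0 => /= ->; rewrite eqxx.
- by move=> y; have : [set y | T y = c *: y] y by rewrite ET.
Qed.

(** The adjoint of [f] composed with [f] commutes with [U], hence is a scalar, and positivity makes
    the scalar real. *)
Lemma schur_isometry (H H' : fdHilbert R) (U : urep S H) (U' : urep S H') (f : H -> H') :
  irreducible S U -> intertwiner S U U' f ->
  exists c : R, 0 <= c /\ forall x y, hdot (f x) (f y) = c%:C * hdot x y.
Proof.
move=> irr [fl fU]; have [g [gl hg]] := adjoint_exists fl.
have gU k y : S k -> g (U' k y) = U k (g y).
  move=> Sk; apply: hdot_inj => z; have Sk' := SV Sk.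
  by rewrite hg rep_unitaryV// -fU// -hg rep_unitaryV.
have [c hc] : exists c, forall x, g (f x) = c *: x.
  apply: (schur_scalar irr); split=> [a x y|k x Sk]; first by rewrite fl gl.
  by rewrite fU// gU.
have fxy x y : hdot (f x) (f y) = c * hdot x y by rewrite -hg hc hdotZl.
case: (irr) => -[x x0] _.
have xx0 : 0 < hdot x x by rewrite lt_def hdot_self_neq0// (sd_ge0 (fd_semidot H)).
have c0 : 0 <= c.
  have : 0 <= hdot (f x) (f x) by exact: (sd_ge0 (fd_semidot H')).
  by rewrite fxy pmulr_lge0.
by exists (complex.Re c); split; [exact: Re_ge0|rewrite -ge0_complex].
Qed.

Lemma schur_contains (H H' : fdHilbert R) (U : urep S H) (U' : urep S H') (f : H -> H') x0 :
  irreducible S U -> intertwiner S U U' f -> f x0 != 0 ->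
  exists (c : R) (g : H -> H'), [/\ 0 < c, intertwiner S U U' g, isometric g & forall x, f x = c%:C *: g x].
Proof.
move=> irr fI fx0; have [c [c0 hc]] := schur_isometry irr fI.
have cp : 0 < c.
  rewrite lt_def c0 andbT; apply: contraNneq (hdot_self_neq0 fx0) => h.
  by rewrite hc h mul0r.
have s0 : 0 < Num.sqrt c by rewrite sqrtr_gt0.
case: fI => fl fU.
exists (Num.sqrt c), (fun x => (Num.sqrt c)^-1%:C *: f x); split=> //.
- split=> [a x y|k x Sk]; first by rewrite fl scalerDr !scalerA mulrC.
  by rewrite fU// (lin_mapZ _ _ (fun a x y => rep_linear U' a x y Sk)).
- move=> x y; rewrite hdotZl hdotZr conjc_real hc !mulrA -!rmorphM /=.
  by rewrite -invfM -expr2 sqr_sqrtr// mulVf ?gt_eqF// mul1r.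
- by move=> x; rewrite scalerA -rmorphM /= mulfV ?scale1r// gt_eqF.
Qed.

Lemma schur_equivalent (H H' : fdHilbert R) (U : urep S H) (U' : urep S H') (f : H -> H') x0 :
  irreducible S U -> irreducible S U' -> intertwiner S U U' f -> f x0 != 0 ->
  equivalent S U U'.
Proof.
move=> irr irr' fI fx0; have [c [g [c0 gI gi fg]]] := schur_contains irr fI fx0.
case: (gI) => gl gU.
have surj y : exists x, g x = y.
  have [||E0|ET] := (proj2 irr') (range g).
  - split; first by exists 0 => //; exact: (lin_map0 gl).
    by move=> a _ _ [x _ <-] [z _ <-]; exists (a *: x + z) => //; rewrite gl.
  - by move=> k _ Sk [x _ <-]; exists (U k x) => //; exact: (gU k x Sk).
  - have : range g (g x0) by exists x0.
    by rewrite E0 => /= h; move: fx0; rewrite fg h scaler0 eqxx.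
  - have [x _ <-] : range g y by rewrite ET.
    by exists x.
have [g' hg'] := choice surj.
exists g; split=> //; exists g' => x //; apply: hdot_inj => z.
by rewrite -gi hg' gi.
Qed.

End schur.

Section schur_orthogonality.
Context {R : realType} {n : nat} {G : lieGroupType R n}.
Hypothesis Gc : compact [set: G].

Lemma coefficient_dot_ccont (H H' : fdHilbert R) (V : urep [set: G] H) (V' : urep [set: G] H') a b a' b' :
  ccont (fun g => hdot (V g a) b * conjc (hdot (V' g a') b')).
Proof. by apply: ccont_dot; exact: coefficient_joint. Qed.

(** For fixed [b] and [b'] the mean is sesquilinear in [a] and [a'], and right invariance of the
    mean is the intertwining property. *)
Lemma coefficient_intertwiner (H H' : fdHilbert R) (V : urep [set: G] H) (V' : urep [set: G] H') b b' :
  exists f : H -> H', intertwiner [set: G] V V' f /\ forall a a', hdot (f a) a' =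
    mean (fun g => hdot (V g a) b * conjc (hdot (V' g a') b')).
Proof.
have cB := coefficient_dot_ccont V V'.
have [z a x y|z a x y|f [fl hf]] := @sesquilinear_map R H H'
  (fun a a' => mean (fun g => hdot (V g a) b * conjc (hdot (V' g a') b'))).
- rewrite -(mean_linear Gc)//; congr mean; apply/funext => g.
  by rewrite rep_linear// hdotDl hdotZl mulrDl mulrA.
- rewrite -(mean_linear Gc)//; congr mean; apply/funext => g.
  by rewrite rep_linear// hdotDl hdotZl rmorphD /= conjcM; ring.
exists f; split=> //; split=> // k x _; apply: hdot_inj => z.
rewrite rep_unitaryV// !hf -[LHS](mean_mulgr Gc k^-1%g)//; congr mean; apply/funext => g.
by rewrite -(repM V)// mulgVK (repM V').
Qed.

Lemma schur_orthogonality_neq (H H' : fdHilbert R) (V : urep [set: G] H) (V' : urep [set: G] H') :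
  irreducible [set: G] V -> irreducible [set: G] V' -> ~ equivalent [set: G] V V' ->
  forall a b a' b', mean (fun g => hdot (V g a) b * conjc (hdot (V' g a') b')) = 0.
Proof.
move=> irr irr' neq a b a' b'; have [f [fI hf]] := coefficient_intertwiner V V' b b'.
have [f0|fn0] := eqVneq (f a) 0; first by rewrite -hf f0 hdot0l.
by exfalso; apply: neq; exact: schur_equivalent fn0.
Qed.

Lemma schur_orthogonality (H : fdHilbert R) (V : urep [set: G] H) d (e : 'I_d -> H) :
  irreducible [set: G] V -> onb (@hdot R H) e -> forall a b a' b',
  mean (fun g => hdot (V g a) b * conjc (hdot (V g a') b')) =
    hdot a a' * conjc (hdot b b') / d%:R.
Proof.
move=> irr oe a b a' b'; have [f [fI hf]] := coefficient_intertwiner V V b b'.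
have [c hc] := schur_scalar irr fI.
have d0 : d%:R != 0 :> R[i].
  rewrite pnatr_eq0; case: irr => -[x x0] _; case: d e oe => // e [_ he].
  by exfalso; move: x0; rewrite (he x) big_ord0 eqxx.
(* The scalar is computed by a trace: summed over the basis, the integrands become constant in
   [g]. *)
rewrite -hf hc hdotZl; suff -> : c = conjc (hdot b b') / d%:R by ring.
apply: (mulIf d0); rewrite divfK//.
have -> : c * d%:R = \sum_(l < d) hdot (f (e l)) (e l).
  rewrite -[in LHS](card_ord d) mulr_natr -sumr_const; apply: eq_bigr => l _.
  by rewrite hc hdotZl (proj1 oe) eqxx mulr1.
under eq_bigr do rewrite hf.
rewrite -(mean_sum Gc _ (F := fun l g => hdot (V g (e l)) b * conjc (hdot (V g (e l)) b'))); last first.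
  by move=> l; exact: coefficient_dot_ccont.
rewrite -[RHS](mean_cst Gc); congr mean; apply/funext => g.
rewrite -hdot_conj -(rep_unitary V (k := g^-1%g))// (onb_parseval _ _ oe).
apply: eq_bigr => l _.
have U y : hdot (V g (e l)) y = conjc (hdot (V g^-1%g y) (e l)).
  by rewrite rep_unitaryV// hdot_conj.
by rewrite !U conjcK mulrC.
Qed.

End schur_orthogonality.

(** * Square integrable random variables *)

Section real_square_integrable.
Context {R : realType} d (Omega : measurableType d) (P : probability Omega R).
Implicit Types f g : Omega -> R.

Definition rl2 f := measurable_fun setT f /\ (\int[P]_w ((f w) ^+ 2)%:E < +oo)%E.

Lemma rl2_integrable_sqr f : rl2 f -> P.-integrable setT (EFin \o (fun w => f w ^+ 2)).
Proof.
move=> [mf fi]; apply/integrableP; split; first by apply/measurable_EFinP; exact: measurable_funX.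
by under eq_integral do rewrite /= ger0_norm ?sqr_ge0//.
Qed.

Lemma rl2_integrable_mul f g : rl2 f -> rl2 g -> P.-integrable setT (EFin \o (fun w => f w * g w)).
Proof.
move=> lf lg; have /rl2_integrable_sqr fi := lf; have /rl2_integrable_sqr gi := lg.
apply: (le_integrable measurableT _ _ (integrableD measurableT fi gi)).
  by apply/measurable_EFinP; apply: measurable_funM; [exact: lf.1|exact: lg.1].
move=> w _ /=; rewrite lee_fin normrM [leRHS]ger0_norm ?addr_ge0 ?sqr_ge0//.
rewrite -(real_normK (num_real (f w))) -(real_normK (num_real (g w))).
have := normr_ge0 (f w); have := normr_ge0 (g w).
by have := sqr_ge0 (`|f w| - `|g w|); nra.
Qed.

Lemma rl2_cst (c : R) : rl2 (fun=> c).
Proof.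
split; first exact: measurable_cst.
by rewrite integral_cst//= probability_setT mule1 ltry.
Qed.

Lemma rl2D f g : rl2 f -> rl2 g -> rl2 (fun w => f w + g w).
Proof.
move=> lf lg; have fi := rl2_integrable_sqr lf; have gi := rl2_integrable_sqr lg.
split; first by apply: measurable_funD; [exact: lf.1|exact: lg.1].
have := integrable_lty measurableT (integrableZl measurableT 2 (integrableD measurableT fi gi)).
apply: le_lt_trans; apply: ge0_le_integral => //.
- by move=> w _; rewrite lee_fin sqr_ge0.
- by apply/measurable_EFinP; apply: measurable_funX; apply: measurable_funD; [exact: lf.1|exact: lg.1].
- by apply: measurable_int; apply: (integrableZl measurableT); exact: (integrableD measurableT fi gi).
move=> w _ /=; rewrite -EFinD -EFinM lee_fin.
by have := sqr_ge0 (f w - g w); nra.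
Qed.

Lemma rl2Z (c : R) f : rl2 f -> rl2 (fun w => c * f w).
Proof.
move=> lf; split; first by apply: measurable_funM; [exact: measurable_cst|exact: lf.1].
have := integrable_lty measurableT (integrableZl measurableT (c ^+ 2) (rl2_integrable_sqr lf)).
by under eq_integral do rewrite /= -EFinM -exprMn.
Qed.

(* Riesz-Fischer: a rapidly Cauchy subsequence converges almost everywhere. *)
Lemma rl2_complete (X : nat -> Omega -> R) : (forall k, rl2 (X k)) ->
  (forall e : R, 0 < e -> exists k, forall l m, (k <= l)%N -> (k <= m)%N ->
     (\int[P]_w ((X l w - X m w) ^+ 2)%:E <= e%:E)%E) ->
  exists Y, rl2 Y /\ forall e : R, 0 < e -> exists k, forall l, (k <= l)%N ->
     (\int[P]_w ((X l w - Y w) ^+ 2)%:E <= e%:E)%E.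
Proof.
move=> lX cau.
have mX k : measurable_fun setT (X k) by case: (lX k).
have pos k : 0 < (4 ^+ k)^-1 :> R by rewrite invr_gt0 exprn_gt0.
(* Squared distances below [4^-k] make the mean absolute increments at most [2^-k], a summable
   sequence. *)
have [N hN] := choice (fun k => cau _ (pos k)).
pose n_ := fix n_ k := if k is k'.+1 then maxn (n_ k').+1 (N k) else N 0%N.
have nN k : (N k <= n_ k)%N by case: k => //= k; rewrite leq_maxr.
have nlt k : (n_ k < n_ k.+1)%N by rewrite /= leq_maxl.
have nS k : (n_ k <= n_ k.+1)%N by exact: ltnW.
have n_ge k : (k <= n_ k)%N by elim: k => // k ih; exact: leq_ltn_trans (nlt k).
pose x k := X (n_ k).
pose D k w := `|x k.+1 w - x k w|.
have mD k : measurable_fun setT (D k).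
  by apply: measurableT_comp => //; apply: measurable_funB; exact: mX.
have iD2 k : (\int[P]_w ((D k w) ^+ 2)%:E <= ((4 ^+ k)^-1)%:E)%E.
  under eq_integral do rewrite /D real_normK ?num_real//.
  by apply: hN; [exact: leq_trans (nN _) (nS _)|exact: nN].
have lD k : rl2 (D k) by split=> //; apply: le_lt_trans (iD2 k) (ltry _).
have iD k : (\int[P]_w (D k w)%:E <= ((2 ^+ k)^-1)%:E)%E.
  have p2 : 0 < 2 ^+ k :> R by rewrite exprn_gt0.
  (* The bound of the increment by [F] is the expanded form of [(2^k D - 1)^2 >= 0]; both terms of
     [F] integrate to at most half of [2^-k]. *)
  pose F w := ((2 ^+ k / 2)%:E * ((D k w) ^+ 2)%:E + ((2 ^+ k)^-1 / 2)%:E)%E.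
  have i1 := integrableZl measurableT (2 ^+ k / 2) (rl2_integrable_sqr (lD k)).
  have i2 : P.-integrable setT (cst (((2 ^+ k)^-1 / 2)%:E : \bar R)).
    exact: finite_measure_integrable_cst.
  apply: (@le_trans _ _ (\int[P]_w F w)%E).
    apply: ge0_le_integral => //.
    - by move=> w _; rewrite lee_fin normr_ge0.
    - exact/measurable_EFinP.
    - exact: (measurable_int P (integrableD measurableT i1 i2)).
    - move=> w _; rewrite /F -EFinM -EFinD lee_fin.
      have := sqr_ge0 (2 ^+ k * D k w - 1).
      rewrite -(pmulr_rge0 _ (_ : 0 < (2 ^+ k)^-1 / 2)); last by rewrite divr_gt0// invr_gt0.
      have -> : (2 ^+ k)^-1 / 2 * (2 ^+ k * D k w - 1) ^+ 2 =
         2 ^+ k / 2 * D k w ^+ 2 + (2 ^+ k)^-1 / 2 - D k w by field; rewrite gt_eqF.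
      by rewrite subr_ge0.
  rewrite /F (integralD measurableT i1 i2) integralZl//; last exact: rl2_integrable_sqr.
  rewrite integral_cst//= probability_setT mule1.
  apply: le_trans (_ : (2 ^+ k / 2)%:E * ((4 ^+ k)^-1)%:E + ((2 ^+ k)^-1 / 2)%:E <= _)%E.
    by rewrite leeD2r// lee_pmul2l// lte_fin divr_gt0.
  have E4 : 4 ^+ k = 2 ^+ k * 2 ^+ k :> R by rewrite -exprMn; congr (_ ^+ _); ring.
  rewrite -EFinM -EFinD lee_fin E4; move: p2; move: (2 ^+ k : R) => a a0.
  have -> : a / 2 * (a * a)^-1 + a^-1 / 2 = a^-1 by field; rewrite gt_eqF.
  by [].
pose Y w := (\sum_(0 <= k <oo) (D k w)%:E)%E.
have D0 k w : (0 <= (D k w)%:E)%E by rewrite lee_fin normr_ge0.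
have mY : measurable_fun setT Y.
  by apply: ge0_emeasurable_sum => // k _; exact/measurable_EFinP.
have Y0 w : (0 <= Y w)%E by apply: nneseries_ge0.
have iY : P.-integrable setT Y.
  apply/integrableP; split=> //; under eq_integral do rewrite gee0_abs//.
  rewrite integral_nneseries//; last by move=> k; exact/measurable_EFinP.
  apply: (@le_lt_trans _ _ 2%:E); last exact: ltry.
  apply: lime_le; first by apply: is_cvg_nneseries => k _ _; exact: integral_ge0.
  apply: nearW => m.
  suff : (\sum_(0 <= k < m) \int[P]_x (D k x)%:E <= (2 - 2 / 2 ^+ m)%:E)%E.
    by move=> h; apply: le_trans h _; rewrite lee_fin gerBl divr_ge0// exprn_ge0.
  elim: m => [|m ih]; first by rewrite big_geq// expr0 divr1 subrr.
  rewrite big_nat_recr//=; apply: le_trans (leeD ih (iD m)) _.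
  rewrite -EFinD lee_fin le_eqVlt; apply/orP; left; apply/eqP.
  by rewrite exprS; field; rewrite expf_neq0.
have xcvg w : Y w \is a fin_num -> cvgn (fun k => x k w).
  move=> Yw; pose u k := x k.+1 w - x k w.
  have : cvgn (series u).
    apply: normed_cvg; apply: nondecreasing_is_cvgn.
      apply: nondecreasing_series => k _ _; exact: normr_ge0.
    exists (fine (Y w)) => _ [k _ <-]; rewrite -lee_fin fineK//.
    have := @nneseries_lim_ge R (fun k => (D k w)%:E) xpredT 0%N k (fun j _ _ => D0 j w).
    by rewrite -sumEFin; apply.
  have E : (fun k => series u k + x 0%N w) = (fun k => x k w).
    by apply/funext => k; rewrite /series /= telescope_sumr// subrK.
  move=> cu; rewrite -[X in cvgn X]E; apply: is_cvgD => //; exact: is_cvg_cst.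
(* The upper limit is measurable everywhere and equals the limit wherever [Y] is finite, that is
   almost everywhere. *)
pose Z w := fine (limn_esup (fun k => (x k w)%:E)).
have mZ : measurable_fun setT Z.
  apply: measurableT_comp => //; apply: measurable_fun_limn_esup => k.
  by apply/measurable_EFinP; exact: mX.
have aeY := integrable_ae measurableT iY.
have xZ w : Y w \is a fin_num -> (fun k => x k w) @ \oo --> Z w.
  move=> /xcvg /cvg_ex[l xl].
  have /cvg_limn_einf_sup[_ E] : (fun k => (x k w)%:E) @ \oo --> l%:E.
    by apply/fine_cvgP; split; first exact: nearW.
  by rewrite /Z E.
(* Fatou's lemma along the subsequence carries the Cauchy estimate over to the limit. *)
have XZ (e : R) : 0 < e -> exists k, forall l, (k <= l)%N ->
    (\int[P]_w ((X l w - Z w) ^+ 2)%:E <= e%:E)%E.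
  move=> /cau[k0 hk0]; exists k0 => l kl.
  have mXx j : measurable_fun setT (fun w => ((X l w - x j w) ^+ 2)%:E : \bar R).
    by apply/measurable_EFinP; apply: measurable_funX; apply: measurable_funB; exact: mX.
  apply: (@le_trans _ _ (\int[P]_w limn_einf (fun k => ((X l w - x k w) ^+ 2)%:E))%E).
    have einf_ge0 w : (0 <= limn_einf (fun k => ((X l w - x k w) ^+ 2)%:E))%E.
      rewrite limn_einf_lim; apply: lime_ge; first exact: is_cvg_einfs.
      apply: nearW => k; apply: le_ereal_inf_tmp => _ [j _ <-].
      by rewrite lee_fin sqr_ge0.
    apply: ae_ge0_le_integral => //.
    - by move=> w _; rewrite lee_fin sqr_ge0.
    - by apply/measurable_EFinP; apply: measurable_funX; apply: measurable_funB.
    - apply: measurableT_comp => //; apply: measurable_fun_limn_esup => k.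
      by apply: measurableT_comp => //.
    - apply: filterS aeY => w /(_ Logic.I) /xZ xw _.
      have /cvg_limn_einf_sup[-> _] // : (fun k => ((X l w - x k w) ^+ 2)%:E) @ \oo -->
          ((X l w - Z w) ^+ 2)%:E.
      apply/fine_cvgP; split; first exact: nearW.
      have h : (fun k => X l w - x k w) @ \oo --> X l w - Z w.
        by apply: cvgB => //; exact: cvg_cst.
      exact: (cvgM h h).
  apply: le_trans (fatou P measurableT mXx _) _.
    by move=> k w _; rewrite lee_fin sqr_ge0.
  rewrite limn_einf_lim; apply: lime_le; first exact: is_cvg_einfs.
  apply: nearW => k; pose j := maxn k k0.
  apply: le_trans (_ : \int[P]_w ((X l w - x j w) ^+ 2)%:E <= _)%E.
    by apply: ereal_inf_lbound; exists j => //=; exact: leq_maxl.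
  by apply: hk0 => //; exact: leq_trans (leq_maxr _ _) (n_ge _).
exists Z; split=> //; have [k hk] := XZ 1 ltr01.
have lXZ : rl2 (fun w => X k w - Z w).
  split; first by apply: measurable_funB.
  exact: le_lt_trans (hk k (leqnn _)) (ltry _).
have -> : Z = fun w => X k w + (-1) * (X k w - Z w).
  by apply/funext => w; rewrite mulN1r opprB addrC subrK.
by apply: rl2D => //; exact: rl2Z.
Qed.
End real_square_integrable.

Section complex_square_integrable.
Context {R : realType} d (Omega : measurableType d) (P : probability Omega R).
Implicit Types Z : Omega -> R[i].

Lemma square_integrableP Z : square_integrable P Z <->
  rl2 P (fun w => complex.Re (Z w)) /\ rl2 P (fun w => complex.Im (Z w)).
Proof.
have le0 (f g : Omega -> R) : measurable_fun setT f -> measurable_fun setT g ->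
    (\int[P]_w ((f w ^+ 2)%:E) <= \int[P]_w ((f w ^+ 2 + g w ^+ 2)%:E))%E.
  move=> mf mg; apply: ge0_le_integral => //.
  - by move=> w _; rewrite lee_fin sqr_ge0.
  - by apply/measurable_EFinP; exact: measurable_funX.
  - by apply/measurable_EFinP; apply: measurable_funD; exact: measurable_funX.
  - by move=> w _; rewrite lee_fin lerDl sqr_ge0.
split=> [[[mr mi] fin]|[[mr fr] [mi fi]]].
  rewrite /sqmean unlock in fin; split; split=> //.
    exact: le_lt_trans (le0 _ _ mr mi) fin.
  apply: le_lt_trans (le0 _ _ mi mr) _.
  by under eq_integral do rewrite addrC.
split=> //; rewrite /sqmean unlock.
under eq_integral do rewrite EFinD.
rewrite ge0_integralD//.
- exact: lte_add_pinfty.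
- by move=> w _; rewrite lee_fin sqr_ge0.
- by apply/measurable_EFinP; exact: measurable_funX.
- by move=> w _; rewrite lee_fin sqr_ge0.
- by apply/measurable_EFinP; exact: measurable_funX.
Qed.

Definition cintegrable Z :=
  P.-integrable setT (EFin \o (fun w => complex.Re (Z w))) /\
  P.-integrable setT (EFin \o (fun w => complex.Im (Z w))).

Lemma cexpectE Z : cexpect P Z =
  (\int[P]_w complex.Re (Z w)) +i* (\int[P]_w complex.Im (Z w)).
Proof. by rewrite /cexpect unlock. Qed.

Lemma integrable_lin (a b : R) (f g : Omega -> R) :
  P.-integrable setT (EFin \o f) -> P.-integrable setT (EFin \o g) ->
  P.-integrable setT (EFin \o (fun w => a * f w + b * g w)) /\
  \int[P]_w (a * f w + b * g w) = a * \int[P]_w f w + b * \int[P]_w g w.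
Proof.
move=> fi gi.
have afi : P.-integrable setT (EFin \o (fun w => a * f w)) by exact: (integrableZl measurableT a fi).
have bgi : P.-integrable setT (EFin \o (fun w => b * g w)) by exact: (integrableZl measurableT b gi).
split; first exact: (integrableD measurableT afi bgi).
by rewrite RintegralD// !RintegralZl.
Qed.

Lemma cexpect_linear (c : R[i]) Z Z' : cintegrable Z -> cintegrable Z' ->
  cintegrable (fun w => c * Z w + Z' w) /\
  cexpect P (fun w => c * Z w + Z' w) = c * cexpect P Z + cexpect P Z'.
Proof.
case: c => a b [zr zi] [zr' zi']; rewrite !cexpectE.
have [i1 e1] := integrable_lin a (- b) zr zi.
have [i2 e2] := integrable_lin a b zi zr.
have [i3 e3] := integrable_lin 1 1 i1 zr'.
have [i4 e4] := integrable_lin 1 1 i2 zi'.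
have Er : (fun w => complex.Re ((a +i* b) * Z w + Z' w)) =
   fun w => 1 * (a * complex.Re (Z w) + - b * complex.Im (Z w)) + 1 * complex.Re (Z' w).
  by apply/funext => w; rewrite ReD ReM /=; ring.
have Ei : (fun w => complex.Im ((a +i* b) * Z w + Z' w)) =
   fun w => 1 * (a * complex.Im (Z w) + b * complex.Re (Z w)) + 1 * complex.Im (Z' w).
  by apply/funext => w; rewrite ImD ImM /=; ring.
split; first by split; rewrite ?Er ?Ei.
rewrite Er Ei e3 e4 e1 e2; apply/eqP; rewrite eq_complex /=.
by apply/andP; split; apply/eqP; ring.
Qed.

Lemma cexpect_conj Z : cintegrable Z -> cexpect P (fun w => conjc (Z w)) = conjc (cexpect P Z).
Proof.
move=> [zr zi]; rewrite !cexpectE /=; congr (_ +i* _).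
  by apply: eq_Rintegral => w _; rewrite ReJ.
have [_ e] := integrable_lin (-1) 0 zi zi.
rewrite -[RHS]mulN1r -[RHS]addr0 -[X in _ + X](mul0r (\int[P]_w complex.Im (Z w))) -e.
by apply: eq_Rintegral => w _; rewrite ImJ mul0r addr0 mulN1r.
Qed.

Definition cdot Z Z' : R[i] := cexpect P (fun w => Z w * conjc (Z' w)).
Definition cl2 : set (Omega -> R[i]) := [set Z | square_integrable P Z].

Lemma cl2_cintegrable Z Z' : cl2 Z -> cl2 Z' -> cintegrable (fun w => Z w * conjc (Z' w)).
Proof.
move=> /square_integrableP[zr zi] /square_integrableP[zr' zi'].
have i1 := rl2_integrable_mul zr zr'; have i2 := rl2_integrable_mul zi zi'.
have i3 := rl2_integrable_mul zi zr'; have i4 := rl2_integrable_mul zr zi'.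
have [j1 _] := integrable_lin 1 1 i1 i2; have [j2 _] := integrable_lin 1 (-1) i3 i4.
split.
  rewrite (_ : (fun w => complex.Re _) = fun w => 1 * (complex.Re (Z w) * complex.Re (Z' w)) +
    1 * (complex.Im (Z w) * complex.Im (Z' w)))//.
  by apply/funext => w; rewrite ReM ReJ ImJ; ring.
rewrite (_ : (fun w => complex.Im _) = fun w => 1 * (complex.Im (Z w) * complex.Re (Z' w)) +
    -1 * (complex.Re (Z w) * complex.Im (Z' w)))//.
by apply/funext => w; rewrite ImM ReJ ImJ; ring.
Qed.

Lemma cl2_cst (c : R[i]) : cl2 (fun=> c).
Proof. by apply/square_integrableP; split; exact: rl2_cst. Qed.

Lemma cl2P (c : R[i]) Z Z' : cl2 Z -> cl2 Z' -> cl2 (c *: Z + Z').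
Proof.
move=> /square_integrableP[zr zi] /square_integrableP[zr' zi']; apply/square_integrableP.
split.
  rewrite (_ : (fun w => _) = fun w => (complex.Re c * complex.Re (Z w) +
    - complex.Im c * complex.Im (Z w)) + complex.Re (Z' w)).
    by apply: rl2D => //; apply: rl2D; exact: rl2Z.
  by apply/funext => w; rewrite -[(c *: Z + Z') w]/(c * Z w + Z' w) ReD ReM; ring.
rewrite (_ : (fun w => _) = fun w => (complex.Re c * complex.Im (Z w) +
  complex.Im c * complex.Re (Z w)) + complex.Im (Z' w)).
  by apply: rl2D => //; apply: rl2D; exact: rl2Z.
by apply/funext => w; rewrite -[(c *: Z + Z') w]/(c * Z w + Z' w) ImD ImM; ring.
Qed.

Lemma cdot_semidot : semidot cl2 cdot.
Proof.
split.
- exact: cl2_cst.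
- by move=> c Z Z'; exact: cl2P.
- move=> c x y z Sx Sy Sz.
  have [_ e] := cexpect_linear c (cl2_cintegrable Sx Sz) (cl2_cintegrable Sy Sz).
  rewrite /cdot -e; congr cexpect; apply/funext => w.
  by rewrite -[(c *: x + y) w]/(c * x w + y w) mulrDl mulrA.
- move=> x y Sx Sy; rewrite /cdot -cexpect_conj; last exact: cl2_cintegrable.
  by congr cexpect; apply/funext => w; rewrite conjcM conjcK mulrC.
- move=> x Sx; rewrite /cdot cexpectE lecE /=.
  rewrite (_ : (fun w => complex.Im _) = cst 0); last first.
    by apply/funext => w; rewrite mulcJ.
  rewrite Rintegral_cst// mul0r eqxx /=; apply: Rintegral_ge0 => w _.
  by rewrite mulcJ /= sqr_ge0.
Qed.

Lemma sqmeanE Z : cl2 Z -> sqmean P Z = (sqn cdot Z)%:E.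
Proof.
move=> SZ; rewrite /sqn /cdot cexpectE /sqmean unlock /= /Rintegral fineK.
  by apply: eq_integral => w _; rewrite mulcJ /= normc_sqE.
have [ir _] := cl2_cintegrable SZ SZ.
exact: (integrable_fin_num measurableT ir).
Qed.

Lemma cexpect_cdot Z : cexpect P Z = cdot Z (fun=> 1).
Proof. by congr cexpect; apply/funext => w; rewrite conjc1 mulr1. Qed.

Lemma cl2_complete : hcomplete cdot cl2.
Proof.
move=> u Su cau.
have SB k l : cl2 (u k - u l) by apply: (sdB cdot_semidot).
have part (p : R[i] -> R) : (forall z, p z ^+ 2 <= complex.Re z ^+ 2 + complex.Im z ^+ 2) ->
    (forall z w, p (z - w) = p z - p w) ->
    (forall Z, cl2 Z -> rl2 P (fun w => p (Z w))) ->
    exists Y, rl2 P Y /\ forall e : R, 0 < e -> exists k, forall l, (k <= l)%N ->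
      (\int[P]_w ((p (u l w) - Y w) ^+ 2)%:E <= e%:E)%E.
  move=> p_le pB pl2; apply: rl2_complete => [k|e e0]; first exact: pl2.
  have s0 : 0 < Num.sqrt e by rewrite sqrtr_gt0.
  have [k hk] := cau _ s0; exists k => l m kl km.
  have := hk _ _ kl km; rewrite hnorm_le ?sqrtr_ge0// sqr_sqrtr ?(ltW e0)// -lee_fin => h.
  move: h; rewrite -sqmeanE// /sqmean unlock; apply: le_trans.
  apply: ge0_le_integral => //.
  - by move=> w _; rewrite lee_fin sqr_ge0.
  - apply/measurable_EFinP; apply: measurable_funX; apply: measurable_funB.
      by have [] := pl2 _ (Su l).
    by have [] := pl2 _ (Su m).
  - have [[mr mi] _] := SB l m.
    by apply/measurable_EFinP; apply: measurable_funD; exact: measurable_funX.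
  - by move=> w _; rewrite lee_fin -pB; exact: p_le.
have [||Z|Yr [lr hr]] := part (@complex.Re R).
- by move=> z; rewrite lerDl sqr_ge0.
- exact: ReB.
- by move=> /square_integrableP[].
have [||Z|Yi [li hi]] := part (@complex.Im R).
- by move=> z; rewrite lerDr sqr_ge0.
- exact: ImB.
- by move=> /square_integrableP[].
pose Y w := Yr w +i* Yi w.
have SY : cl2 Y by apply/square_integrableP.
exists Y; split=> // e e0.
have e20 : 0 < e ^+ 2 / 2 by rewrite divr_gt0// exprn_gt0.
have [k1 hk1] := hr _ e20; have [k2 hk2] := hi _ e20.
exists (maxn k1 k2) => l; rewrite geq_max => /andP[k1l k2l].
have SuY : cl2 (u l - Y) by apply: (sdB cdot_semidot).
rewrite (hnorm_le _ _ (ltW e0)) -lee_fin -sqmeanE// /sqmean unlock.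
have [[mr mi] _] := SuY.
under eq_integral do rewrite EFinD.
rewrite ge0_integralD//.
- rewrite [e ^+ 2]splitr EFinD; apply: leeD.
    apply: le_trans (hk1 _ k1l); rewrite le_eqVlt; apply/orP; left; apply/eqP/eq_integral => w _.
    by rewrite -[(u l - Y) w]/(u l w - Y w) ReB.
  apply: le_trans (hk2 _ k2l); rewrite le_eqVlt; apply/orP; left; apply/eqP/eq_integral => w _.
  by rewrite -[(u l - Y) w]/(u l w - Y w) ImB.
- by move=> w _; rewrite lee_fin sqr_ge0.
- by apply/measurable_EFinP; exact: measurable_funX.
- by move=> w _; rewrite lee_fin sqr_ge0.
- by apply/measurable_EFinP; exact: measurable_funX.
Qed.

End complex_square_integrable.

Lemma sum_fset_sub {R : nmodType} (I : choiceType) (F F' : {fset I}) (c : I -> R) :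
  (F `<=` F')%fset ->
  \sum_(i <- F') c i = \sum_(i <- F) c i + \sum_(i <- (F' `\` F)%fset) c i.
Proof.
move=> FF'; rewrite -big_cat; apply: perm_big; apply: uniq_perm.
- exact: fset_uniq.
- rewrite cat_uniq !fset_uniq /= andbT; apply/hasPn => i /=.
  by rewrite in_fsetD => /andP[].
- move=> i; rewrite mem_cat in_fsetD; case: (boolP (i \in F)) => //= iF.
  exact: (fsubsetP FF').
Qed.

(** The index [m] ranges over a type depending on [i], so indices are compared as natural numbers,
    next to the comparison of [i] and [i']. *)
Lemma dot_orthogonal_family {R : realType} {E : lmodType R[i]} {dot : E -> E -> R[i]} {S : set E}
    (SD : semidot S dot) (I : eqType) (d : I -> nat) (z : forall i, 'I_(d i) -> E)
    (c : I -> R[i]) (F : seq I) (al be : forall i, 'I_(d i) -> R[i]) :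
  (forall i m, S (z i m)) ->
  (forall i i' (m : 'I_(d i)) (m' : 'I_(d i')),
     dot (z i m) (z i' m') = ((i == i') && (m == m' :> nat))%:R * c i) ->
  uniq F ->
  dot (\sum_(i <- F) \sum_m al i m *: z i m) (\sum_(i <- F) \sum_m be i m *: z i m) =
  \sum_(i <- F) c i * \sum_m al i m * conjc (be i m).
Proof.
move=> Sz oz uF.
have Sa (a : forall i, 'I_(d i) -> R[i]) i m : S (a i m *: z i m) by exact: (sdZ SD).
have Ss (a : forall i, 'I_(d i) -> R[i]) i : S (\sum_m a i m *: z i m) by apply: (sd_sum SD).
rewrite (dot_suml SD)//; last by apply: (sd_sum SD).
rewrite [LHS]big_seq [RHS]big_seq; apply: eq_bigr => i iF.
rewrite (dot_sumr SD)// (bigD1_seq i)//= [X in _ + X]big1 ?addr0 => [|i' i'i].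
  rewrite (dot_suml SD)//; last exact: (Ss be).
  rewrite mulr_sumr; apply: eq_bigr => m _.
  rewrite (dot_sumr SD)// (bigD1 m)//= [X in _ + X]big1 ?addr0 => [|m' m'm].
    by rewrite (dotZl SD)// (dotZr SD)// oz !eqxx mul1r; ring.
  rewrite (dotZl SD)// (dotZr SD)// oz eqxx (inj_eq val_inj) eq_sym (negbTE m'm).
    by rewrite mul0r !mulr0.
rewrite (dot_suml SD)//; last exact: (Ss be).
rewrite big1// => m _; rewrite (dot_sumr SD)// big1// => m' _.
by rewrite (dotZl SD)// (dotZr SD)// oz eq_sym (negbTE i'i) mul0r !mulr0.
Qed.

Definition restrict_urep {R : realType} {n : nat} {G : lieGroupType R n} (S : set G)
  (H : fdHilbert R) (U : urep [set: G] H) : urep S H.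
Proof.
refine (@URep R n G S H U _ _ _ _ _).
- by move=> k a x y _; exact: rep_linear.
- exact: rep1.
- by move=> k l x _ _; exact: repM.
- by move=> k x y _; exact: rep_unitary.
- by move=> x; apply: continuous_subspaceW (@rep_cts _ _ _ _ _ U x).
Defined.

(** * Expansion of an invariant field *)

Section multiplicity.
Context {R : realType} {n : nat} {G : lieGroupType R n} {K : closedSubgroup G}.
Context {H : fdHilbert R} {W : urep K H} {dimW : nat} {e : 'I_dimW -> H}.
Hypothesis massiveK : massive K.
Hypothesis irrW : irreducible K W.

(** The embedding is a nonzero intertwiner, so the multiplicity granted by [massiveK] is 1 and the
    embedding spans all intertwiners. *)
Lemma massive_intertwiner (V : adapted_irrep W e) (h : H -> a_space V) :
  intertwiner K W V h -> exists c, forall x, h x = c *: a_emb V x.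
Proof.
move=> hI; have embI := a_emb_intertwiner V.
case: (irrW) => -[x0 x0n] _.
have emb0 : a_emb V x0 != 0.
  apply: contraNneq (hdot_self_neq0 x0n) => h0.
  by rewrite -(a_emb_isometric V) h0 hdot0l.
have [[f [_ hf]]|[f [_ hf]]] := massiveK (a_irr V) irrW.
  have [c [hc _]] := hf _ embI; move: emb0.
  by rewrite (congr1 (fun F => F x0) hc) big_ord0 eqxx.
have [c [hc _]] := hf _ embI; have [c' [hc' _]] := hf _ hI.
have cE x : a_emb V x = c ord0 *: f ord0 x.
  by rewrite (congr1 (fun F => F x) hc) big_ord1.
have c'E x : h x = c' ord0 *: f ord0 x.
  by rewrite (congr1 (fun F => F x) hc') big_ord1.
have c0 : c ord0 != 0.
  by apply: contraNneq emb0 => z; rewrite cE z scale0r.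
by exists (c' ord0 / c ord0) => x; rewrite c'E cE scalerA divfK.
Qed.

Lemma equivalent_contains (V : adapted_irrep W e) (H' : fdHilbert R) (U : urep [set: G] H') :
  equivalent [set: G] V U -> contains K U W.
Proof.
move=> [f [[fl fI] fi _]]; have [el eI] := a_emb_intertwiner V.
exists (fun x => f (a_emb V x)); split; first split.
- by move=> a x y; rewrite el fl.
- by move=> k x Kk; rewrite eI// fI.
- by move=> x y; rewrite fi; exact: a_emb_isometric.
Qed.

Lemma isometric_embedding_dot (V : adapted_irrep W e) (g : G) (x y : H) :
  hdot (V g (a_emb V x)) (V g (a_emb V y)) = hdot x y.
Proof. by rewrite rep_unitary// a_emb_isometric. Qed.

End multiplicity.

(* f g v stands for the value of the field at the point [g, v] of the bundle. *)
Section equivariant_field.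
Context {R : realType} {n : nat} {G : lieGroupType R n} {K : closedSubgroup G}.
Context {H : fdHilbert R} {W : urep K H} {dimW : nat} {e : 'I_dimW -> H}.
Context {I : choiceType} {V : I -> adapted_irrep W e}.
Context {E : lmodType R[i]} {dot : E -> E -> R[i]} {S : set E}.
Hypothesis Gc : compact [set: G].
Hypothesis massiveK : massive K.
Hypothesis irrW : irreducible K W.
Hypothesis onbe : onb (@hdot R H) e.
Hypothesis dualV : represents_dual V.
Hypothesis SD : semidot S dot.
Hypothesis SC : hcomplete dot S.
Variable f : G -> H -> E.
Hypothesis fS : forall g v, S (f g v).
Hypothesis f_lin : forall g a v v', f g (a *: v + v') = a *: f g v + f g v'.
Hypothesis f_K : forall g k v, sgset K k -> f (g * k)%g v = f g (W k v).
Hypothesis f_inv : forall h g g' v v',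
  dot (f (h * g)%g v) (f (h * g')%g v') = dot (f g v) (f g' v').
Hypothesis f_cont : forall v, hcont dot (fun g => f g v).

Let SH := fd_semidot H.
Local Notation emb i := (a_emb (V i)).
Local Notation eV i := (@a_basis _ _ _ _ _ _ _ _ (V i)).
Local Notation dV i := (a_dim (V i)).

Let cov_ccont v v' : ccont (fun g => dot (f g v) (f 1%g v')).
Proof. by apply: (hcont_dot SD) => //; exact: (hcont_cst SD). Qed.

Let cov g h v v' : dot (f g v) (f h v') = dot (f (h^-1 * g)%g v) (f 1%g v').
Proof. by rewrite -(f_inv h^-1%g) mulVg. Qed.

Definition fourier (HU : fdHilbert R) (U : G -> HU -> HU) v v' a b :=
  mean (fun g => dot (f g v) (f 1%g v') * conjc (hdot (U g a) b)).

Let fourier_ccont (HU : fdHilbert R) (U : urep [set: G] HU) v v' a b :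
  ccont (fun g => dot (f g v) (f 1%g v') * conjc (hdot (U g a) b)).
Proof. by apply: ccont_dot => //; exact: coefficient_joint. Qed.

Lemma fourier_intertwiner (HU : fdHilbert R) (U : urep [set: G] HU) v' b :
  exists h : H -> HU, intertwiner K W U h /\ forall v a, hdot (h v) a = fourier U v v' a b.
Proof.
have c := fourier_ccont U.
have [a z x y|z a x y|h [hl hh]] := @sesquilinear_map R H HU (fun v a => fourier U v v' a b).
- rewrite /fourier -(mean_linear Gc)//; congr mean; apply/funext => g.
  by rewrite f_lin (sd_linear SD)// mulrDl mulrA.
- rewrite /fourier -(mean_linear Gc)//; congr mean; apply/funext => g.
  by rewrite rep_linear// hdotDl hdotZl rmorphD /= conjcM; ring.
exists h; split=> //; split=> // k v Kk; apply: hdot_inj => z.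
rewrite rep_unitaryV// !hh /fourier -[RHS](mean_mulgr Gc k)//; congr mean; apply/funext => g.
by rewrite f_K// -(repM U)// mulgK.
Qed.

Lemma fourier_not_contains (HU : fdHilbert R) (U : urep [set: G] HU) v v' a b :
  irreducible [set: G] U -> ~ contains K U W -> fourier U v v' a b = 0.
Proof.
move=> irr ncont; have [h [hI hh]] := fourier_intertwiner U v' b.
have [h0|hn0] := eqVneq (h v) 0; first by rewrite -hh h0 hdot0l.
exfalso; apply: ncont.
have [_ [g [_ gI gi _]]] :=
  @schur_contains _ _ _ _ (@sgV _ _ _ K) _ _ W (restrict_urep K U) h v irrW hI hn0.
by exists g.
Qed.

(** Hermitian symmetry of the covariance under inversion. It lets an argument about [v] and [a] be
    repeated for [v'] and [b]. *)
Lemma fourier_swap (HU : fdHilbert R) (U : urep [set: G] HU) v v' a b :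
  fourier U v v' a b = conjc (fourier U v' v b a).
Proof.
rewrite /fourier -(mean_conj Gc)// -[LHS](mean_inv Gc)//; congr mean; apply/funext => g.
rewrite -(f_inv g) mulgV mulg1 conjcM conjcK -(sd_conj SD)//; congr (_ * _).
by rewrite rep_unitaryV// invgK -hdot_conj.
Qed.

Variable k0 : 'I_dimW.
Let e0 := e k0.
Let a0 i := a_emb (V i) e0.

(** The spectral constant of [V i]: at the unit vectors [e0] and [a0 i] both inner products in
    [fourierE] equal 1. *)
Definition sigma i : R[i] := fourier (V i) e0 e0 (a0 i) (a0 i).

(** Multiplicity one gives a multiple of [hdot (emb i v) a], with a factor depending on [v'] and
    [b]. By [fourier_swap] the same argument determines this factor up to one constant, which the
    symmetry also shows to be real. *)
Lemma fourierE i v v' a b :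
  fourier (V i) v v' a b = sigma i * hdot (emb i v) a * conjc (hdot (emb i v') b).
Proof.
have e00 : hdot e0 e0 = 1 by rewrite (proj1 onbe) eqxx.
have key w c : exists z, forall v a, fourier (V i) v w a c = z * hdot (emb i v) a.
  have [h [hI hh]] := fourier_intertwiner (V i) w c.
  have [z hz] := massive_intertwiner massiveK irrW hI.
  by exists z => x y; rewrite -hh hz hdotZl.
have [z hz] := key v' b; have [z' hz'] := key e0 (a0 i).
have norm0 : hdot (emb i e0) (a0 i) = 1 by rewrite a_emb_isometric.
have sE : sigma i = z' by rewrite /sigma hz' norm0 mulr1.
have zE : z = conjc z' * conjc (hdot (emb i v') b).
  rewrite -conjcM -hz' -[z]mulr1 -norm0 -hz fourier_swap.
  by [].
have sJ : conjc z' = z'.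
  by rewrite -sE {1}/sigma -fourier_swap.
by rewrite hz zE sJ sE mulrAC.
Qed.

Let dV_gt0 i : (0 < dV i)%N. Proof. exact: leq_ltn_trans (ltn_ord (a_idx (V i) k0)). Qed.

Let dV_neq0 i : (dV i)%:R != 0 :> R[i].
Proof. by rewrite pnatr_eq0 -lt0n. Qed.

Let e0_unit : hdot e0 e0 = 1. Proof. by rewrite (proj1 onbe) eqxx. Qed.

Definition harmonic_component i m g : E :=
  conjc (hdot (V i g (a0 i)) (eV i m)) *: f g e0.

Lemma harmonic_componentS i (m : 'I_(dV i)) g : S (harmonic_component m g).
Proof. exact: (sdZ SD). Qed.

Lemma harmonic_component_cont i (m : 'I_(dV i)) : hcont dot (harmonic_component m).
Proof. by apply: (hcontZ SD) => //; apply: ccontJ; exact: coefficient_joint. Qed.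

Variable y : forall i, 'I_(dV i) -> E.
Hypothesis yS : forall i (m : 'I_(dV i)), S (y m).
Hypothesis y_mean : forall i (m : 'I_(dV i)), is_mean (dot := dot) (harmonic_component m) (y m).

(** By invariance the covariance of [f h v] and [f g e0] depends on [g^-1 * h] only; replacing [g]
    by [h * g^-1] under the mean leaves a Fourier coefficient. *)
Lemma dot_f_y h v i (m : 'I_(dV i)) : dot (f h v) (y m) = sigma i * hdot (V i h (emb i v)) (eV i m).
Proof.
rewrite (sd_conj SD)// (is_mean_dot Gc SD (harmonic_componentS m) (@harmonic_component_cont _ m)
  (yS m) (fS h v) (y_mean m)).
have cc : ccont (fun g => dot (harmonic_component m g) (f h v)).
  apply: (hcont_dot SD) => //; first by move=> t; exact: harmonic_componentS.
  - exact: harmonic_component_cont.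
  - exact: (hcont_cst SD).
pose c g := hdot (V i g (a0 i)) (eV i m).
have E1 : (fun g => conjc (dot (harmonic_component m g) (f h v))) =
          fun g => c g * dot (f (g^-1 * h)%g v) (f 1%g e0).
  apply/funext => g; rewrite /harmonic_component (dotZl SD)// conjcM conjcK.
  by rewrite -(sd_conj SD)// cov.
rewrite -(mean_conj Gc)// E1.
have := ccontJ cc; rewrite E1 => cE1.
rewrite -(mean_mulgl Gc h)// -(mean_inv Gc); last exact: (ccont_mulgl h cE1).
transitivity (fourier (V i) v e0 (V i h^-1%g (eV i m)) (a0 i)).
  congr mean; apply/funext => g; rewrite invgM invgK mulgVK mulrC; congr (_ * _).
  rewrite /c (@rep_unitaryV _ _ _ _ _ _ (V i) (h * g^-1)%g)// invgM invgK (repM (V i))//.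
  by rewrite -hdot_conj.
by rewrite fourierE a_emb_isometric e0_unit conjc1 mulr1 -rep_unitaryV.
Qed.

(** One factor is expanded as a mean and paired with the other by [dot_f_y]; what remains is a mean
    of two matrix coefficients, evaluated by Schur orthogonality. *)
Lemma dot_y_y i i' (m : 'I_(dV i)) (m' : 'I_(dV i')) : dot (y m) (y m') =
  ((i == i') && (m == m' :> nat))%:R * (sigma i / (dV i)%:R).
Proof.
rewrite (is_mean_dot Gc SD (harmonic_componentS m) (@harmonic_component_cont _ m)
  (yS m) (yS m') (y_mean m)).
have -> : (fun g => dot (harmonic_component m g) (y m')) =
   fun g => sigma i' * (hdot (V i' g (a0 i')) (eV i' m') * conjc (hdot (V i g (a0 i)) (eV i m))).
  by apply/funext => g; rewrite /harmonic_component (dotZl SD)// dot_f_y; ring.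
rewrite (meanZ Gc); last exact: coefficient_dot_ccont.
have [ii'|ii'] := eqVneq i i'; last first.
  rewrite (schur_orthogonality_neq Gc (a_irr (V i')) (a_irr (V i))) ?mulr0 ?mul0r//.
  by move=> /(proj1 dualV) h; rewrite h eqxx in ii'.
subst i'; rewrite (schur_orthogonality Gc (a_irr (V i)) (a_onb (V i))).
rewrite a_emb_isometric e0_unit (proj1 (a_onb (V i))) mul1r -(inj_eq val_inj) eq_sym /=.
by rewrite conjc_nat; ring.
Qed.

Lemma sigma_ge0 i : 0 <= sigma i.
Proof.
have := sd_ge0 SD (yS (a_idx (V i) k0)); rewrite dot_y_y !eqxx mul1r.
by rewrite pmulr_lge0// invr_gt0 ltr0n.
Qed.

(** The contribution of [V i] to the variance of the field at a unit vector, as [residual] shows. *)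
Definition weight i : R := complex.Re (sigma i) * (dV i)%:R.

Lemma weight_ge0 i : 0 <= weight i.
Proof. by rewrite mulr_ge0// Re_ge0 ?sigma_ge0. Qed.

Lemma weightE i : (weight i)%:C = sigma i * (dV i)%:R.
Proof. by rewrite /weight rmorphM /= rmorph_nat -ge0_complex// sigma_ge0. Qed.

(** The coefficient of [y m] is the projection coefficient [dot (f g v) (y m) / dot (y m) (y m)]. In
    the quotient [sigma i] cancels, so the formula also makes sense when [sigma i] is 0. *)
Definition partial_field (F : seq I) g v : E :=
  \sum_(i <- F) \sum_m ((dV i)%:R * hdot (V i g (emb i v)) (eV i m)) *: y m.

Lemma partial_fieldS F g v : S (partial_field F g v).
Proof. by apply: (sd_sum SD) => i; apply: (sd_sum SD) => m; exact: (sdZ SD). Qed.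

(** Pythagoras: the cross term and the square of the partial sum agree, and unitarity of [V i]
    removes [g] from both. *)
Lemma residual F g v : uniq F ->
  sqn dot (f g v - partial_field F g v) =
  sqn dot (f 1%g v) - (\sum_(i <- F) weight i) * sqn (@hdot R H) v.
Proof.
move=> uF; have ST := partial_fieldS F g v.
have hv : hdot v v = (sqn (@hdot R H) v)%:C by rewrite (dot_sqn SH).
have pv i : \sum_m hdot (V i g (emb i v)) (eV i m) * conjc (hdot (V i g (emb i v)) (eV i m)) =
    hdot v v.
  by rewrite -(onb_parseval _ _ (a_onb (V i))) isometric_embedding_dot.
have fT : dot (f g v) (partial_field F g v) =
    ((\sum_(i <- F) weight i) * sqn (@hdot R H) v)%:C.
  rewrite /partial_field (dot_sumr SD)//; last first.
    by move=> i; apply: (sd_sum SD) => m; exact: (sdZ SD).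
  rewrite rmorphM /= rmorph_sum mulr_suml -hv; apply: eq_bigr => i _ /=.
  rewrite (dot_sumr SD)//; last by move=> m; exact: (sdZ SD).
  rewrite weightE -(pv i) mulr_sumr; apply: eq_bigr => m _.
  by rewrite (dotZr SD)// dot_f_y conjcM conjc_nat; ring.
have TT : dot (partial_field F g v) (partial_field F g v) =
    ((\sum_(i <- F) weight i) * sqn (@hdot R H) v)%:C.
  rewrite /partial_field (dot_orthogonal_family SD _ _ yS dot_y_y uF).
  rewrite rmorphM /= rmorph_sum mulr_suml -hv; apply: eq_bigr => i _ /=.
  rewrite weightE -(pv i) !mulr_sumr; apply: eq_bigr => m _.
  by rewrite !conjcM conjc_nat; field.
have sT : sqn dot (partial_field F g v) = (\sum_(i <- F) weight i) * sqn (@hdot R H) v.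
  by rewrite /sqn TT.
rewrite (sqnB SD)// fT sT [complex.Re _]/=.
have -> : sqn dot (f g v) = sqn dot (f 1%g v).
  by rewrite /sqn -(f_inv g^-1%g) mulVg.
by ring.
Qed.

Lemma weight_bound (F : seq I) v : uniq F ->
  (\sum_(i <- F) weight i) * sqn (@hdot R H) v <= sqn dot (f 1%g v).
Proof.
move=> uF; rewrite -subr_ge0 -(residual 1%g v uF); apply: (sqn_ge0 SD).
by apply: (sdB SD) => //; exact: partial_fieldS.
Qed.

(** The covariance function of the remainder, written out; its value at 1 is the squared norm of the
    remainder ([res1]). *)
Let res (F : seq I) v g : R[i] := dot (f g v) (f 1%g v) -
  \sum_(i <- F) (weight i)%:C * hdot (V i g (emb i v)) (emb i v).

Let res_ccont F v : ccont (res F v).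
Proof.
apply: ccontB => //; apply: ccont_sum => i; apply: ccontZ; exact: coefficient_joint.
Qed.

Let res1 F v : uniq F -> res F v 1%g = (sqn dot (f 1%g v - partial_field F 1%g v))%:C.
Proof.
move=> uF; rewrite residual// rmorphB /= -(dot_sqn SD)//; congr (_ - _).
rewrite rmorphM /= rmorph_sum mulr_suml; apply: eq_bigr => i _.
by rewrite rep1 a_emb_isometric (dot_sqn SH).
Qed.

Let mean_res F v (HU : fdHilbert R) (U : urep [set: G] HU) a b :
  mean (fun g => res F v g * conjc (hdot (U g a) b)) = fourier U v v a b -
  \sum_(i <- F) (weight i)%:C *
    mean (fun g => hdot (V i g (emb i v)) (emb i v) * conjc (hdot (U g a) b)).
Proof.
have cS i := coefficient_dot_ccont (V i) U (emb i v) (emb i v) a b.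
transitivity (mean (fun g => dot (f g v) (f 1%g v) * conjc (hdot (U g a) b) -
   \sum_(i <- F) (weight i)%:C * (hdot (V i g (emb i v)) (emb i v) * conjc (hdot (U g a) b)))).
  congr mean; apply/funext => g; rewrite /res mulrBl mulr_suml; congr (_ - _).
  by apply: eq_bigr => i _; rewrite mulrA.
rewrite (meanB Gc)//; last by apply: ccont_sum => i; exact: ccontZ.
congr (_ - _); rewrite (mean_sum Gc _ (F := fun i g => (weight i)%:C *
  (hdot (V i g (emb i v)) (emb i v) * conjc (hdot (U g a) b)))); last by move=> i; exact: ccontZ.
by apply: eq_bigr => i _; rewrite (meanZ Gc).
Qed.

(** By Schur orthogonality a subtracted term cancels the coefficient of its own class and leaves the
    others as they were. *)
Let fourier_res F v i a b : uniq F ->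
  mean (fun g => res F v g * conjc (hdot (V i g a) b)) =
  (i \notin F)%:R * (sigma i * hdot (emb i v) a * conjc (hdot (emb i v) b)).
Proof.
move=> uF; rewrite mean_res fourierE.
have zero j : j != i -> mean (fun g => hdot (V j g (emb j v)) (emb j v) * conjc (hdot (V i g a) b)) = 0.
  move=> ji; apply: (schur_orthogonality_neq Gc (a_irr (V j)) (a_irr (V i))).
  by move=> /(proj1 dualV) h; rewrite h eqxx in ji.
have [iF|iF] := boolP (i \in F); last first.
  rewrite big_seq big1 ?subr0 ?mul1r// => j jF; rewrite zero ?mulr0//.
  by apply: contraNneq iF => <-.
rewrite (bigD1_seq i)//= big1 ?addr0 => [|j ji]; last by rewrite zero ?mulr0.
rewrite (schur_orthogonality Gc (a_irr (V i)) (a_onb (V i))) weightE mul0r.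
by rewrite -[X in _ - X]mulrA; apply/eqP; rewrite subr_eq0; apply/eqP; field.
Qed.

Let total : R := sup [set r | exists F : {fset I}, r = \sum_(i <- F) weight i].

Let weight_le1 (F : {fset I}) : \sum_(i <- F) weight i <= sqn dot (f 1%g e0).
Proof.
have := weight_bound e0 (fset_uniq F); rewrite [X in _ * X](_ : _ = 1) ?mulr1//.
by rewrite /sqn e0_unit.
Qed.

Let total_has_sup : has_sup [set r | exists F : {fset I}, r = \sum_(i <- F) weight i].
Proof.
split; first by exists (\sum_(i <- (fset0 : {fset I})) weight i); exists fset0.
by exists (sqn dot (f 1%g e0)) => _ [F ->].
Qed.

Let le_total (F : {fset I}) : \sum_(i <- F) weight i <= total.
Proof. by apply: ub_le_sup; [case: total_has_sup|exists F]. Qed.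

Let weight_tail (F F' : {fset I}) :
  \sum_(i <- (F' `\` F)%fset) weight i <= total - \sum_(i <- F) weight i.
Proof.
rewrite lerBrDl; have -> : (F' `\` F = (F `|` F') `\` F)%fset.
  by apply/fsetP => i; rewrite !inE; case: (i \in F).
by rewrite -sum_fset_sub ?le_total// fsubsetUl.
Qed.

Let res_dist (F F' : {fset I}) v g : (F `<=` F')%fset ->
  Normc.normc (res F v g - res F' v g) <= (total - \sum_(i <- F) weight i) * sqn (@hdot R H) v.
Proof.
move=> FF'; have -> : res F v g - res F' v g = \sum_(i <- (F' `\` F)%fset)
    (weight i)%:C * hdot (V i g (emb i v)) (emb i v).
  by rewrite /res (sum_fset_sub _ FF'); ring.
apply: le_trans (ler_normc_sum _ _) _.
apply: (@le_trans _ _ (\sum_(i <- (F' `\` F)%fset) weight i * sqn (@hdot R H) v)).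
  apply: ler_sum => i _; rewrite Normc.normcM normc_real ger0_norm ?weight_ge0//.
  rewrite ler_wpM2l ?weight_ge0//.
  apply: le_trans (cauchy_schwarz (fd_semidot _) Logic.I Logic.I) _.
  rewrite /hnorm /sqn isometric_embedding_dot a_emb_isometric -expr2 sqr_sqrtr//.
  exact: (sqn_ge0 SH).
by rewrite -mulr_suml ler_wpM2r ?(sqn_ge0 SH)// weight_tail.
Qed.

(** The index set may be uncountable, so a sequence of finite sets [Fk] is chosen that exhausts the
    total weight. A class that all of them miss has weight 0, so every Fourier coefficient of the
    limit still vanishes. *)
Theorem residual_small g v (eps : R) : 0 < eps -> exists F0 : {fset I},
  forall F : {fset I}, (F0 `<=` F)%fset -> sqn dot (f g v - partial_field F g v) <= eps.
Proof.
move=> eps0.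
have pos k : 0 < k.+1%:R^-1 :> R by rewrite invr_gt0 ltr0n.
have ex k : exists F : {fset I}, total - \sum_(i <- F) weight i <= k.+1%:R^-1.
  have [_ [F ->] h] := sup_adherent (pos k) total_has_sup.
  by exists F; rewrite lerBlDl -lerBlDr ltW.
have [Fk hFk] := choice ex.
pose N := sqn (@hdot R H) v; have N0 : 0 <= N by exact: (sqn_ge0 SH).
have small (d : R) : 0 < d -> exists k, forall l, (k <= l)%N -> l.+1%:R^-1 <= d.
  move=> d0; exists (Num.truncn d^-1) => l kl.
  rewrite -[d]invrK lef_pV2 ?posrE ?invr_gt0 ?ltr0n//; apply: ltW.
  by apply: lt_le_trans (truncnS_gt _) _; rewrite ler_nat ltnS.
have small' (d C : R) : 0 < d -> 0 <= C -> exists k, forall l, (k <= l)%N -> l.+1%:R^-1 * C <= d.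
  move=> d0 C0; have C1 : 0 < C + 1 by lra.
  have [k hk] := small _ (divr_gt0 d0 C1); exists k => l /hk h.
  apply: le_trans (ler_wpM2r C0 h) _.
  by rewrite mulrAC ler_pdivrMr// ler_wpM2l ?ltW// ltrDl.
have [|rho hrho] := @uniform_cauchy_limit R G (fun k => res (Fk k) v).
  move=> d d0; have [k hk] := small' _ N (divr_gt0 d0 (ltr0n _ 2)) N0.
  exists k => l m kl km x.
  have d1 := @res_dist (Fk l) (Fk l `|` Fk m)%fset v x (fsubsetUl _ _).
  have d2 := @res_dist (Fk m) (Fk l `|` Fk m)%fset v x (fsubsetUr _ _).
  have e1 := le_trans d1 (ler_wpM2r N0 (hFk l)).
  have e2 := le_trans d2 (ler_wpM2r N0 (hFk m)).
  rewrite -(subrK (res (Fk l `|` Fk m)%fset v x) (res (Fk l) v x)) -addrA.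
  apply: le_trans (ler_normcD _ _) _; rewrite [d]splitr lerD//.
    by apply: le_trans e1 _; exact: hk.
  by rewrite normcBC; apply: le_trans e2 _; exact: hk.
have crho : ccont rho.
  apply: (ccont_uniform (F := fun k => res (Fk k) v)) => // d /hrho[k hk].
  by exists k => x; exact: hk.
(* Uniform convergence lets a bound of order [1 / (k + 1)] on the coefficients of the approximants
   force those of the limit to be 0. *)
have bound_lim (HU : fdHilbert R) (U : urep [set: G] HU) a b (C : R) : 0 <= C ->
    (forall k, Normc.normc (mean (fun g => res (Fk k) v g * conjc (hdot (U g a) b))) <= k.+1%:R^-1 * C) ->
    mean (fun g => rho g * conjc (hdot (U g a) b)) = 0.
  move=> C0 hC; apply: normc_small => d d0.
  pose M := hnorm (@hdot R HU) a * hnorm (@hdot R HU) b.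
  have M0 : 0 <= M by rewrite mulr_ge0 ?hnorm_ge0.
  have M1 : 0 < 2 * (M + 1) by rewrite mulr_gt0// ltr_wpDl.
  have [k1 hk1] := small' _ _ (divr_gt0 d0 (ltr0n _ 2)) C0.
  have [k2 hk2] := hrho _ (divr_gt0 d0 M1).
  pose k := maxn k1 k2.
  have cU := coefficient_joint U a b.
  have -> : mean (fun g => rho g * conjc (hdot (U g a) b)) =
      mean (fun g => res (Fk k) v g * conjc (hdot (U g a) b)) -
      mean (fun g => (res (Fk k) v g - rho g) * conjc (hdot (U g a) b)).
    rewrite -(meanB Gc); [|exact: ccont_dot|by apply: ccont_dot => //; exact: ccontB].
    by congr mean; apply/funext => x; ring.
  apply: le_trans (ler_normcD _ _) _; rewrite normcN [d]splitr lerD//.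
    by apply: le_trans (hC k) _; apply: hk1; exact: leq_maxl.
  apply: (normc_mean_le Gc); first by apply: ccont_dot => //; exact: ccontB.
  move=> x; rewrite Normc.normcM normcJ.
  have h1 : Normc.normc (hdot (U x a) b) <= M.
    apply: le_trans (cauchy_schwarz (fd_semidot _) Logic.I Logic.I) _.
    by rewrite {1}/hnorm /sqn rep_unitary.
  apply: le_trans (ler_pM (normc_ge0 _) (normc_ge0 _) (hk2 k (leq_maxr _ _) x) h1) _.
  have Mp : 0 < M + 1 by rewrite ltr_wpDl.
  have -> : d / (2 * (M + 1)) * M = (d / 2) * (M / (M + 1)) by field; rewrite gt_eqF.
  by rewrite ler_piMr ?divr_ge0 ?(ltW d0)// ler_pdivrMr// mul1r lerDl.
have rho0 : rho = 0.
  apply: (peter_weyl Gc crho) => HU U irrU a b.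
  have [cont|ncont] := pselect (contains K U W); last first.
    apply: (bound_lim _ _ _ _ 0) => // k; rewrite mulr0 mean_res fourier_not_contains//.
    rewrite big1 ?subrr ?Normc.normc0// => i _.
    rewrite (schur_orthogonality_neq Gc (a_irr (V i)) irrU) ?mulr0//.
    by move=> /equivalent_contains.
  have [i [phi [[phil phiI] phii _]]] := (proj2 dualV) HU U irrU cont.
  (* The equivalence [phi] turns coefficients of [U] into coefficients of the chosen
     representative. *)
  have -> : (fun g => rho g * conjc (hdot (U g a) b)) =
            fun g => rho g * conjc (hdot (V i g (phi a)) (phi b)).
    by apply/funext => x; rewrite -phiI// phii.
  pose h := hdot (emb i v) (phi a) * conjc (hdot (emb i v) (phi b)).
  apply: (bound_lim _ _ _ _ (Normc.normc h)) => [|k]; first exact: normc_ge0.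
  rewrite fourier_res; last exact: fset_uniq.
  (* A class outside [Fk k] has weight at most [1 / (k + 1)], and its [sigma] is at most its weight
     because the dimension is at least 1. *)
  have [iF|iF] := boolP (i \in Fk k).
    by rewrite mul0r Normc.normc0 mulr_ge0 ?normc_ge0// ltW.
  rewrite mul1r -mulrA Normc.normcM ler_wpM2r ?normc_ge0//.
  rewrite (ge0_complex (sigma_ge0 i)) normc_real ger0_norm ?Re_ge0 ?sigma_ge0//.
  apply: (@le_trans _ _ (weight i)).
    by rewrite /weight ler_peMr ?Re_ge0 ?sigma_ge0// ler1n.
  apply: le_trans (hFk k); apply: le_trans (weight_tail (Fk k) [fset i]%fset).
  have -> : ([fset i] `\` Fk k = [fset i])%fset.
    by apply/fsetP => j; rewrite !inE; case: eqP => [->|]; rewrite ?iF ?andbF.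
  by rewrite big_seq_fset1.
have [k hk] := hrho _ eps0.
exists (Fk k) => F FF; have := hk k (leqnn _) 1%g.
rewrite rho0 -[(0 : G -> R[i]) _]/(0 : R[i]) subr0 res1 ?fset_uniq// normc_real.
rewrite ger0_norm; last first.
  by apply: (sqn_ge0 SD); apply: (sdB SD) => //; exact: partial_fieldS.
(* Enlarging the finite set only decreases the remainder, the weights being nonnegative. *)
apply: le_trans; rewrite !residual ?fset_uniq// lerD2l lerN2 ler_wpM2r//.
by rewrite (sum_fset_sub _ FF) lerDl sumr_ge0// => i _; exact: weight_ge0.
Qed.
End equivariant_field.

Theorem equivariant_expansion {R : realType} {n : nat} {G : lieGroupType R n}
    {K : closedSubgroup G} {H : fdHilbert R} {W : urep K H} {dimW : nat} {e : 'I_dimW -> H}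
    {I : choiceType} {V : I -> adapted_irrep W e}
    {E : lmodType R[i]} {dot : E -> E -> R[i]} {S : set E} (f : G -> H -> E) (k0 : 'I_dimW) :
  compact [set: G] -> massive K -> irreducible K W -> onb (@hdot R H) e ->
  represents_dual V -> semidot S dot -> hcomplete dot S ->
  (forall g v, S (f g v)) ->
  (forall g a v v', f g (a *: v + v') = a *: f g v + f g v') ->
  (forall g k v, sgset K k -> f (g * k)%g v = f g (W k v)) ->
  (forall h g g' v v', dot (f (h * g)%g v) (f (h * g')%g v') = dot (f g v) (f g' v')) ->
  (forall v, hcont dot (fun g => f g v)) ->
  exists (om : I -> R) (y : forall i, 'I_(a_dim (V i)) -> E), [/\
    forall i m, S (y i m) /\ is_mean (dot := dot) (harmonic_component f k0 m) (y i m),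
    forall i, 0 <= om i,
    exists B, forall F : {fset I}, \sum_(i <- F) om i <= B,
    forall i i' (m : 'I_(a_dim (V i))) (m' : 'I_(a_dim (V i'))), dot (y i m) (y i' m') =
      ((i == i') && (m == m' :> nat))%:R * (om i)%:C / (a_dim (V i))%:R ^+ 2 &
    forall g v (eps : R), 0 < eps -> exists F0 : {fset I}, forall F : {fset I}, (F0 `<=` F)%fset ->
      sqn dot (f g v - partial_field y F g v) <= eps].
Proof.
move=> Gc mK irrW onbe dualV SD SC fS f_lin f_K f_inv f_cont.
(* Dependent pairs allow all vectors [y] to be chosen at once. *)
have ex (p : {i : I & 'I_(a_dim (V i))}) : exists y, S y /\
    is_mean (dot := dot) (harmonic_component f k0 (projT2 p)) y.
  apply: (is_mean_exists Gc SD SC).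
    by move=> g; exact: (harmonic_componentS SD fS).
  exact: (harmonic_component_cont SD fS f_cont).
have [y0 hy0] := choice ex.
pose y i (m : 'I_(a_dim (V i))) := y0 (existT _ i m).
have yS i m : S (y i m) by have [] := hy0 (existT _ i m).
have ym i m : is_mean (dot := dot) (harmonic_component f k0 m) (y i m).
  by have [] := hy0 (existT _ i m).
have dn0 i : (a_dim (V i))%:R != 0 :> R[i].
  by rewrite pnatr_eq0 -lt0n; exact: leq_ltn_trans (ltn_ord (a_idx (V i) k0)).
exists (weight (V := V) (dot := dot) f k0), y; split=> //.
- by move=> i; exact: (weight_ge0 Gc mK irrW onbe dualV SD fS f_lin f_K f_inv f_cont yS ym).
- exists (sqn dot (f 1%g (e k0))) => F.
  have := weight_bound Gc mK irrW onbe dualV SD fS f_lin f_K f_inv f_cont yS ym (e k0) (fset_uniq F).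
  by rewrite [X in _ * X](_ : _ = 1) ?mulr1// /sqn (proj1 onbe) eqxx.
- move=> i i' m m'.
  rewrite (dot_y_y Gc mK irrW onbe dualV SD fS f_lin f_K f_inv f_cont yS ym).
  rewrite (weightE Gc mK irrW onbe dualV SD fS f_lin f_K f_inv f_cont yS ym).
  by field.
- move=> g v eps eps0.
  exact: (residual_small Gc mK irrW onbe dualV SD fS f_lin f_K f_inv f_cont yS ym).
Qed.

Section nontrivial_coefficients.
Context {R : realType} {n : nat} {G : lieGroupType R n} {K : closedSubgroup G}.
Context {H : fdHilbert R} {W : urep K H} {dimW : nat} {e : 'I_dimW -> H}.
Hypothesis Gc : compact [set: G].

(** The mean defines a linear map whose values are fixed by [V]. A nonzero fixed vector spans an
    invariant line, which by irreducibility is the whole space, and then [V] is trivial. *)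
Lemma mean_coefficient (V : adapted_irrep W e) a b : ~ is_trivial V ->
  mean (fun g => hdot (V g a) b) = 0.
Proof.
move=> nontriv; have cc := coefficient_joint V.
have [c z x y|c z x y|f [fl hf]] :=
    @sesquilinear_map R _ _ (fun a b => mean (fun g => hdot (V g a) b)).
- rewrite -(mean_linear Gc)//; congr mean; apply/funext => g.
  by rewrite rep_linear// hdotDl hdotZl.
- rewrite -(mean_linear Gc)//; congr mean; apply/funext => g.
  by rewrite hdotDr hdotZr.
rewrite -hf; have [->|fn0] := eqVneq (f a) 0; first by rewrite hdot0l.
exfalso; apply: nontriv; pose x := f a.
have Vx h : V h x = x.
  apply: hdot_inj => z; rewrite rep_unitaryV// !hf.
  rewrite -[RHS](mean_mulgl Gc h)//; congr mean; apply/funext => g.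
  by rewrite (repM V)// [RHS]rep_unitaryV.
have lV (g : G) : lin_map (V g) by move=> c y z; exact: rep_linear.
have [||E0|ET] := (proj2 (a_irr V)) [set y | exists c, y = c *: x].
- split; first by exists 0; rewrite scale0r.
  by move=> c _ _ [c1 ->] [c2 ->]; exists (c * c1 + c2); rewrite scalerDl scalerA.
- by move=> g _ _ [c ->]; exists c; rewrite (lin_mapZ _ _ (lV g)) Vx.
- have : [set y | exists c, y = c *: x] x by exists 1; rewrite scale1r.
  by rewrite E0 /= => x0; move: fn0; rewrite -/x x0 eqxx.
have span y : exists c, y = c *: x by have : [set y | exists c, y = c *: x] y by rewrite ET.
split; last by move=> g y; have [c ->] := span y; rewrite (lin_mapZ _ _ (lV g)) Vx.
have SDV := fd_semidot (a_space V).
have hx : hnorm (@hdot R (a_space V)) x != 0.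
  apply: contraNneq (hdot_self_neq0 fn0) => h0.
  by rewrite (dot_sqn SDV)// -(sqr_hnorm SDV)// h0 expr0n.
pose u (_ : 'I_1) := (hnorm (@hdot R (a_space V)) x)^-1%:C *: x.
have ou : orthonormal (@hdot R (a_space V)) u.
  move=> i j; rewrite (ord1 i) (ord1 j) eqxx /u hdotZl hdotZr conjc_real (dot_sqn SDV)//.
  rewrite -(sqr_hnorm SDV)// -!rmorphM /=; move: hx; move: (hnorm _ _) => r r0.
  by transitivity (1%:C : R[i]) => //; congr (_%:C); field.
have hu y : [set: a_space V] y -> y = \sum_i hdot y (u i) *: u i.
  move=> _; rewrite big_ord1; have [c ->] := span y.
  rewrite -[c *: x](_ : (c * (hnorm (@hdot R (a_space V)) x)%:C) *: u ord0 = _); last first.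
    by rewrite /u scalerA -mulrA -rmorphM /= mulfV// mulr1.
  by rewrite hdotZl ou eqxx mulr1.
have le1 := orthonormal_size SDV (e := u) (f := @a_basis _ _ _ _ _ _ _ _ V)
  (fun=> Logic.I) ou hu (fun=> Logic.I) (proj1 (a_onb V)).
apply/eqP; rewrite eqn_leq le1 lt0n; apply: contraNneq fn0 => d0.
rewrite -/x (proj2 (a_onb V) x) big1// => i.
by have := ltn_ord i; move: (nat_of_ord i) => j; rewrite d0.
Qed.

End nontrivial_coefficients.

Section conjugate_random_variables.
Context {R : realType} d (Omega : measurableType d) (P : probability Omega R).
Implicit Types Z : Omega -> R[i].

Lemma cl2J Z : cl2 P Z -> cl2 P (fun w => conjc (Z w)).
Proof.
move=> /square_integrableP[zr zi]; apply/square_integrableP; split.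
  by under eq_fun do rewrite ReJ.
rewrite (_ : (fun w => _) = fun w => -1 * complex.Im (Z w)); first exact: rl2Z.
by apply/funext => w; rewrite ImJ mulN1r.
Qed.

Lemma sqmeanJ Z : sqmean P (fun w => conjc (Z w)) = sqmean P Z.
Proof.
rewrite /sqmean; congr expectation; apply/funext => w.
by rewrite ReJ ImJ sqrrN.
Qed.

Lemma sqmean_lt (T : Type) (F : set_system T) (FF : Filter F) (u : T -> \bar R) :
  u @ F --> 0%E -> forall eps : R, 0 < eps -> \forall q \near F, (u q < eps%:E)%E.
Proof. 
move=> h eps e0; apply: (h [set x | (x < eps%:E)%E]).
by apply: open_ereal_lt'; rewrite lte_fin. Qed.

Lemma cvg_sqmean (T : Type) (F : set_system T) (FF : Filter F) (u : T -> \bar R) :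
  (forall q, 0 <= u q)%E ->
  (forall eps : R, 0 < eps -> \forall q \near F, (u q < eps%:E)%E) -> u @ F --> 0%E.
Proof.
move=> u0 h; apply/fine_cvgP; split.
  near=> q; rewrite ge0_fin_numE//; apply: lt_trans (ltry 1); near: q; exact: h.
apply/cvgrPdist_lt => eps e0; near=> q.
have hq : (u q < eps%:E)%E by near: q; exact: h.
rewrite sub0r normrN /= ger0_norm ?fine_ge0// -lte_fin fineK// ge0_fin_numE//.
exact: lt_trans hq (ltry _).
Unshelve. all: by end_near. Qed.

Lemma sqmean_ge0 Z : (0 <= sqmean P Z)%E.
Proof.
by rewrite /sqmean unlock; apply: integral_ge0 => w _; rewrite lee_fin addr_ge0// sqr_ge0.
Qed.

End conjugate_random_variables.

(** * From fields on the bundle to functions on the group *)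

Section bundle_fields.
Context {R : realType} {n : nat} {G : lieGroupType R n} {K : closedSubgroup G}.
Context {H : fdHilbert R} {W : urep K H} d {Omega : measurableType d}.
Variable X : random_field W Omega.

Definition fieldv (g : G) (v : H) : Omega -> R[i] := scalar_field X (bcls W g v).

Lemma fieldvE g v w : fieldv g v w = hdot v (bcoord g (X (coset K g) w)).
Proof.
rewrite /fieldv /scalar_field bproj_cls.
by rewrite -{1}(bcoordK (rf_fibre X (coset K g) w)) fib_dot_cls.
Qed.

Lemma fieldv_repr p : fieldv (repr p).1 (repr p).2 = scalar_field X p.
Proof. by rewrite /fieldv bcls_repr. Qed.

Lemma fieldv_linear g a v v' : fieldv g (a *: v + v') = a *: fieldv g v + fieldv g v'.
Proof.
apply/funext => w; rewrite -[RHS]/(a * fieldv g v w + fieldv g v' w) !fieldvE.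
by rewrite hdotDl hdotZl.
Qed.

Lemma fieldv_K g k v : sgset K k -> fieldv (g * k)%g v = fieldv g (W k v).
Proof.
move=> Kk; rewrite /fieldv; congr scalar_field; apply/esym/bcls_eq; exists k; split=> //.
by rewrite -(repM W)//; [rewrite mulVg rep1|exact: sgV].
Qed.

Lemma bcls_continuous : continuous (fun x : G * H => bcls W x.1 x.2).
Proof.
rewrite (_ : (fun x : G * H => bcls W x.1 x.2) = \pi_(bundle W)%qT); last first.
  by apply/funext => -[g v].
exact: pi_continuous.
Qed.

End bundle_fields.

Lemma fct_scale_sum {R : realType} {T I : Type} (r : seq I) (a : I -> R[i]) (y : I -> T -> R[i]) w :
  (\sum_(i <- r) a i *: y i) w = \sum_(i <- r) a i * y i w.
Proof. by elim: r => [|i r ih]; rewrite ?big_nil// !big_cons -ih. Qed.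

Lemma esum_lty {R : realType} {I : choiceType} (u : I -> R) (B : R) :
  (forall F : {fset I}, \sum_(i <- F) u i <= B) -> (\esum_(i in [set: I]) (u i)%:E < +oo)%E.
Proof.
move=> hB; apply: (@le_lt_trans _ _ B%:E); last exact: ltry.
apply: ub_ereal_sup => _ [A [finA _] <-].
by rewrite fsbig_finite//= sumEFin lee_fin.
Qed.

Lemma esum_bound {R : realType} {I : choiceType} (u : I -> R) :
  (forall i, 0 <= u i) -> (\esum_(i in [set: I]) (u i)%:E < +oo)%E ->
  exists B, forall F : {fset I}, \sum_(i <- F) u i <= B.
Proof.
move=> u0 h; exists (fine (\esum_(i in [set: I]) (u i)%:E)) => F.
rewrite -lee_fin fineK; last first.
  by rewrite ge0_fin_numE//; apply: esum_ge0 => i _; rewrite lee_fin.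
apply: esum_ge; exists [set` F]; first by split.
by rewrite fsbig_finite//= set_fsetK sumEFin.
Qed.

Section invariant_field_expansion.
Context {R : realType} {q r : nat} {G : lieGroupType R (q + r)} {K : closedSubgroup G}.
Context {H : fdHilbert R} {W : urep K H} {dimW : nat} {e : 'I_dimW -> H}.
Context (J : adapted_chart K) {I : choiceType} {V : I -> adapted_irrep W e}.
Context d {Omega : measurableType d} (P : probability Omega R) (X : random_field W Omega).
Hypothesis Gc : compact [set: G].
Hypothesis massiveK : massive K.
Hypothesis irrW : irreducible K W.
Hypothesis onbe : onb (@hdot R H) e.
Hypothesis dualV : represents_dual V.
Local Notation f := (fieldv X).

Lemma index_exists : exists k : 'I_dimW, True.
Proof.
case: irrW => -[x x0] _; case: dimW e onbe => [|D] e' [_ he]; last by exists ord0.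
by move: x0; rewrite (he x) big_ord0 eqxx.
Qed.

(** Coordinates have the field in the first argument of the inner product, the scalar field has it
    in the second; this is the source of all conjugations of amplitudes. *)
Lemma field_coordE t j w : ac_dom J t ->
  field_coord e J X j t w = conjc (f (ac_sec J t) (e j) w).
Proof.
by move=> [g Dg <-]; rewrite fieldvE ac_sec_coset// -hdot_conj.
Qed.

Lemma basis_funE i (m : 'I_(a_dim (V i))) j t : basis_fun J m j t =
  (Num.sqrt ((a_dim (V i))%:R / dimW%:R) : R)%:C *
  conjc (hdot (V i (ac_sec J t) (a_emb (V i) (e j))) (a_basis m)).
Proof. by rewrite /basis_fun /matrix_elt a_emb_basis. Qed.

(** With amplitudes scaled by the first root, the normalisation of the basis functions, which is the
    second root, restores the coefficient dim V of [partial_field]. *)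
Lemma sqrt_dims (a b : R) : 0 <= a -> 0 < b -> Num.sqrt (a * b) * Num.sqrt (a / b) = a.
Proof.
move=> a0 b0; rewrite -sqrtrM ?mulr_ge0 ?(ltW b0)//.
rewrite (_ : a * b * (a / b) = a ^+ 2) ?sqrtr_sqr ?ger0_norm//.
by field; rewrite gt_eqF.
Qed.

Lemma invariant_field_expansion : ms_continuous P X -> wide_sense_invariant P X ->
  exists (Z : forall i : I, 'I_(a_dim (V i)) -> 'I_dimW -> Omega -> R[i]) (Q : I -> 'M[R[i]]_dimW),
      [/\ forall i m k, square_integrable P (Z i m k),
          forall t j, ac_dom J t ->
            L2_sum P
              (fun i w => \sum_m \sum_k Z i m k w * basis_fun J m j t)
              (field_coord e J X j t),
          forall i m k, ~ is_trivial (V i) -> cexpect P (Z i m k) = 0,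
          forall i i' m m' k k',
            cexpect P (fun w => Z i m k w * (Z i' m' k' w)^*) =
            ((i == i') && (m == m' :> nat))%:R * Q i k k'
        & (\esum_(i in [set: I])
             ((a_dim (V i))%:R * complex.Re (\tr (Q i)))%:E < +oo)%E].
Proof.
move=> [msS msC] [invm invc].
have [k0 _] := index_exists.
have SD := cdot_semidot P.
have fS g v : cl2 P (f g v) by exact: msS.
have f_inv h g g' v v' : cdot P (f (h * g)%g v) (f (h * g')%g v') = cdot P (f g v) (f g' v').
  by have := invc h (bcls W g v) (bcls W g' v'); rewrite !bact_cls.
have f_mean g v : cexpect P (f g v) = cexpect P (f 1%g v).
  by have := invm g (bcls W 1%g v); rewrite bact_cls mulg1.
have f_cont v : hcont (cdot P) (fun g => f g v).
  move=> t eps eps0; have e20 : 0 < eps ^+ 2 by rewrite exprn_gt0.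
  have h := sqmean_lt (nbhs_filter _) (msC (bcls W t v)) e20.
  have cb : bcls W g v @[g --> t] --> bcls W t v.
    have c1 : (fun g : G => (g, v)) @ t --> (t, v).
      by apply: cvg_pair; [exact: cvg_id|exact: cvg_cst].
    exact: (cvg_comp _ _ c1 (bcls_continuous (W := W) (x := (t, v)))).
  have {}h : \forall u \near t, (sqmean P (fun w => f u v w - f t v w)%R < (eps ^+ 2)%:E)%E := cb _ h.
  near=> u; have hu : (sqmean P (fun w => f u v w - f t v w)%R < (eps ^+ 2)%:E)%E by near: u.
  have Su : cl2 P (f u v - f t v) by exact: (sdB SD).
  rewrite -ltr_sqr ?nnegrE ?hnorm_ge0 ?(ltW eps0)// (sqr_hnorm SD)// -lte_fin -sqmeanE//.
have [om [y [hy om0 [B hB] yy small]]] := equivariant_expansion k0 Gc massiveK irrW onbe dualV SD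
  (@cl2_complete _ _ _ P) fS (fieldv_linear X) (fieldv_K X) f_inv f_cont.
have yS i m : cl2 P (y i m) by have [] := hy i m.
have dimW0 : 0 < dimW%:R :> R by rewrite ltr0n; exact: leq_ltn_trans (ltn_ord k0).
have d0 i : 0 < (a_dim (V i))%:R :> R.
  by rewrite ltr0n; exact: leq_ltn_trans (ltn_ord (a_idx (V i) k0)).
pose c i : R := Num.sqrt ((a_dim (V i))%:R * dimW%:R).
pose Z i (m : 'I_(a_dim (V i))) (k : 'I_dimW) w : R[i] :=
  (k == k0)%:R * ((c i)%:C * conjc (y i m w)).
(* The single nonzero entry is [c i ^+ 2] times the squared norm of [y], which is [om i] divided by
   the squared dimension of [V i]. *)
pose Q i : 'M[R[i]]_dimW := \matrix_(k, k')
  (((k == k0) && (k' == k0))%:R * (dimW%:R * om i / (a_dim (V i))%:R)%:C).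
exists Z, Q; split.
- move=> i m k; have -> : Z i m k = ((k == k0)%:R * (c i)%:C) *: (fun w => conjc (y i m w)).
    by apply/funext => w; rewrite /Z mulrA.
  by apply: (sdZ SD); exact: cl2J.
- move=> t j Dt eps eps0.
  have [F0 hF0] := small (ac_sec J t) (e j) (eps / 2) (divr_gt0 eps0 (ltr0n _ 2)).
  exists F0 => F F0F; have {}hF0 := hF0 F F0F.
  pose g := ac_sec J t.
  have E : (fun w => field_coord e J X j t w -
        \sum_(i <- F) \sum_m \sum_k Z i m k w * basis_fun J m j t) =
      fun w => conjc ((f g (e j) - partial_field y F g (e j)) w).
    apply/funext => w; rewrite -[(_ - partial_field _ _ _ _) w]/(f g (e j) w - partial_field y F g (e j) w).
    rewrite rmorphB /= field_coordE//; congr (_ - _).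
    rewrite /partial_field fct_sumE conjc_sum; apply: eq_bigr => i _.
    rewrite fct_scale_sum conjc_sum; apply: eq_bigr => m _.
    rewrite (bigD1 k0)//= big1 ?addr0 => [|k kk0]; last by rewrite /Z (negbTE kk0) !mul0r.
    rewrite /Z eqxx mul1r basis_funE !conjcM conjc_nat -/g.
    rewrite -(rmorph_nat (real_complex R)) -{2}(sqrt_dims (ltW (d0 i)) dimW0) rmorphM /=.
    by rewrite -/(c i); ring.
  rewrite E sqmeanJ sqmeanE; last first.
    apply: (sdB SD) => //; exact: (partial_fieldS SD yS).
  rewrite lte_fin; apply: le_lt_trans hF0 _.
  by rewrite ltr_pdivrMr// mulr_natr mulr2n ltrDl.
- move=> i m k nontriv; have S1 : cl2 P (fun=> 1) by exact: cl2_cst.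
  (* The expectation of the field at [g] and [e k0] does not depend on [g], so the mean of a
     nontrivial matrix coefficient factors out. *)
  have y1 : cdot P (y i m) (fun=> 1) = 0.
    have [_ ym] := hy i m.
    rewrite (is_mean_dot Gc SD _ _ (yS i m) S1 ym); last 2 first.
    + by move=> g; exact: (harmonic_componentS SD fS).
    + exact: (harmonic_component_cont SD fS f_cont).
    have -> : (fun g => cdot P (harmonic_component f k0 m g) (fun=> 1)) =
        fun g => conjc (hdot (V i g (a_emb (V i) (e k0))) (a_basis m)) * cexpect P (f 1%g (e k0)).
      apply/funext => g; rewrite /harmonic_component (dotZl SD)//.
      by rewrite -cexpect_cdot f_mean.
    rewrite (meanZr Gc) ?(mean_conj Gc) ?mean_coefficient ?conjc0 ?mul0r//.
    + exact: coefficient_joint.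
    + by apply: ccontJ; exact: coefficient_joint.
  have -> : Z i m k = ((k == k0)%:R * (c i)%:C) *: (fun w => conjc (y i m w)).
    by apply/funext => w; rewrite /Z mulrA.
  rewrite cexpect_cdot (dotZl SD)//; last exact: cl2J.
  suff -> : cdot P (fun w => conjc (y i m w)) (fun=> 1) = 0 by rewrite mulr0.
  rewrite -[RHS]conjc0 -y1 -(sd_conj SD)// /cdot; congr cexpect; apply/funext => w.
  by rewrite conjc1 mulr1 mul1r.
- move=> i i' m m' k k'.
  have -> : cexpect P (fun w => Z i m k w * (Z i' m' k' w)^*) =
     ((k == k0)%:R * (c i)%:C * ((k' == k0)%:R * (c i')%:C)) * cdot P (y i' m') (y i m).
    rewrite -(dotZl SD)//; congr cexpect; apply/funext => w.
    rewrite -[(_ *: y i' m') w]/(_ * y i' m' w) /Z.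
    rewrite -[Num.conj _]/(conjc _) !conjcM !conjcK !conjc_real conjc_nat.
    by ring.
  rewrite yy mxE (eq_sym i' i) (eq_sym (m' : nat)).
  have [ii'|_] := eqVneq i i'; last by rewrite !mul0r mulr0.
  subst i'; case: (m == m' :> nat); last by rewrite !mul0r mulr0.
  have cc : (c i)%:C * (c i)%:C = ((a_dim (V i))%:R * dimW%:R)%:C.
    by rewrite -rmorphM -expr2 sqr_sqrtr// mulr_ge0// ltW.
    have -> : (k == k0)%:R * (c i)%:C * ((k' == k0)%:R * (c i)%:C) =
     ((k == k0) && (k' == k0))%:R * ((c i)%:C * (c i)%:C).
    by rewrite -mulnb natrM; ring.
  rewrite cc !rmorphM /= fmorphV /= !rmorph_nat.
  by field; rewrite pnatr_eq0 -lt0n -(ltr0n R).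
(* The factor dim V cancels the denominator in [Q], leaving [dimW] times the bounded sums of
   [om]. *)
- have trE i : (a_dim (V i))%:R * complex.Re (\tr (Q i)) = dimW%:R * om i.
    rewrite /mxtrace (bigD1 k0)//= big1 ?addr0 => [|k kk0]; last first.
      by rewrite mxE (negbTE kk0) mul0r.
    rewrite mxE eqxx mul1r /=; field.
    by rewrite gt_eqF.
  under eq_esum do rewrite trE.
  apply: (@esum_lty _ _ _ (dimW%:R * B)) => F.
  by rewrite -mulr_sumr ler_wpM2l.
Unshelve. all: by end_near. Qed.

Lemma ms_continuous_extends : ms_continuous P X -> ms_extends_from P (ac_dom J) X.
Proof.
move=> [_ msC] p _; apply: cvg_trans (msC p); apply: cvg_app; exact: cvg_within.
Qed.

End invariant_field_expansion.

Lemma bounded_sums_tail {R : realType} {I : choiceType} (u : I -> R) (B : R) :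
  (forall F : {fset I}, \sum_(i <- F) u i <= B) ->
  forall eps : R, 0 < eps -> exists F0 : {fset I}, forall F : {fset I}, (F0 `<=` F)%fset ->
    \sum_(i <- F) u i - \sum_(i <- F0) u i <= eps.
Proof.
move=> hB eps eps0; pose A := [set \sum_(i <- F) u i | F in [set: {fset I}]].
have supA : has_sup A.
  by split; [exists (\sum_(i <- fset0) u i), fset0|exists B => _ [F _ <-]].
have [_ [F0 _ <-] h] := sup_adherent eps0 supA; exists F0 => F _.
have : \sum_(i <- F) u i <= sup A by apply: (sup_upper_bound supA); exists F.
by move: h; lra.
Qed.

(** * Synthesis of an invariant field *)

Section hilbert_approximation.
Context {R : realType} {E : lmodType R[i]} {dot : E -> E -> R[i]} {S : set E}.
Hypothesis SD : semidot S dot.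

Lemma dot_dist x y x' y' (d : R) : S x -> S y -> S x' -> S y' ->
  hnorm dot (x - x') <= d -> hnorm dot (y - y') <= d ->
  Normc.normc (dot x y - dot x' y') <= d * (hnorm dot x + hnorm dot y + d).
Proof.
move=> Sx Sy Sx' Sy' hx hy.
have S1 := sdB SD Sx Sx'; have S2 := sdB SD Sy Sy'.
have -> : dot x y - dot x' y' = dot (x - x') y + dot x' (y - y').
  by rewrite (dotBl SD)// (dotBr SD)//; ring.
apply: le_trans (ler_normcD _ _) _.
have h1 := cauchy_schwarz SD S1 Sy; have h2 := cauchy_schwarz SD Sx' S2.
have h3 : hnorm dot x' <= hnorm dot x + d.
  have -> : x' = x + (x' - x) by rewrite addrC subrK.
  apply: le_trans (ler_hnormD SD Sx (sdB SD Sx' Sx)) _.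
  by rewrite lerD2l (hnormBC SD).
have h4 := hnorm_ge0 dot (x - x'); have h5 := hnorm_ge0 dot (y - y').
have h6 := hnorm_ge0 dot x'; have h7 := hnorm_ge0 dot y; have h8 := hnorm_ge0 dot x.
have h9 : hnorm dot (x - x') * hnorm dot y <= d * hnorm dot y by rewrite ler_wpM2r.
have h10 : hnorm dot x' * hnorm dot (y - y') <= (hnorm dot x + d) * d by apply: ler_pM.
by nra.
Qed.

(** Identities between inner products pass from partial sums to the field; the bound is linear in
    [d], with the norms of the limits as constants. *)
Lemma dot_eq_approx x y x1 y1 : S x -> S y -> S x1 -> S y1 ->
  (forall d : R, 0 < d -> exists a b a1 b1, [/\ [/\ S a, S b, S a1 & S b1],
     [/\ hnorm dot (x - a) <= d, hnorm dot (y - b) <= d,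
         hnorm dot (x1 - a1) <= d & hnorm dot (y1 - b1) <= d] & dot a b = dot a1 b1]) ->
  dot x y = dot x1 y1.
Proof.
move=> Sx Sy Sx1 Sy1 h; apply/eqP; rewrite -subr_eq0; apply/eqP/Normc.eq0_normc/eqP.
rewrite eq_le normc_ge0 andbT; apply/ler_addgt0Pr => eps eps0; rewrite add0r.
pose C := hnorm dot x + hnorm dot y + hnorm dot x1 + hnorm dot y1 + 2.
have C0 : 0 < C by rewrite ltr_wpDl// !addr_ge0// hnorm_ge0.
pose d := Num.min 1 (eps / C).
have d0 : 0 < d by rewrite lt_min ltr01 divr_gt0.
have d1 : d <= 1 by rewrite ge_min lexx.
have dC : d * C <= eps by rewrite -ler_pdivlMr// ge_min lexx orbT.
have [a [b [a1 [b1 [[Sa Sb Sa1 Sb1] [ha hb ha1 hb1] ab]]]]] := h d d0.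
have -> : dot x y - dot x1 y1 = (dot x y - dot a b) - (dot x1 y1 - dot a1 b1).
  by rewrite ab; ring.
apply: le_trans (ler_normcD _ _) _; rewrite normcN.
have h1 := dot_dist Sx Sy Sa Sb ha hb; have h2 := dot_dist Sx1 Sy1 Sa1 Sb1 ha1 hb1.
by move: dC; rewrite /C; nra.
Qed.

Lemma hnorm_continuous (T : topologicalType) (f : T -> E) x : (forall t, S (f t)) -> S x ->
  hcont dot f -> continuous (fun t => hnorm dot (f t - x)).
Proof.
move=> Sf Sx cf t; apply/cvgrPdist_lt => eps eps0; near=> u.
have hu : hnorm dot (f u - f t) < eps by near: u; exact: cf.
have S1 : S (f u - x) by exact: (sdB SD).
have S2 : S (f t - x) by exact: (sdB SD).
have S3 : S (f u - f t) by exact: (sdB SD).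
have S4 : S (f t - f u) by exact: (sdB SD).
have h1 := ler_hnormD SD S3 S2; have h2 := ler_hnormD SD S4 S1.
rewrite (hnormBC SD (Sf t) (Sf u)) in h2.
rewrite addrA subrK in h1; rewrite addrA subrK in h2.
by rewrite ltr_norml; apply/andP; split; lra.
Unshelve. all: by end_near. Qed.

Lemma sqn_sum_le (N : nat) (x : 'I_N -> E) : (forall k, S (x k)) ->
  sqn dot (\sum_k x k) <= N%:R * \sum_k sqn dot (x k).
Proof.
move=> Sx; have Ss : S (\sum_k x k) by exact: (sd_sum SD).
have half k l : complex.Re (dot (x k) (x l)) <= (sqn dot (x k) + sqn dot (x l)) / 2.
  by have := sqn_ge0 SD (sdB SD (Sx k) (Sx l)); rewrite (sqnB SD)//; lra.
rewrite {1}/sqn (dot_suml SD)// Re_sum.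
apply: (@le_trans _ _ (\sum_k \sum_l (sqn dot (x k) + sqn dot (x l)) / 2)).
  by apply: ler_sum => k _; rewrite (dot_sumr SD)// Re_sum; apply: ler_sum => l _.
rewrite le_eqVlt; apply/orP; left; apply/eqP.
under eq_bigr => k _ do rewrite -mulr_suml big_split /= sumr_const card_ord.
rewrite -mulr_suml big_split /= sumr_const card_ord sumrMnl [RHS]mulr_natl.
by move: (_ *+ N) => s; lra.
Qed.

End hilbert_approximation.

Section harmonic_series.
Context {R : realType} {n : nat} {G : lieGroupType R n} {K : closedSubgroup G}.
Context {H : fdHilbert R} {W : urep K H} {dimW : nat} {e : 'I_dimW -> H}.
Context {I : choiceType} {V : I -> adapted_irrep W e}.
Context {E : lmodType R[i]} {dot : E -> E -> R[i]} {S : set E}.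
Hypothesis onbe : onb (@hdot R H) e.
Hypothesis SD : semidot S dot.
Local Notation emb i := (a_emb (V i)).
Local Notation eV i := (@a_basis _ _ _ _ _ _ _ _ (V i)).
Local Notation dV i := (a_dim (V i)).
Variables (z : forall i, 'I_(dV i) -> E) (tau c : I -> R).
Hypothesis zS : forall i (m : 'I_(dV i)), S (z m).
Hypothesis zz : forall i i' (m : 'I_(dV i)) (m' : 'I_(dV i')),
  dot (z m) (z m') = ((i == i') && (m == m' :> nat))%:R * (tau i)%:C.

Let SH := fd_semidot H.

(** The conjugated partial sum of the expansion, read at the point [g, v] of the bundle; [c] is the
    normalisation of the basis functions and [tau i] the squared norm of each [z m]. *)
Definition series (F : {fset I}) g v : E :=
  \sum_(i <- F) \sum_m ((c i)%:C * hdot (V i g (emb i v)) (eV i m)) *: z m.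

Lemma seriesS F g v : S (series F g v).
Proof. by apply: (sd_sum SD) => i; apply: (sd_sum SD) => m; exact: (sdZ SD). Qed.

Lemma series_linear F g a v v' : series F g (a *: v + v') = a *: series F g v + series F g v'.
Proof.
rewrite /series scaler_sumr -big_split; apply: eq_bigr => i _ /=.
rewrite scaler_sumr -big_split; apply: eq_bigr => m _ /=.
rewrite (proj1 (a_emb_intertwiner (V i))) rep_linear// hdotDl hdotZl scalerA -scalerDl.
by congr (_ *: _); ring.
Qed.

Lemma series_K F g k v : sgset K k -> series F (g * k)%g v = series F g (W k v).
Proof.
move=> Kk; apply: eq_bigr => i _; apply: eq_bigr => m _.
by rewrite (proj2 (a_emb_intertwiner (V i)))// -(repM (V i)).
Qed.

Lemma series_dot F g v g' v' : dot (series F g v) (series F g' v') =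
  \sum_(i <- F) (c i ^+ 2 * tau i)%:C * hdot (V i g (emb i v)) (V i g' (emb i v')).
Proof.
rewrite (dot_orthogonal_family SD _ _ zS zz (fset_uniq F)).
apply: eq_bigr => i _; rewrite (onb_parseval _ _ (a_onb (V i))) !mulr_sumr.
by apply: eq_bigr => m _; rewrite conjcM conjc_real !rmorphM /=; ring.
Qed.

Lemma series_inv F h g g' v v' :
  dot (series F (h * g)%g v) (series F (h * g')%g v') = dot (series F g v) (series F g' v').
Proof.
by rewrite !series_dot; apply: eq_bigr => i _; rewrite !(repM (V i))// rep_unitary.
Qed.

(** The right-hand side is free of [g]: this makes the convergence uniform over the group. *)
Lemma series_sub (F F' : {fset I}) g v : (F `<=` F')%fset ->
  sqn dot (series F' g v - series F g v) =
  (\sum_(i <- F') c i ^+ 2 * tau i - \sum_(i <- F) c i ^+ 2 * tau i) * sqn (@hdot R H) v.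
Proof.
move=> FF'; rewrite (sum_fset_sub _ FF') [X in X * _]addrAC subrr add0r.
rewrite {1}/series (sum_fset_sub _ FF') -/(series F g v) addrAC subrr add0r.
rewrite -/(series (F' `\` F)%fset g v).
rewrite /sqn series_dot Re_sum mulr_suml; apply: eq_bigr => i _.
by rewrite isometric_embedding_dot ReM /= mul0r subr0.
Qed.

Lemma linear_onb_sum (f : H -> E) v :
  (forall a v v', f (a *: v + v') = a *: f v + f v') ->
  f v = \sum_j hdot v (e j) *: f (e j).
Proof.
move=> fl; have f0 : f 0 = 0.
  have := fl 1 0 0; rewrite !scale1r addr0 => /eqP.
  by rewrite -subr_eq0 opprD addNKr oppr_eq0 => /eqP.
rewrite {1}(proj2 onbe v).
elim: (index_enum _) => [|j s ih]; first by rewrite !big_nil.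
by rewrite !big_cons fl ih.
Qed.

Lemma series_cont F : hcont dot (fun x : G * H => series F x.1 x.2).
Proof.
have zc i (m : 'I_(dV i)) v : hcont dot (fun g => ((c i)%:C * hdot (V i g (emb i v)) (eV i m)) *: z m).
  apply: (hcontZ SD) => //; last exact: (hcont_cst SD).
  by apply: ccontZ; exact: coefficient_joint.
have gc v : hcont dot (fun g => series F g v).
  apply: (hcont_sum SD) => [i t|i]; first by apply: (sd_sum SD) => m; exact: (sdZ SD).
  by apply: (hcont_sum SD) => // m t; exact: (sdZ SD).
have -> : (fun x : G * H => series F x.1 x.2) =
    fun x => \sum_j hdot x.2 (e j) *: series F x.1 (e j).
  by apply/funext => x; exact: (linear_onb_sum x.2 (series_linear F x.1)).
apply: (hcont_sum SD) => [j t|j]; first by apply: (sdZ SD); exact: seriesS.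
apply: (hcontZ SD) => [t||]; first exact: seriesS.
  apply: (hcont_dot SH) => //; last exact: (hcont_cst SH).
  by apply/hcont_continuous => x; exact: cvg_snd.
exact: (hcont_comp (fun x => cvg_fst) (gc (e j))).
Qed.

(** [D] stands for the elements over the domain of the chart. Over [D] the expansion is known at one
    point [g'] of each coset and for basis vectors only; off [D] the field is reached by
    approximation, which also has to transfer membership in [S]. *)
Variables (f : G -> H -> E) (D : set G) (B : R).
Hypothesis f_lin : forall g a v v', f g (a *: v + v') = a *: f g v + f g v'.
Hypothesis f_K : forall g k v, sgset K k -> f (g * k)%g v = f g (W k v).
Hypothesis weight_le : forall F : {fset I}, \sum_(i <- F) c i ^+ 2 * tau i <= B.
Hypothesis D_sum : forall g, D g -> exists g' k, [/\ sgset K k, g = (g' * k)%g &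
  forall j, S (f g' (e j)) /\ forall eps : R, 0 < eps -> exists F0 : {fset I}, forall F : {fset I},
    (F0 `<=` F)%fset -> hnorm dot (f g' (e j) - series F g' (e j)) < eps].
Hypothesis D_dense : forall g v (A : set G), nbhs g A -> ~ D g ->
  forall eps : R, 0 < eps -> exists g', [/\ A g', D g', S (f g' v) -> S (f g v) &
    hnorm dot (f g v - f g' v) < eps].

Let fD g v : D g -> S (f g v).
Proof.
move=> /D_sum[g' [k [Kk -> h]]]; rewrite f_K// (linear_onb_sum _ (f_lin g')).
by apply: (sd_sum SD) => j; apply: (sdZ SD); have [] := h j.
Qed.

Lemma fieldS g v : S (f g v).
Proof.
have [/fD//|nD] := pselect (D g).
by have [g' [_ /fD h + _]] := D_dense v filterT nD ltr01; apply.
Qed.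

Let approx_D (eps : R) : 0 < eps -> exists F, forall g v, D g ->
  hnorm dot (f g v - series F g v) <= eps * hnorm (@hdot R H) v.
Proof.
(* Each of the [dimW] basis vectors gets an error of [eps / N]; the added 1 keeps [N] positive. *)
move=> eps0; pose N : R := dimW%:R + 1.
have N0 : 0 < N by rewrite ltr_wpDl// ler0n.
have r0 : 0 < eps / N by rewrite divr_gt0.
have [F hF] := bounded_sums_tail weight_le (exprn_gt0 2 r0).
exists F => g v /D_sum[g' [k [Kk -> h]]]; rewrite f_K// series_K//.
have -> : hnorm (@hdot R H) v = hnorm (@hdot R H) (W k v) by rewrite /hnorm /sqn rep_unitary.
move: (W k v) => {}v.
have basis j : hnorm dot (f g' (e j) - series F g' (e j)) <= eps / N.
  apply/ler_addgt0Pr => d d0; have [Sf /(_ d d0)[F1 hF1]] := h j.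
  have SF F2 := seriesS F2 g' (e j).
  (* The set [F1] depends on [g'] and [j], but the passage from [F] to the union is controlled by
     the tail of the weights alone. *)
  have -> : f g' (e j) - series F g' (e j) = (series (F `|` F1)%fset g' (e j) - series F g' (e j)) +
      (f g' (e j) - series (F `|` F1)%fset g' (e j)) by rewrite [RHS]addrC addrA subrK.
  apply: le_trans (ler_hnormD SD _ _) _; [exact: (sdB SD)|exact: (sdB SD)|].
  apply: lerD; last by apply: ltW; apply: hF1; exact: fsubsetUr.
  rewrite hnorm_le ?(ltW r0)// series_sub ?fsubsetUl//.
  by rewrite {1}/sqn (proj1 onbe) eqxx mulr1; apply: hF; exact: fsubsetUl.
rewrite (linear_onb_sum v (f_lin g')) (linear_onb_sum v (series_linear F g')) -sumrB.
have SB j : S (f g' (e j) - series F g' (e j)).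
  by apply: (sdB SD); [have [] := h j|exact: seriesS].
under eq_bigr do rewrite -scalerBr.
apply: le_trans (ler_hnorm_sum SD _ _) _; first by move=> j; exact: (sdZ SD).
apply: (@le_trans _ _ (\sum_(j < dimW) hnorm (@hdot R H) v * (eps / N))).
  apply: ler_sum => j _; rewrite (hnormZ SD)//; apply: ler_pM => //; rewrite ?normc_ge0 ?hnorm_ge0//.
  have := @cauchy_schwarz _ _ _ _ SH v (e j) Logic.I Logic.I.
  by rewrite [hnorm _ (e j)](_ : _ = 1) ?mulr1// /hnorm /sqn (proj1 onbe) eqxx sqrtr1.
rewrite sumr_const card_ord -mulr_natl mulrCA mulrC ler_wpM2r ?hnorm_ge0//.
rewrite mulrCA ler_piMr ?(ltW eps0)// ler_pdivrMr// mul1r lerDl.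
exact: ler01.
Qed.

(** Off [D] the bound is inherited from nearby points of [D], since the finite sum is continuous and
    [f g v] is approximated by values over [D]. *)
Lemma field_approx (eps : R) : 0 < eps -> exists F, forall g v,
  hnorm dot (f g v - series F g v) <= eps * hnorm (@hdot R H) v.
Proof.
move=> eps0; have [F hF] := approx_D eps0; exists F => g v.
have [/hF//|nD] := pselect (D g).
apply/ler_addgt0Pr => d d0; have d20 : 0 < d / 2 by rewrite divr_gt0.
have near_g : \forall g' \near g, hnorm dot (series F g' v - series F g v) < d / 2.
  have c1 : (fun g' : G => (g', v)) @ g --> (g, v).
    by apply: cvg_pair; [exact: cvg_id|exact: cvg_cst].
  exact: (c1 _ (series_cont F (g, v) d20)).
have [g' [h1 Dg' _ h2]] := D_dense v near_g nD d20.
have -> : f g v - series F g v = (f g' v - series F g' v) +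
    ((f g v - f g' v) + (series F g' v - series F g v)).
  by rewrite [RHS]addrCA !addrA !subrK.
have SB1 : S (f g' v - series F g' v) by apply: (sdB SD); [exact: fieldS|exact: seriesS].
have SB2 : S (f g v - f g' v) by apply: (sdB SD); exact: fieldS.
have SB3 : S (series F g' v - series F g v) by apply: (sdB SD); exact: seriesS.
apply: le_trans (ler_hnormD SD SB1 (sdD SD SB2 SB3)) _; apply: lerD; first exact: hF.
by apply: le_trans (ler_hnormD SD SB2 SB3) _; rewrite [d]splitr lerD// ltW.
Qed.

Let approx2 v v' (d : R) : 0 < d -> exists F, forall g,
  hnorm dot (f g v - series F g v) <= d /\ hnorm dot (f g v' - series F g v') <= d.
Proof.
move=> d0; pose N := hnorm (@hdot R H) v + hnorm (@hdot R H) v' + 1.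
have hv := hnorm_ge0 (@hdot R H) v; have hv' := hnorm_ge0 (@hdot R H) v'.
have N0 : 0 < N by rewrite /N; lra.
have [F hF] := field_approx (divr_gt0 d0 N0); exists F => g.
by split; apply: le_trans (hF g _) _; rewrite -mulrA ler_piMr ?(ltW d0)// mulrC
  ler_pdivrMr// mul1r /N; lra.
Qed.

Lemma field_dot_inv h g g' v v' : dot (f (h * g)%g v) (f (h * g')%g v') = dot (f g v) (f g' v').
Proof.
apply: (dot_eq_approx SD); try exact: fieldS; move=> d d0.
have [F hF] := approx2 v v' d0.
exists (series F (h * g)%g v), (series F (h * g')%g v'), (series F g v), (series F g' v').
split; last exact: series_inv; first by split; exact: seriesS.
by split; [have [] := hF (h * g)%g|have [] := hF (h * g')%g|have [] := hF g|have [] := hF g'].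
Qed.

(** Terms of nontrivial classes are orthogonal to [u], and those of the trivial class do not change
    with [g]. With [u] the constant 1 this is the invariance of the expectation. *)
Lemma field_dot_cst u h g v : S u ->
  (forall i (m : 'I_(dV i)), ~ is_trivial (V i) -> dot (z m) u = 0) ->
  dot (f (h * g)%g v) u = dot (f g v) u.
Proof.
move=> Su zu; apply: (dot_eq_approx SD) => //; try exact: fieldS; move=> d d0.
have [F hF] := approx2 v v d0.
have uu : hnorm dot (u - u) <= d.
  by rewrite subrr /hnorm /sqn (dot0l SD) ?sqrtr0 ?ltW//; exact: (sd0 SD).
exists (series F (h * g)%g v), u, (series F g v), u; split.
- by split=> //; exact: seriesS.
- by split=> //; [have [] := hF (h * g)%g|have [] := hF g].
have term k i (m : 'I_(dV i)) : S (((c i)%:C * hdot (V i k (emb i v)) (eV i m)) *: z m).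
  exact: (sdZ SD).
have terms k i : S (\sum_m ((c i)%:C * hdot (V i k (emb i v)) (eV i m)) *: z m).
  exact: (sd_sum SD).
rewrite /series !(dot_suml SD)//; apply: eq_bigr => i _.
rewrite !(dot_suml SD)//; apply: eq_bigr => m _; rewrite !(dotZl SD)//.
have [[_ triv]|ntriv] := pselect (is_trivial (V i)); first by rewrite !triv.
by rewrite zu// !mulr0.
Qed.

Lemma field_cont : hcont dot (fun x : G * H => f x.1 x.2).
Proof.
move=> x0 eps eps0; pose N := hnorm (@hdot R H) x0.2 + 1.
have hx0 := hnorm_ge0 (@hdot R H) x0.2.
have N0 : 0 < N by rewrite /N; lra.
(* The approximation is uniform in [g] but only relative to the norm of [v]; [N] bounds this norm
   near [x0]. *)
have d0 : 0 < eps / 4 / N by rewrite !divr_gt0.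
have [F hF] := field_approx d0.
have snd_cont : hcont (@hdot R H) (fun x : G * H => x.2).
  by apply/hcont_continuous => x; exact: cvg_snd.
have e40 : 0 < eps / 4 by rewrite divr_gt0.
near=> x.
have hx : hnorm (@hdot R H) x.2 <= N.
  have -> : x.2 = (x.2 - x0.2) + x0.2 by rewrite subrK.
  apply: le_trans (ler_hnormD SH _ _) _ => //; rewrite /N addrC lerD2l ltW//.
  by near: x; exact: (snd_cont x0 1 ltr01).
have hT : hnorm dot (series F x.1 x.2 - series F x0.1 x0.2) < eps / 4.
  by near: x; exact: (series_cont F x0 e40).
have bound y : hnorm (@hdot R H) y.2 <= N -> hnorm dot (f y.1 y.2 - series F y.1 y.2) <= eps / 4.
  move=> hy; apply: le_trans (hF _ _) _; apply: le_trans (ler_wpM2l (ltW d0) hy) _.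
  by rewrite divfK// gt_eqF.
have h1 := bound x hx; have h2 : hnorm dot (f x0.1 x0.2 - series F x0.1 x0.2) <= eps / 4.
  by apply: bound; rewrite /N; lra.
have SB y : S (f y.1 y.2 - series F y.1 y.2) by apply: (sdB SD); [exact: fieldS|exact: seriesS].
have SB' : S (series F x0.1 x0.2 - f x0.1 x0.2) by apply: (sdB SD); [exact: seriesS|exact: fieldS].
have SB3 : S (series F x.1 x.2 - series F x0.1 x0.2) by apply: (sdB SD); exact: seriesS.
have -> : f x.1 x.2 - f x0.1 x0.2 = (f x.1 x.2 - series F x.1 x.2) +
    ((series F x.1 x.2 - series F x0.1 x0.2) + (series F x0.1 x0.2 - f x0.1 x0.2)).
  by rewrite !addrA !subrK.
apply: le_lt_trans (ler_hnormD SD (SB x) (sdD SD SB3 SB')) _.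
have := ler_hnormD SD SB3 SB'.
rewrite [hnorm dot (_ - f x0.1 _)](hnormBC SD (seriesS _ _ _) (fieldS _ _)).
by move: h1 h2 hT; lra.
Unshelve. all: by end_near. Qed.

End harmonic_series.

Section synthesis.
Context {R : realType} {q r : nat} {G : lieGroupType R (q + r)} {K : closedSubgroup G}.
Context {H : fdHilbert R} {W : urep K H} {dimW : nat} {e : 'I_dimW -> H}.
Context (J : adapted_chart K) {I : choiceType} {V : I -> adapted_irrep W e}.
Context d {Omega : measurableType d} (P : probability Omega R) (X : random_field W Omega).
Hypothesis irrW : irreducible K W.
Hypothesis onbe : onb (@hdot R H) e.
Variables (Z : forall i : I, 'I_(a_dim (V i)) -> 'I_dimW -> Omega -> R[i]) (Q : I -> 'M[R[i]]_dimW).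
Hypothesis Z_l2 : forall i m k, square_integrable P (@Z i m k).
Hypothesis Z_sum : forall t j, ac_dom J t ->
  L2_sum P (fun i w => \sum_m \sum_k @Z i m k w * basis_fun J m j t) (field_coord e J X j t).
Hypothesis Z_mean : forall i m k, ~ is_trivial (V i) -> cexpect P (@Z i m k) = 0.
Hypothesis Z_cov : forall i i' m m' k k',
  cexpect P (fun w => @Z i m k w * conjc (@Z i' m' k' w)) =
  ((i == i') && (m == m' :> nat))%:R * Q i k k'.
Hypothesis Q_lty :
  (\esum_(i in [set: I]) ((a_dim (V i))%:R * complex.Re (\tr (Q i)))%:E < +oo)%E.
Hypothesis X_extends : ms_extends_from P (ac_dom J) X.
Local Notation f := (fieldv X).
Local Notation dV i := (a_dim (V i)).

Let SD := cdot_semidot P.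

(** The field is only known to be measurable; square integrability is obtained from its distance to
    a square integrable variable. *)
Lemma cl2_of_diff (A B : Omega -> R[i]) : complex_rv A -> cl2 P B ->
  (sqmean P (fun w => (A w - B w)%R) < +oo)%E -> cl2 P A.
Proof.
move=> [Ar Ai] SB fin; have [[Br Bi] _] := SB.
have SAB : cl2 P (A - B).
  split=> //; split.
  - rewrite (_ : (fun w => _) = fun w => complex.Re (A w) - complex.Re (B w)).
      exact: measurable_funB.
    by apply/funext => w; rewrite -ReB.
  - rewrite (_ : (fun w => _) = fun w => complex.Im (A w) - complex.Im (B w)).
      exact: measurable_funB.
    by apply/funext => w; rewrite -ImB.
by rewrite -[A](subrK B); exact: (sdD SD).
Qed.

Lemma fieldv_complex_rv g v : complex_rv (f g v).
Proof. exact: rf_measurable. Qed.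

Definition conj_amplitude i (m : 'I_(dV i)) : Omega -> R[i] := fun w => conjc ((\sum_k Z m k) w).

Lemma conj_amplitudeS i (m : 'I_(dV i)) : cl2 P (conj_amplitude m).
Proof. by apply: cl2J; apply: (sd_sum SD) => k; exact: Z_l2. Qed.

Definition amplitude_cov i : R[i] := \sum_k \sum_k' Q i k k'.

Lemma amplitude_dot i i' (m : 'I_(dV i)) (m' : 'I_(dV i')) :
  cdot P (\sum_k Z m k) (\sum_k Z m' k) = ((i == i') && (m == m' :> nat))%:R * amplitude_cov i.
Proof.
have SZ j (l : 'I_(dV j)) k : cl2 P (Z l k) by exact: Z_l2.
rewrite (dot_suml SD)//; last exact: (sd_sum SD).
rewrite mulr_sumr; apply: eq_bigr => k _; rewrite (dot_sumr SD)// mulr_sumr.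
by apply: eq_bigr => k' _; exact: Z_cov.
Qed.

Let dV_gt0 i : (0 < dV i)%N.
Proof. by have [k0 _] := index_exists irrW onbe; exact: leq_ltn_trans (ltn_ord (a_idx (V i) k0)). Qed.

Let sumZS i (m : 'I_(dV i)) : cl2 P (\sum_k Z m k).
Proof. by apply: (sd_sum SD) => k; exact: Z_l2. Qed.

Lemma amplitude_covE i : amplitude_cov i = (complex.Re (amplitude_cov i))%:C.
Proof.
have := amplitude_dot (Ordinal (dV_gt0 i)) (Ordinal (dV_gt0 i)).
by rewrite !eqxx mul1r => <-; rewrite (dot_sqn SD).
Qed.

(** The sum of all entries of [Q i] is the variance of a sum of [dimW] variables, hence at most
    [dimW] times the sum of their variances, which is the trace. *)
Lemma amplitude_cov_bounds i : 0 <= complex.Re (amplitude_cov i) /\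
  complex.Re (amplitude_cov i) <= dimW%:R * complex.Re (\tr (Q i)).
Proof.
pose m := Ordinal (dV_gt0 i).
have E : complex.Re (amplitude_cov i) = sqn (cdot P) (\sum_k Z m k).
  by rewrite /sqn amplitude_dot !eqxx mul1r.
rewrite E; split; first exact: (sqn_ge0 SD).
apply: le_trans (sqn_sum_le SD (fun k => Z_l2 m k)) _; rewrite /mxtrace Re_sum.
rewrite le_eqVlt; apply/orP; left; apply/eqP; congr (_ * _); apply: eq_bigr => k _.
by rewrite /sqn [cdot P _ _]Z_cov !eqxx mul1r.
Qed.

Lemma conj_amplitude_dot i i' (m : 'I_(dV i)) (m' : 'I_(dV i')) :
  cdot P (conj_amplitude m) (conj_amplitude m') =
  ((i == i') && (m == m' :> nat))%:R * (complex.Re (amplitude_cov i))%:C.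
Proof.
rewrite -amplitude_covE; transitivity (cdot P (\sum_k Z m' k) (\sum_k Z m k)).
  by congr cexpect; apply/funext => w; rewrite /conj_amplitude conjcK mulrC.
rewrite amplitude_dot (eq_sym i') (eq_sym (m' : nat)).
by have [ii'|_] := eqVneq i i'; [subst i'|rewrite !mul0r].
Qed.

Let c i : R := Num.sqrt ((dV i)%:R / dimW%:R).
Let T := series (e := e) conj_amplitude c.

Let dimW_gt0 : 0 < dimW%:R :> R.
Proof. by have [k0 _] := index_exists irrW onbe; rewrite ltr0n; exact: leq_ltn_trans (ltn_ord k0). Qed.

(** The factor [dimW] lost in [amplitude_cov_bounds] is cancelled by the denominator of [c i ^+ 2],
    so the sums are bounded by those of dim V times the trace. *)
Lemma weights_bounded : exists B, forall F : {fset I},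
  \sum_(i <- F) c i ^+ 2 * complex.Re (amplitude_cov i) <= B.
Proof.
have tr0 i : 0 <= (dV i)%:R * complex.Re (\tr (Q i)).
  have [h0 h1] := amplitude_cov_bounds i.
  by rewrite mulr_ge0// -(pmulr_rge0 _ dimW_gt0); exact: le_trans h1.
have [B hB] := esum_bound tr0 Q_lty; exists B => F; apply: le_trans (hB F).
apply: ler_sum => i _; have [h0 h1] := amplitude_cov_bounds i.
rewrite /c sqr_sqrtr ?divr_ge0 ?(ltW dimW_gt0)//.
by rewrite -mulrA ler_wpM2l// mulrC ler_pdivrMr// mulrC.
Qed.

Lemma conj_field_coord (F : {fset I}) t j : ac_dom J t ->
  (fun w => field_coord e J X j t w -
     \sum_(i <- F) \sum_m \sum_k @Z i m k w * basis_fun J m j t) =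
  fun w => conjc ((f (ac_sec J t) (e j) - T F (ac_sec J t) (e j)) w).
Proof.
move=> Dt; apply/funext => w.
rewrite -[(_ - T _ _ _) w]/(f (ac_sec J t) (e j) w - T F (ac_sec J t) (e j) w).
rewrite rmorphB /= field_coordE//; congr (_ - _).
rewrite /T /series fct_sumE conjc_sum; apply: eq_bigr => i _.
rewrite fct_scale_sum conjc_sum; apply: eq_bigr => m _.
rewrite -mulr_suml basis_funE !conjcM conjc_real /conj_amplitude conjcK fct_sumE.
by rewrite mulrC.
Qed.

Lemma field_on_chart t j : ac_dom J t -> cl2 P (f (ac_sec J t) (e j)) /\
  forall eps : R, 0 < eps -> exists F0 : {fset I}, forall F : {fset I}, (F0 `<=` F)%fset ->
    hnorm (cdot P) (f (ac_sec J t) (e j) - T F (ac_sec J t) (e j)) < eps.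
Proof.
move=> Dt; have ST F g v : cl2 P (T F g v) by exact: (seriesS SD _ conj_amplitudeS).
have conv (eps : R) : 0 < eps -> exists F0 : {fset I}, forall F : {fset I}, (F0 `<=` F)%fset ->
    (sqmean P (f (ac_sec J t) (e j) - T F (ac_sec J t) (e j))%R < eps%:E)%E.
  move=> eps0; have [F0 hF0] := Z_sum j Dt eps0; exists F0 => F /hF0.
  by rewrite conj_field_coord// sqmeanJ.
have Sf : cl2 P (f (ac_sec J t) (e j)).
  have [F0 /(_ F0 (fsubset_refl _)) h] := conv 1 ltr01.
  apply: (cl2_of_diff (fieldv_complex_rv _ _) (ST F0 (ac_sec J t) (e j))).
  exact: lt_trans h (ltry _).
split=> // eps eps0; have [F0 hF0] := conv _ (exprn_gt0 2 eps0); exists F0 => F /hF0.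
have SB : cl2 P (f (ac_sec J t) (e j) - T F (ac_sec J t) (e j)) by exact: (sdB SD).
rewrite sqmeanE// lte_fin => h.
by rewrite -ltr_sqr ?nnegrE ?hnorm_ge0 ?(ltW eps0)// (sqr_hnorm SD).
Qed.

Let D : set G := [set g | ac_dom J (coset K g)].

Lemma field_D_sum g : D g -> exists g' k, [/\ sgset K k, g = (g' * k)%g &
  forall j, cl2 P (f g' (e j)) /\ forall eps : R, 0 < eps -> exists F0 : {fset I},
    forall F : {fset I}, (F0 `<=` F)%fset -> hnorm (cdot P) (f g' (e j) - T F g' (e j)) < eps].
Proof.
move=> Dg; exists (ac_sec J (coset K g)), ((ac_sec J (coset K g))^-1 * g)%g; split.
- by apply/coset_eq; case: Dg => g0 Dg0 <-; exact: ac_sec_coset.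
- by rewrite mulVKg.
- by move=> j; exact: field_on_chart.
Qed.

(** The extension condition gives a neighbourhood in the bundle. Pulled back along the map from [g']
    to [g', v], it meets the dense domain of the chart inside [A]. *)
Lemma field_D_dense g v (A : set G) : nbhs g A -> ~ D g ->
  forall eps : R, 0 < eps -> exists g', [/\ A g', D g', cl2 P (f g' v) -> cl2 P (f g v) &
    hnorm (cdot P) (f g v - f g' v) < eps].
Proof.
move=> gA nD eps eps0.
have nD' : ~ ac_dom J (bproj (bcls W g v)) by rewrite bproj_cls.
have h := sqmean_lt (within_filter _ (nbhs_filter _)) (X_extends nD') (exprn_gt0 2 eps0).
have c1 : (fun g' : G => (g', v)) @ g --> (g, v).
  by apply: cvg_pair; [exact: cvg_id|exact: cvg_cst].
have cb : bcls W g' v @[g' --> g] --> bcls W g v.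
  exact: (cvg_comp _ _ c1 (bcls_continuous (W := W) (x := (g, v)))).
have {}h : \forall g' \near g, ac_dom J (bproj (bcls W g' v)) ->
  (sqmean P (fun w => (f g' v w - f g v w)%R) < (eps ^+ 2)%:E)%E := cb _ h.
have dns A' : nbhs g A' -> exists g', A' g' /\ cdom J g'.
  rewrite nbhsE => -[U [oU Ug] UA'].
  have [|g' [Og' Dg']] := @ac_dense _ _ _ _ _ J U _ oU; first by exists g.
  by exists g'; split=> //; exact: UA'.
have [g' [[Ag' hg'] Dg']] := dns _ (filterI gA h).
have DDg' : D g' by exists g'.
rewrite bproj_cls in hg'; have {}hg' := hg' DDg'.
have hsym : sqmean P (fun w => f g v w - f g' v w) = sqmean P (fun w => f g' v w - f g v w).
  rewrite /sqmean; congr expectation; apply/funext => w.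
  by rewrite !ReB !ImB; ring.
have fin : (sqmean P (fun w => (f g v w - f g' v w)%R) < +oo)%E.
  by rewrite hsym; exact: lt_trans hg' (ltry _).
have Sg' : cl2 P (f g' v).
  have [g1 [k [Kk -> hj]]] := field_D_sum DDg'; rewrite fieldv_K//.
  rewrite (linear_onb_sum onbe _ (fieldv_linear X g1)); apply: (sd_sum SD) => j.
  by apply: (sdZ SD); have [] := hj j.
have Sg : cl2 P (f g v) by exact: (cl2_of_diff (fieldv_complex_rv _ _) Sg' fin).
exists g'; split=> //.
have SB : cl2 P (f g v - f g' v) by exact: (sdB SD).
rewrite -ltr_sqr ?nnegrE ?hnorm_ge0 ?(ltW eps0)// (sqr_hnorm SD)// -lte_fin -sqmeanE//.
by rewrite -[sqmean _ _]/(sqmean P (fun w => f g v w - f g' v w)) hsym.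
Qed.

Lemma invariant_field_synthesis : ms_continuous P X /\ wide_sense_invariant P X.
Proof.
have [B hB] := weights_bounded.
have Sf := fieldS onbe SD (fieldv_linear X) (fieldv_K X) field_D_sum field_D_dense.
have inv := field_dot_inv onbe SD conj_amplitudeS conj_amplitude_dot (fieldv_linear X) (fieldv_K X) hB
  field_D_sum field_D_dense.
have mean0 := field_dot_cst onbe SD conj_amplitudeS conj_amplitude_dot (fieldv_linear X) (fieldv_K X) hB
  field_D_sum field_D_dense.
have cont := field_cont onbe SD conj_amplitudeS conj_amplitude_dot (fieldv_linear X) (fieldv_K X) hB
  field_D_sum field_D_dense.
have S1 : cl2 P (fun=> 1) by exact: cl2_cst.
split; split.
- by move=> p; rewrite -fieldv_repr; exact: Sf.
- move=> p; apply: (cvg_sqmean (nbhs_filter p)) => [p'|eps eps0]; first exact: sqmean_ge0.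
  have near_p : \forall p' \near p, hnorm (cdot P) (scalar_field X p' - scalar_field X p) < Num.sqrt eps.
    (* The distance to the value at [p] is a real function on the quotient, so its continuity can be
       checked on [G * H], where [field_cont] applies. *)
    pose h (p' : bundle W) := hnorm (cdot P) (scalar_field X p' - scalar_field X p).
    have hc : continuous h.
      apply/quotient_continuous.
      rewrite (_ : h \o _ = fun x : G * H => hnorm (cdot P) (f x.1 x.2 - scalar_field X p)); last first.
        by apply/funext => -[g v].
      apply: (hnorm_continuous SD (f := fun x : G * H => f x.1 x.2) (fun x => Sf x.1 x.2) _ cont).
      by rewrite -fieldv_repr; exact: Sf.
    have s0 : 0 < Num.sqrt eps by rewrite sqrtr_gt0.
    have hp : h p = 0.
      by rewrite /h subrr /hnorm /sqn (dot0l SD) ?sqrtr0//; exact: (sd0 SD).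
    have hlt : \forall p' \near p, `|h p - h p'| < Num.sqrt eps.
      by move: (hc p) => /cvgrPdist_lt; exact.
    apply: (@filterS _ (nbhs p) (nbhs_filter p) _ _ _ hlt) => p'.
    by rewrite hp sub0r normrN ger0_norm//; exact: hnorm_ge0.
  apply: (@filterS _ (nbhs p) (nbhs_filter p) _ _ _ near_p) => p' hp'.
  have SB : cl2 P (scalar_field X p' - scalar_field X p).
    by apply: (sdB SD); rewrite -fieldv_repr; exact: Sf.
  rewrite [X in (X < _)%E](sqmeanE SB) lte_fin -(sqr_hnorm SD SB).
  rewrite -[ltRHS](sqr_sqrtr (ltW eps0)) ltr_sqr ?nnegrE ?hnorm_ge0 ?sqrtr_ge0//.
- move=> g p; rewrite -(bcls_repr p) bact_cls !cexpect_cdot; apply: mean0 => // i m ntriv.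
  transitivity (conjc (cdot P (\sum_k Z m k) (fun=> 1))).
    rewrite -(sd_conj SD)//; congr cexpect; apply/funext => w.
    by rewrite /conj_amplitude conjc1 mulr1 mul1r.
  have Zk k : cl2 P (Z m k) by exact: Z_l2.
  rewrite (dot_suml SD)// [X in conjc X]big1 ?conjc0// => k _.
  by rewrite -cexpect_cdot; exact: Z_mean.
- move=> g p p'; rewrite -(bcls_repr p) -(bcls_repr p') !bact_cls; exact: inv.
Qed.

End synthesis.

Theorem theorem2 (R : realType) (q r : nat) (G : lieGroupType R (q + r))
    (K : closedSubgroup G) (H : fdHilbert R) (W : urep K H)
    (dimW : nat) (e : 'I_dimW -> H) (J : adapted_chart K)
    (I : choiceType) (V : I -> adapted_irrep W e)
    (d : measure_display) (Omega : measurableType d) (P : probability Omega R)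
    (X : random_field W Omega) :
  compact [set: G] -> connected [set: G] -> massive K ->
  irreducible K W -> onb (@hdot R H) e -> represents_dual V ->
  (ms_continuous P X /\ wide_sense_invariant P X)
  <->
  ((exists (Z : forall i : I, 'I_(a_dim (V i)) -> 'I_dimW -> Omega -> R[i])
           (Q : I -> 'M[R[i]]_dimW),
      [/\ forall i m k, square_integrable P (Z i m k),
          forall t j, ac_dom J t ->
            L2_sum P
              (fun i w => \sum_m \sum_k Z i m k w * basis_fun J m j t)
              (field_coord e J X j t),
          forall i m k, ~ is_trivial (V i) -> cexpect P (Z i m k) = 0,
          forall i i' m m' k k',
            cexpect P (fun w => Z i m k w * (Z i' m' k' w)^*) =
            ((i == i') && (m == m' :> nat))%:R * Q i k k'
        & (\esum_(i in [set: I])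
             ((a_dim (V i))%:R * complex.Re (\tr (Q i)))%:E < +oo)%E])
   /\ ms_extends_from P (ac_dom J) X).
Proof.
move=> Gc _ massiveK irrW onbe dualV; split=> [[msX invX]|[[Z [Q [Z2 Zsum Zmean Zcov Qlty]]] ext]].
- split; last exact: ms_continuous_extends.
  exact: (invariant_field_expansion J Gc massiveK irrW onbe dualV msX invX).
- exact: (invariant_field_synthesis irrW onbe Z2 Zsum Zmean Zcov Qlty ext).
Qed.
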